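(* Let $U$ and $V$ be vertex operator algebras, and let $\mathcal{U}$, $\mathcal{V}$, and $\mathcal{D}$ be categories of generalized $U$-modules, $V$-modules, and $U\otimes V$-modules, respectively, such that: (i) all objects of $\mathcal{D}$ decompose into generalized eigenspaces for $L_U(0)$ and for $L_V(0)$; (ii) if $M\in\mathrm{Ob}(\mathcal{U})$ and $W\in\mathrm{Ob}(\mathcal{V})$, then $M\otimes W\in\mathrm{Ob}(\mathcal{D})$; (iii) the conformal weights of any object in $\mathcal{U}$ or $\mathcal{V}$ are contained in finitely many cosets of $\mathbb{C}/\mathbb{Z}$; (iv) if $\mathcal{Y}$ is a $U$-module intertwining operator of type $\binom{X}{M_1\,M_2}$ where $M_1,M_2\in\mathrm{Ob}(\mathcal{U})$ and $X\in\mathrm{Ob}(\mathcal{D})$, then $\mathrm{Im}\,\mathcal{Y}\in\mathrm{Ob}(\mathcal{U})$; similarly, if $\mathcal{Y}$ is a $V$-module intertwining operator of type $\binom{X}{W_1\,W_2}$ where $W_1,W_2\in\mathrm{Ob}(\mathcal{V})$ and $X\in\mathrm{Ob}(\mathcal{D})$, then $\mathrm{Im}\,\mathcal{Y}\in\mathrm{Ob}(\mathcal{V})$. Let $(M_1\boxtimes_U M_2,\mathcal{Y}_{M_1,M_2})$ be a fusion product of $M_1$ and $M_2$ in $\mathcal{U}$ and let $(W_1\boxtimes_V W_2,\mathcal{Y}_{W_1,W_2})$ be a fusion product of $W_1$ and $W_2$ in $\mathcal{V}$. Then $$((M_1\boxtimes_U M_2)\otimes(W_1\boxtimes_V W_2),\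 \mathcal{Y}_{M_1,M_2}\otimes\mathcal{Y}_{W_1,W_2})$$ is a fusion product of $M_1\otimes W_1$ and $M_2\otimes W_2$ in $\mathcal{D}$.
   Context: Everything is over $\mathbb{C}$. A vertex operator algebra (VOA) is $V=\bigoplus_{n\in\mathbb{Z}}V_{(n)}$ with $\dim V_{(n)}<\infty$ and $V_{(n)}=0$ for $n\ll 0$, vertex operators $Y_V(v,x)=\sum_{n\in\mathbb{Z}}v_n\,x^{-n-1}$, vacuum $\mathbf{1}$ and conformal vector $\omega$ with $Y_V(\omega,x)=\sum_n L(n)x^{-n-2}$, where $V_{(n)}$ is the $L(0)$-eigenspace of eigenvalue $n$. A weak $V$-module is a module $(W,Y_W)$ for $V$ viewed as a vertex algebra, with no grading assumed. A generalized $V$-module is a weak $V$-module that is the direct sum of its generalized $L(0)$-eigenspaces $W_{[h]}$, $h\in\mathbb{C}$; the $h$ with $W_{[h]}\neq 0$ are its conformal weights. Categories of modules are full subcategories closed under isomorphisms. $U\otimes V$ is a VOA with $Y_{U\otimes V}(u\otimes v,x)=Y_U(u,x)\otimes Y_V(v,x)$, vacuum $\mathbf{1}_U\otimes\mathbf{1}_V$ and conformal vector $\omega_U\otimes\mathbf{1}_V+\mathbf{1}_U\otimes\omega_V$; $M\otimes W$ is a $U\otimes V$-module with $Y(u\otimes v,x)=Y_M(u,x)\otimes Y_W(v,x)$. A $U\otimes V$-module $X$ restricts to a weak $U$-module and a weak $V$-module via $u\mapsto u\otimes\mathbf{1}_V$ and $v\mapsto\mathbf{1}_U\otimes v$; $L_U(0)$,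 $L_V(0)$ are the Virasoro zero-modes on $X$ coming from $\omega_U$, $\omega_V$. An intertwining operator of type $\binom{W_3}{W_1\,W_2}$ among weak $V$-modules is a linear map $\mathcal{Y}:W_1\otimes W_2\to W_3[\log x]\{x\}$, $\mathcal{Y}(w_1,x)w_2=\sum_{h\in\mathbb{C}}\sum_{k\in\mathbb{N}}(w_1)^{\mathcal{Y}}_{h;k}w_2\,x^{-h-1}(\log x)^k$, satisfying lower truncation (for all $w_1,w_2,h$, $(w_1)^{\mathcal{Y}}_{h+n;k}w_2=0$ for all $k$ and all sufficiently large $n\in\mathbb{Z}$), the Jacobi identity $x_0^{-1}\delta(\frac{x_1-x_2}{x_0})Y_{W_3}(v,x_1)\mathcal{Y}(w_1,x_2)-x_0^{-1}\delta(\frac{-x_2+x_1}{x_0})\mathcal{Y}(w_1,x_2)Y_{W_2}(v,x_1)=x_2^{-1}\delta(\frac{x_1-x_0}{x_2})\mathcal{Y}(Y_{W_1}(v,x_0)w_1,x_2)$ with $\delta(x)=\sum_{n\in\mathbb{Z}}x^n$, and $\frac{d}{dx}\mathcal{Y}(w_1,x)=\mathcal{Y}(L(-1)w_1,x)$. $\mathrm{Im}\,\mathcal{Y}\subseteq W_3$ is the span of all coefficients $(w_1)^{\mathcal{Y}}_{h;k}w_2$. For a $U$-module intertwining operator $\mathcal{Y}_U$ and a $V$-module intertwining operator $\mathcal{Y}_V$, $(\mathcal{Y}_U\otimes\mathcal{Y}_V)(m_1\otimes w_1,x)(m_2\otimes w_2)=\mathcal{Y}_U(m_1,x)m_2\otimes\mathcal{Y}_V(w_1,x)w_2$.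 A fusion product of $W_1,W_2$ in a category $\mathcal{C}$ of generalized $V$-modules is a pair $(W_1\boxtimes W_2,\mathcal{Y}_{W_1,W_2})$ with $W_1\boxtimes W_2\in\mathrm{Ob}(\mathcal{C})$ and $\mathcal{Y}_{W_1,W_2}$ an intertwining operator of type $\binom{W_1\boxtimes W_2}{W_1\,W_2}$, such that for any $W_3\in\mathrm{Ob}(\mathcal{C})$ and intertwining operator $\mathcal{Y}$ of type $\binom{W_3}{W_1\,W_2}$ there is a unique module homomorphism $f:W_1\boxtimes W_2\to W_3$ with $f\circ\mathcal{Y}_{W_1,W_2}=\mathcal{Y}$. *)

(* Defs.v *)
From HB Require Import structures.
From mathcomp Require Import all_boot all_order all_algebra.
From mathcomp Require Import all_classical all_reals.
From mathcomp Require Import complex.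

Set Implicit Arguments.
Unset Strict Implicit.
Unset Printing Implicit Defensive.

Import Order.TTheory GRing.Theory Num.Theory.
Local Open Scope classical_set_scope.
Local Open Scope quotient_scope.
Local Open Scope ring_scope.

(******************************************************************************)
(* Conventions. A formal series is represented by the family of its           *)
(* coefficients, and an identity of formal series by the equality of the      *)
(* coefficients of every monomial. Infinite sums of coefficients are written  *)
(* with the finitely supported sum \sum_(i \in A) of fsbigop; whenever the    *)
(* lower truncation axioms hold, the sums below have finite support.          *)
(*                                                                            *)
(* Structures are split into data (voa_data, module_data) and axioms          *)
(* (is_VOA, is_weak_module, ...), so that tensor products, restrictions and   *)
(* images are plain constructions on data.                                    *)
(******************************************************************************)

Section LinearAlgebra.
Variable K : fieldType.

Definition is_bilinear (M W P : lmodType K) (f : M -> W -> P) : Prop :=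
  (forall w, linear (f ^~ w)) /\ (forall m, linear (f m)).

Definition span (X : lmodType K) (G : set X) : pred X :=
  fun x => `[< exists s : seq (K * X),
    (forall p, p \in s -> G p.2) /\ x = \sum_(p <- s) p.1 *: p.2 >].

(* W is the internal direct sum of the subspaces S i: every vector is in a    *)
(* unique way a finite sum of vectors f i in S i.                             *)
Definition direct_sum (W : lmodType K) (I : choiceType) (S : I -> set W) :=
  forall w : W, exists! f : I -> W,
    [/\ finite_set [set i | f i != 0], forall i, S i (f i)
      & w = \sum_(i \in [set: I]) f i].

Definition eigenspace (W : lmodType K) (L : W -> W) (a : K) : set W :=
  [set w | L w = a *: w].

Definition gen_eigenspace (W : lmodType K) (L : W -> W) (a : K) : set W :=
  [set w | exists N, iter N (fun x => L x - a *: x) w = 0].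

Lemma span_submod_closed (X : lmodType K) (G : set X) :
  GRing.subsemimod_closed (span G).
Proof.
split; first split.
- by apply/asboolP; exists [::]; split=> //; rewrite big_nil.
- move=> x y /asboolP[s [sG ->]] /asboolP[t [tG ->]].
  apply/asboolP; exists (s ++ t); rewrite big_cat; split=> // p.
  by rewrite mem_cat => /orP[/sG|/tG].
- move=> a x /asboolP[s [sG ->]].
  apply/asboolP; exists [seq (a * p.1, p.2) | p <- s]; split.
    by move=> p /mapP[q /sG Gq ->].
  by rewrite big_map scaler_sumr; apply: eq_bigr => p _; rewrite scalerA.
Qed.

End LinearAlgebra.

(* The span of G as a vector space in its own right. *)
Section SpanType.
Variables (K : fieldType) (X : lmodType K) (G : set X).

HB.instance Definition _ :=
  GRing.isSubmodClosed.Build K X (span G) (span_submod_closed G).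

Record span_type := SpanElt { span_val :> X; span_valP : span_val \in span G }.

HB.instance Definition _ := [isSub for span_val].
HB.instance Definition _ := [Choice of span_type by <:].
HB.instance Definition _ := [SubChoice_isSubLmodule of span_type by <:].

End SpanType.

(******************************************************************************)
(* The tensor product of vector spaces. Its elements are the classes of       *)
(* formal sums of pairs (m, w), two formal sums being identified when every   *)
(* bilinear map to a vector space takes the same value on them.               *)
(******************************************************************************)
Section Tensor.
Variables (K : fieldType) (M W : lmodType K).

Definition bisum (P : lmodType K) (f : M -> W -> P) (s : seq (M * W)) : P :=
  \sum_(p <- s) f p.1 p.2.

Definition tensor_rel (s t : seq (M * W)) : bool :=
  `[< forall (P : lmodType K) (f : M -> W -> P),
        is_bilinear f -> bisum f s = bisum f t >].

Lemma tensor_rel_refl : reflexive tensor_rel.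
Proof. by move=> s; apply/asboolP. Qed.

Lemma tensor_rel_sym : symmetric tensor_rel.
Proof. by move=> s t; apply/asboolP/asboolP => st P f bf; rewrite st. Qed.

Lemma tensor_rel_trans : transitive tensor_rel.
Proof.
move=> t s u /asboolP st /asboolP tu.
by apply/asboolP => P f bf; rewrite st // tu.
Qed.

Canonical tensor_equiv :=
  EquivRel tensor_rel tensor_rel_refl tensor_rel_sym tensor_rel_trans.

Definition tensor := {eq_quot tensor_equiv}.

HB.instance Definition _ := Choice.on tensor.
HB.instance Definition _ := EqQuotient.on tensor.

Definition tpure (m : M) (w : W) : tensor := \pi_tensor [:: (m, w)].

(* The linear map induced by a bilinear map f, see tlift_linear, tliftE. *)
Definition tlift (P : lmodType K) (f : M -> W -> P) (t : tensor) : P :=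
  bisum f (repr t).

Definition tzero : tensor := \pi_tensor [::].
Definition tadd (s t : tensor) : tensor := \pi_tensor (repr s ++ repr t).
Definition tscale (a : K) (t : tensor) : tensor :=
  \pi_tensor [seq (a *: p.1, p.2) | p <- repr t].

Lemma tlift_pi (P : lmodType K) (f : M -> W -> P) s :
  is_bilinear f -> tlift f (\pi_tensor s) = bisum f s.
Proof.
move=> bf; have : tensor_rel (repr (\pi_tensor s)) s.
  by rewrite -/(equiv tensor_equiv _ _) -eqmodE reprK.
by move/asboolP; apply.
Qed.

Lemma tensor_eq (s t : tensor) :
  (forall (P : lmodType K) (f : M -> W -> P),
     is_bilinear f -> tlift f s = tlift f t) -> s = t.
Proof. by move=> st; rewrite -[s]reprK -[t]reprK; apply/eqmodP/asboolP. Qed.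

Lemma tlift0 (P : lmodType K) (f : M -> W -> P) :
  is_bilinear f -> tlift f tzero = 0.
Proof. by move=> bf; rewrite tlift_pi // /bisum big_nil. Qed.

Lemma tliftD (P : lmodType K) (f : M -> W -> P) s t :
  is_bilinear f -> tlift f (tadd s t) = tlift f s + tlift f t.
Proof. by move=> bf; rewrite tlift_pi // /bisum big_cat. Qed.

Lemma tliftZ (P : lmodType K) (f : M -> W -> P) a t :
  is_bilinear f -> tlift f (tscale a t) = a *: tlift f t.
Proof.
move=> bf; rewrite tlift_pi // /bisum big_map scaler_sumr.
apply: eq_bigr => p _ /=.
by case: bf => /(_ p.2)/scalable_linear/(_ a p.1).
Qed.

Lemma taddA : associative tadd.
Proof. by move=> s t u; apply: tensor_eq => P f bf; rewrite !tliftD // addrA. Qed.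
Lemma taddC : commutative tadd.
Proof. by move=> s t; apply: tensor_eq => P f bf; rewrite !tliftD // addrC. Qed.
Lemma tadd0 : left_id tzero tadd.
Proof.
by move=> s; apply: tensor_eq => P f bf; rewrite tliftD // tlift0 // add0r.
Qed.
Lemma taddN : left_inverse tzero (tscale (-1)) tadd.
Proof.
move=> s; apply: tensor_eq => P f bf.
by rewrite tliftD // tliftZ // tlift0 // scaleN1r addNr.
Qed.

HB.instance Definition _ :=
  GRing.isZmodule.Build tensor taddA taddC tadd0 taddN.

Lemma tscaleA a b t : tscale a (tscale b t) = tscale (a * b) t.
Proof. by apply: tensor_eq => P f bf; rewrite !tliftZ // scalerA. Qed.
Lemma tscale1 : left_id 1 tscale.
Proof. by move=> t; apply: tensor_eq => P f bf; rewrite tliftZ // scale1r. Qed.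
Lemma tscaleDr : right_distributive tscale +%R.
Proof.
move=> a s t; apply: tensor_eq => P f bf.
by rewrite [LHS]tliftZ // !tliftD // !tliftZ // scalerDr.
Qed.
Lemma tscaleDl t : {morph tscale^~ t : a b / a + b}.
Proof.
move=> a b; apply: tensor_eq => P f bf.
by rewrite [LHS]tliftZ // [RHS]tliftD // !tliftZ // scalerDl.
Qed.

HB.instance Definition _ :=
  GRing.Zmodule_isLmodule.Build K tensor tscaleA tscale1 tscaleDr tscaleDl.

(* The universal property. *)
Lemma tpure_bilinear : is_bilinear tpure.
Proof.
split=> [w a m m'|m a w w']; apply: tensor_eq => P f bf;
  rewrite [RHS]tliftD // [X in _ = X + _]tliftZ // !tlift_pi // /bisum !big_seq1;
  by case: bf => fl fr; first [exact: fl | exact: fr].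
Qed.

Lemma tlift_linear (P : lmodType K) (f : M -> W -> P) :
  is_bilinear f -> linear (tlift f).
Proof.
by move=> bf a s t; rewrite [LHS]tliftD // [X in X + _ = _]tliftZ.
Qed.

Lemma tliftE (P : lmodType K) (f : M -> W -> P) m w :
  is_bilinear f -> tlift f (tpure m w) = f m w.
Proof. by move=> bf; rewrite tlift_pi // /bisum big_seq1. Qed.

Lemma tensor_spanned (t : tensor) :
  exists s : seq (M * W), t = \sum_(p <- s) tpure p.1 p.2.
Proof.
exists (repr t); apply: tensor_eq => P f bf; rewrite {1}/tlift /bisum.
elim: (repr t) => [|p s IH]; first by rewrite !big_nil [RHS]tlift0.
by rewrite !big_cons IH [RHS]tliftD // tliftE.
Qed.

End Tensor.

(******************************************************************************)
(* Vertex operator algebras and modules                                       *)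
(******************************************************************************)

(* vmode v n w is v_n w, where Y(v, x) = \sum_n v_n x^(-n-1). *)
Record voa_data (K : fieldType) := VOAData {
  vcarrier :> lmodType K;
  vmode : vcarrier -> int -> vcarrier -> vcarrier;
  vacuum : vcarrier;
  conformal : vcarrier }.

Record module_data (K : fieldType) (V : voa_data K) := ModuleData {
  carrier :> lmodType K;
  act : V -> int -> carrier -> carrier }.

Section VOA.
Variable K : fieldType.

Definition adjoint (V : voa_data K) : module_data V :=
  ModuleData (@vmode K V).

(* Lmode V W n is the Virasoro mode L(n) acting on W. *)
Definition Lmode (V : voa_data K) (W : module_data V) (n : int) : W -> W :=
  act (conformal V) (n + 1).

Definition binz (l : int) (i : nat) : K :=
  (\prod_(0 <= j < i) (l%:~R - j%:R)) / (i`!)%:R.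

(* The Jacobi identity for a map I with coefficients I w1 h w2 at x^(-h-1),   *)
(* the exponents h running through A (the integers for vertex operators, the  *)
(* field K for intertwining operators): the equation below compares the       *)
(* coefficients of x0^(-l-1) x1^(-m-1) x2^(-h-1), the delta functions being   *)
(* expanded by the binomial theorem in nonnegative powers of their second     *)
(* variable; on the right, (-1)^i * binz (i - m - 1) i = binz m i.            *)
Definition jacobi (A : pzRingType) (V W1 W2 W3 : lmodType K)
    (Y1 : V -> int -> W1 -> W1) (Y2 : V -> int -> W2 -> W2)
    (Y3 : V -> int -> W3 -> W3) (I : W1 -> A -> W2 -> W3) : Prop :=
  forall (v : V) (w1 : W1) (w2 : W2) (l m : int) (h : A),
    \sum_(i \in [set: nat])
       ((-1) ^+ i * binz l i) *: Y3 v (m + l - i%:Z) (I w1 (h + i%:R) w2)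
    - \sum_(i \in [set: nat])
       ((-1) ^ (l + i%:Z) * binz l i)
         *: I w1 (h + l%:~R - i%:R) (Y2 v (m + i%:Z) w2)
    = \sum_(i \in [set: nat])
       binz m i *: I (Y1 v (l + i%:Z) w1) (h + m%:~R - i%:R) w2.

(* A module for V viewed as a vertex algebra. *)
Record is_weak_module (V : voa_data K) (W : module_data V) : Prop := {
  act_bilinear : forall n : int, is_bilinear (fun v w => act (m := W) v n w);
  act_truncated : forall (v : V) (w : W),
    exists N : int, forall n : int, N <= n -> act v n w = 0;
  act_vacuum : forall (n : int) (w : W),
    act (vacuum V) n w = if n == -1 then w else 0;
  act_jacobi : jacobi (@vmode K V) (@act K V W) (@act K V W) (@act K V W) }.

Definition weight_space (V : voa_data K) (n : int) : set V :=
  eigenspace (Lmode (W := adjoint V) 0) n%:~R.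

Record is_VOA (V : voa_data K) : Prop := {
  voa_adjoint : is_weak_module (adjoint V);
  voa_creation : forall v : V, vmode v (-1) (vacuum V) = v;
  voa_creation0 : forall (v : V) (n : int),
    0 <= n -> vmode v n (vacuum V) = 0;
  voa_virasoro : exists c : K, forall (m n : int) (v : adjoint V),
    Lmode m (Lmode n v) - Lmode n (Lmode m v)
    = (m - n)%:~R *: Lmode (m + n) v
      + (if m + n == 0 then (m ^+ 3 - m)%:~R / 12%:R * c else 0) *: v;
  voa_derivative : forall (v : adjoint V) (n : int) (w : V),
    vmode (Lmode (-1) v) n w = - (n%:~R *: vmode v (n - 1) w);
  voa_graded : direct_sum (@weight_space V);
  voa_finite_dim : forall n : int, exists s : seq V,
    forall v : V, weight_space n v <-> span [set x | x \in s] v;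
  voa_bounded_below : exists N : int, forall n : int, n < N ->
    forall v : V, weight_space n v -> v = 0 }.

Definition decomposes (W : lmodType K) (L0 : W -> W) : Prop :=
  direct_sum (gen_eigenspace L0).

Definition is_generalized_module (V : voa_data K) (W : module_data V) : Prop :=
  is_weak_module W /\ decomposes (Lmode (W := W) 0).

Definition conformal_weight (V : voa_data K) (W : module_data V) (h : K) :=
  exists2 w : W, w != 0 & gen_eigenspace (Lmode 0) h w.

Definition weights_in_finitely_many_cosets (V : voa_data K)
    (W : module_data V) : Prop :=
  exists s : seq K, forall h, conformal_weight W h ->
    exists2 a, a \in s & exists n : int, h = a + n%:~R.

Definition is_hom (V : voa_data K) (W W' : module_data V) (f : W -> W') :=
  linear f /\ forall (v : V) (n : int) (w : W), f (act v n w) = act v n (f w).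

(* A full subcategory closed under isomorphisms is given by its objects. *)
Definition is_category (V : voa_data K) (C : module_data V -> Prop) : Prop :=
  (forall W, C W -> is_generalized_module W) /\
  (forall (W W' : module_data V) (f : W -> W'),
     is_hom f -> bijective f -> C W -> C W').

(* I w1 h k w2 is the coefficient of x^(-h-1) (log x)^k in I(w1, x) w2. *)
Definition iop (V : voa_data K) (W1 W2 W3 : module_data V) :=
  W1 -> K -> nat -> W2 -> W3.

(* iop_log: the coefficient of each power of x is polynomial in log x. *)
Record is_intertwining (V : voa_data K) (W1 W2 W3 : module_data V)
    (I : iop W1 W2 W3) : Prop := {
  iop_bilinear : forall h k, is_bilinear (fun w1 w2 => I w1 h k w2);
  iop_log : forall w1 h w2,
    exists k0 : nat, forall k, (k0 <= k)%N -> I w1 h k w2 = 0;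
  iop_truncated : forall w1 w2 h,
    exists N : nat, forall n, (N <= n)%N -> forall k, I w1 (h + n%:R) k w2 = 0;
  iop_jacobi : forall k,
    jacobi (@act K V W1) (@act K V W2) (@act K V W3) (fun w1 h => I w1 h k);
  iop_derivative : forall w1 h k w2,
    I (Lmode (-1) w1) h k w2
    = - (h *: I w1 (h - 1) k w2) + k.+1%:R *: I w1 (h - 1) k.+1 w2 }.

Definition iop_coefs (V : voa_data K) (W1 W2 W3 : module_data V)
    (I : iop W1 W2 W3) : set W3 :=
  [set x | exists w1 h k w2, x = I w1 h k w2].

(* Im I with the restricted action. The image of an intertwining operator is  *)
(* stable under the modes v_n, so the default value 0 of insubd is not used.  *)
Definition image_module (V : voa_data K) (W1 W2 W3 : module_data V)
    (I : iop W1 W2 W3) : module_data V :=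
  @ModuleData K V (span_type (iop_coefs I))
    (fun v n x => insubd 0 (act v n (val x))).

Record is_fusion_product (V : voa_data K) (C : module_data V -> Prop)
    (W1 W2 P : module_data V) (Y : iop W1 W2 P) : Prop := {
  fusion_object : C P;
  fusion_intertwining : is_intertwining Y;
  fusion_universal : forall (W3 : module_data V) (I : iop W1 W2 W3),
    C W3 -> is_intertwining I ->
    exists! f : P -> W3,
      is_hom f /\ forall w1 h k w2, f (Y w1 h k w2) = I w1 h k w2 }.

End VOA.

(******************************************************************************)
(* Tensor products                                                            *)
(******************************************************************************)
Section TensorVOA.
Variables (K : fieldType) (U V : voa_data K).

(* (u (x) v)_n (m (x) w) = \sum_(i + j = n - 1) u_i m (x) v_j w *)
Definition tensor_act (M : module_data U) (W : module_data V)
    (t : tensor U V) (n : int) (x : tensor M W) : tensor M W :=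
  tlift (fun u v =>
    tlift (fun m w =>
      \sum_(i \in [set: int]) tpure (act u i m) (act v (n - 1 - i) w)) x) t.

Definition tensor_voa : voa_data K :=
  @VOAData K (tensor U V) (@tensor_act (adjoint U) (adjoint V))
    (tpure (vacuum U) (vacuum V))
    (tpure (conformal U) (vacuum V) + tpure (vacuum U) (conformal V)).

Definition tensor_module (M : module_data U) (W : module_data V) :
    module_data tensor_voa :=
  @ModuleData K tensor_voa (tensor M W) (@tensor_act M W).

Definition restrict_left (X : module_data tensor_voa) : module_data U :=
  @ModuleData K U X (fun u => @act K tensor_voa X (tpure u (vacuum V))).

Definition restrict_right (X : module_data tensor_voa) : module_data V :=
  @ModuleData K V X (fun v => @act K tensor_voa X (tpure (vacuum U) v)).

(* The coefficient of x^(-h-1) (log x)^k in I(m1, x) m2 (x) J(w1, x) w2 is    *)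
(* the sum of (m1)_(h';k') m2 (x) (w1)_(h'';k'') w2 over h' + h'' = h - 1 and *)
(* k' + k'' = k. For the conformal weights of the modules in finitely many    *)
(* cosets of Z, the sum over h' has finite support.                           *)
Definition tensor_iop (M1 M2 M3 : module_data U) (W1 W2 W3 : module_data V)
    (I : iop M1 M2 M3) (J : iop W1 W2 W3) :
    iop (tensor_module M1 W1) (tensor_module M2 W2) (tensor_module M3 W3) :=
  fun x1 h k x2 =>
    tlift (fun m1 w1 =>
      tlift (fun m2 w2 =>
        \sum_(h' \in [set: K]) \sum_(k' < k.+1)
           tpure (I m1 h' k' m2) (J w1 (h - 1 - h') (k - k')%N w2)) x2) x1.

End TensorVOA.

(* Main.v *)
(* An intertwining operator I is determined by its coefficients I_h without   *)
(* logarithms: they satisfy the Jacobi identity and shift generalized         *)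
(* L(0)-weights, and x d/dx recovers the powers of log x from the nilpotent   *)
(* part of L(0). In this form an intertwining operator Y among U (x) V-modules*)
(* into X splits: projecting to generalized L_V(0)-eigenspaces separates      *)
(* Y(m1 (x) w1, x)(m2 (x) w2) into coefficients Z_{h,h'}(m1, w1, m2, w2) which*)
(* are log-free U-intertwining in (m1, h, m2) and V-intertwining in           *)
(* (w1, h', w2). Condition (iv) and the universal properties of the two       *)
(* fusion products then extend Z to M12 in the first, and to W12 in the       *)
(* second group of variables; the extensions glue to a map on M12 (x) W12     *)
(* because M12 and W12 are spanned by the coefficients of YM and YW. That     *)
(* span property follows from (iv) applied to m |-> m (x) w, with a linear    *)
(* functional nonzero at w providing a retraction. Uniqueness holds because   *)
(* L_U(0)-weights separate the summands of the coefficients of YM (x) YW.     *)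
(* The Jacobi identity of YM (x) YW for u (x) v reduces, by a recursion, to   *)
(* weak commutativity and weak associativity, which are stable under products.*)

Require Import Defs.
From mathcomp Require Import all_boot all_order all_algebra.
From mathcomp Require Import all_classical all_reals.
From mathcomp Require Import complex.
From mathcomp Require Import finmap zify ring.

Set Implicit Arguments.
Unset Strict Implicit.
Unset Printing Implicit Defensive.
Import Order.TTheory GRing.Theory Num.Theory.
Local Open Scope classical_set_scope.
Local Open Scope ring_scope.

(** * Finitely supported sums and linear algebra *)

(** An intertwining operator for U (x) V has one variable x, to be seen as the diagonal x_U = x_V =
    x of an operator in two variables. Since L_V(0) commutes with the modes of U, the exponent of
    x_V can be read off from the L_V(0)-weight of a coefficient. Logarithms would bring in the
    nilpotent parts of L_U(0) and L_V(0); they are avoided by keeping only the coefficients of (log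
    x)^0. Nothing is lost: the Jacobi identity concerns each power of log x separately, and the
    derivative axiom with the commutator of L(0) produces the coefficient of (log x)^(k+1) from that
    of (log x)^k ([iop_raise]). Conversely every family satisfying [is_logfree] is the log-free part
    of an intertwining operator ([log_levels_intertwining]), so a fusion product also extends
    log-free families to homomorphisms ([fusion_logfree]).

    Let [Y] have its target X in D. Its splitting [split_iop] is log-free for U when the V-arguments
    are fixed and for V when the U-arguments are fixed ([split_iop_left], [split_iop_right]), and
    summing it along the diagonal gives [Y] back ([split_iop_sum]). By (iv) each slice factors
    through the fusion product, which gives maps on M12 and on W12. They fit into one bilinear map
    because coefficients span M12 and W12 ([fusion_span]). The induced linear map on M12 (x) W12
    commutes with U and with V, hence with U (x) V, whose modes are normally ordered products
    ([tensor_hom]).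

    That YM (x) YW is itself an intertwining operator rests on two facts: condition (iii) makes its
    coefficients finite sums ([iop_lowfin], [lowfin_pair]), and the Jacobi identity is stable under
    products of series ([jac_conv]). *)

Section LinearMaps.
Variables (K : fieldType) (V W : lmodType K).
Implicit Types f : V -> W.

Lemma lin0 f : linear f -> f 0 = 0.
Proof. by move=> fl; have := fl (-1) 0 0; rewrite !scaleN1r oppr0 addr0 addNr. Qed.

Lemma linZ f : linear f -> forall a x, f (a *: x) = a *: f x.
Proof. by move=> fl a x; rewrite -[a *: x]addr0 fl lin0 // addr0. Qed.

Lemma linD f : linear f -> forall x y, f (x + y) = f x + f y.
Proof. by move=> fl x y; rewrite -[x]scale1r fl !scale1r. Qed.

Lemma linN f : linear f -> forall x, f (- x) = - f x.
Proof. by move=> fl x; rewrite -scaleN1r linZ // scaleN1r. Qed.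

Lemma linB f : linear f -> forall x y, f (x - y) = f x - f y.
Proof. by move=> fl x y; rewrite linD // linN. Qed.

Lemma lin_sum f I (r : seq I) (F : I -> V) :
  linear f -> f (\sum_(i <- r) F i) = \sum_(i <- r) f (F i).
Proof.
move=> fl; elim: r => [|i r IH]; first by rewrite !big_nil lin0.
by rewrite !big_cons linD // IH.
Qed.

Lemma linear_addf f g : linear f -> linear g -> linear (fun x => f x + g x).
Proof. by move=> fl gl a x y; rewrite fl gl scalerDr addrACA. Qed.

Lemma linear_subf f g : linear f -> linear g -> linear (fun x => f x - g x).
Proof.
by move=> fl gl a x y; rewrite fl gl opprD addrACA scalerBr.
Qed.

Lemma linear_scalef f c : linear f -> linear (fun x => c *: f x).
Proof. by move=> fl a x y; rewrite fl scalerDr !scalerA mulrC. Qed.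

End LinearMaps.

Lemma linear_compf (K : fieldType) (U V W : lmodType K) (g : V -> W)
  (f : U -> V) : linear g -> linear f -> linear (fun x => g (f x)).
Proof. by move=> gl fl a x y; rewrite fl gl. Qed.

Section Bilinear.
Variables (K : fieldType) (V W P : lmodType K) (f : V -> W -> P).
Hypothesis bf : is_bilinear f.

Lemma bil0l w : f 0 w = 0. Proof. exact: (lin0 (bf.1 w)). Qed.
Lemma bil0r v : f v 0 = 0. Proof. exact: (lin0 (bf.2 v)). Qed.
Lemma bilDl w x y : f (x + y) w = f x w + f y w.
Proof. exact: (linD (bf.1 w)). Qed.
Lemma bilDr v x y : f v (x + y) = f v x + f v y.
Proof. exact: (linD (bf.2 v)). Qed.
Lemma bilZl w a x : f (a *: x) w = a *: f x w.
Proof. exact: (linZ (bf.1 w)). Qed.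
Lemma bilZr v a x : f v (a *: x) = a *: f v x.
Proof. exact: (linZ (bf.2 v)). Qed.
Lemma bilBl w x y : f (x - y) w = f x w - f y w.
Proof. exact: (linB (bf.1 w)). Qed.
Lemma bilBr v x y : f v (x - y) = f v x - f v y.
Proof. exact: (linB (bf.2 v)). Qed.
Lemma bilNl w x : f (- x) w = - f x w.
Proof. exact: (linN (bf.1 w)). Qed.
Lemma bilNr v x : f v (- x) = - f v x.
Proof. exact: (linN (bf.2 v)). Qed.

End Bilinear.

Section LmodReflection.
Variables (K : fieldType) (W : lmodType K).

(* The tactic lmod K proves linear identities in a K-module by comparing the  *)
(* coefficients of the atoms with ring; lmod_conv K also identifies atoms     *)
(* that are convertible but not syntactically equal.                          *)
Inductive mexpr :=
  | MAtom of nat | MZero | MAdd of mexpr & mexpr | MOpp of mexpr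
  | MScale of K & mexpr.

Fixpoint meval (env : seq W) (e : mexpr) : W :=
  match e with
  | MAtom n => nth 0 env n
  | MZero => 0
  | MAdd e1 e2 => meval env e1 + meval env e2
  | MOpp e1 => - meval env e1
  | MScale c e1 => c *: meval env e1
  end.

Fixpoint mcoef (n : nat) (e : mexpr) : K :=
  match e with
  | MAtom m => if Nat.eqb m n then 1 else 0
  | MZero => 0
  | MAdd e1 e2 => mcoef n e1 + mcoef n e2
  | MOpp e1 => - mcoef n e1
  | MScale c e1 => c * mcoef n e1
  end.

Fixpoint mwf (N : nat) (e : mexpr) : bool :=
  match e with
  | MAtom n => (n < N)%N
  | MZero => true
  | MAdd e1 e2 => mwf N e1 && mwf N e2
  | MOpp e1 | MScale _ e1 => mwf N e1
  end.

Lemma mevalE env e : mwf (size env) e ->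
  meval env e = \sum_(n < size env) mcoef n e *: env`_n.
Proof.
elim: e => [n||e1 IH1 e2 IH2|e1 IH1|c e1 IH1] /=.
- move=> nN; rewrite (bigD1 (Ordinal nN)) //= PeanoNat.Nat.eqb_refl scale1r big1 ?addr0 //.
  move=> i ni; case: PeanoNat.Nat.eqb_spec => [nE|_]; last by rewrite scale0r.
  by rewrite -val_eqE /= nE eqxx in ni.
- by move=> _; rewrite big1 // => i _; rewrite scale0r.
- move=> /andP[/IH1 -> /IH2 ->]; rewrite -big_split; apply: eq_bigr => i _.
  by rewrite scalerDl.
- by move=> /IH1 ->; rewrite -sumrN; apply: eq_bigr => i _; rewrite scaleNr.
by move=> /IH1 ->; rewrite scaler_sumr; apply: eq_bigr => i _; rewrite scalerA.
Qed.

Fixpoint mcheck (n : nat) (e1 e2 : mexpr) : Prop :=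
  if n is n'.+1 then mcoef n' e1 = mcoef n' e2 /\ mcheck n' e1 e2 else True.

Lemma meval_eq env e1 e2 : mwf (size env) e1 && mwf (size env) e2 ->
  mcheck (size env) e1 e2 -> meval env e1 = meval env e2.
Proof.
move=> /andP[/mevalE -> /mevalE ->] chk; apply: eq_bigr => -[i iN] _ /=.
congr (_ *: _); elim: (size env) chk iN => //= n IH [en /IH {}IH].
by rewrite ltnS leq_eqVlt => /predU1P[->|].
Qed.

End LmodReflection.

Ltac lmod_mem same x l :=
  lazymatch l with
  | ?y :: ?l' =>
    match goal with
    | _ => let __ := match goal with _ => same x y end in constr:(true)
    | _ => lmod_mem same x l'
    end
  | _ => constr:(false)
  end.

Ltac lmod_atoms same t l :=
  lazymatch t with
  | (?a + ?b)%R => let l1 := lmod_atoms same a l in lmod_atoms same b l1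
  | (- ?a)%R => lmod_atoms same a l
  | (_ *: ?a)%R => lmod_atoms same a l
  | 0%R => l
  | _ =>
    lazymatch lmod_mem same t l with true => l | false => constr:(t :: l) end
  end.

Ltac lmod_index same t l :=
  lazymatch l with
  | ?y :: ?l' =>
    match goal with
    | _ => let __ := match goal with _ => same t y end in constr:(0%N)
    | _ => let n := lmod_index same t l' in constr:(S n)
    end
  end.

Ltac lmod_reify same K t l :=
  lazymatch t with
  | (?a + ?b)%R =>
    let e1 := lmod_reify same K a l in let e2 := lmod_reify same K b l in
    constr:(MAdd e1 e2)
  | (- ?a)%R => let e := lmod_reify same K a l in constr:(MOpp e)
  | (?c *: ?a)%R => let e := lmod_reify same K a l in constr:(@MScale K c e)
  | 0%R => constr:(@MZero K)
  | _ => let n := lmod_index same t l in constr:(@MAtom K n)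
  end.

Ltac lmod_with same K :=
  lazymatch goal with
  | |- @eq ?T ?a ?b =>
    let l0 := lmod_atoms same a (@nil T) in
    let l := lmod_atoms same b l0 in
    let e1 := lmod_reify same K a l in
    let e2 := lmod_reify same K b l in
    apply: (@meval_eq K _ l e1 e2); [by [] | cbn [mcheck size mcoef Nat.eqb];
      repeat match goal with
        | |- _ /\ _ => split
        | |- True => exact: Logic.I
        end; try ring]
  end.

Ltac lmod K := lmod_with ltac:(fun x y => constr_eq x y) K.
Ltac lmod_conv K := lmod_with ltac:(fun x y => unify x y) K.

(** A sum over [[set: T]] is 0 by convention when its support is infinite, so linearity and exchange
    of such sums are stated under this hypothesis. *)
Definition fsupp (T : choiceType) (P : nmodType) (F : T -> P) : Prop :=
  finite_set [set i | F i != 0].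

Section FiniteSums.
Variables (T : choiceType).

Lemma fsuppP (P : nmodType) (F : T -> P) :
  fsupp F <-> exists A : {fset T}, forall i, i \notin A -> F i = 0.
Proof.
split=> [/finite_fsetP[A AE]|[A A0]].
  exists A => i iA; apply/eqP; apply: contraNT iA => Fi.
  by have : [set` A] i by rewrite -AE.
apply: (sub_finite_set _ (finite_fset A)) => i /= Fi.
by apply: contraNT Fi => /A0/eqP.
Qed.

Lemma fsupp_sub (P : nmodType) (F : T -> P) (A : set T) :
  finite_set A -> (forall i, F i != 0 -> A i) -> fsupp F.
Proof. by move=> fA FA; apply: sub_finite_set fA. Qed.

Lemma fsupp_le (P Q : nmodType) (F : T -> P) (G : T -> Q) :
  fsupp F -> (forall i, F i = 0 -> G i = 0) -> fsupp G.
Proof.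
move=> fF FG; apply: (fsupp_sub fF) => i Gi.
by apply: contra_neq Gi => /FG.
Qed.

Lemma fsupp_le2 (P P' Q : nmodType) (F : T -> P) (F' : T -> P') (G : T -> Q) :
  fsupp F -> fsupp F' -> (forall i, F i = 0 -> F' i = 0 -> G i = 0) -> fsupp G.
Proof.
move=> /fsuppP[A FA] /fsuppP[B FB] FG; apply/fsuppP.
exists (A `|` B)%fset => i; rewrite inE negb_or => /andP[iA iB].
by apply: FG; [exact: FA | exact: FB].
Qed.

Lemma fsuppD (P : nmodType) (F G : T -> P) :
  fsupp F -> fsupp G -> fsupp (fun i => F i + G i).
Proof. by move=> fF fG; apply: (fsupp_le2 fF fG) => i -> ->; rewrite addr0. Qed.

Lemma fsupp_lin (K : fieldType) (P Q : lmodType K) (f : P -> Q) (F : T -> P) :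
  linear f -> fsupp F -> fsupp (fun i => f (F i)).
Proof. by move=> fl fF; apply: (fsupp_le fF) => i ->; exact: lin0. Qed.

Lemma fsumE (P : nmodType) (A : {fset T}) (F : T -> P) :
  (forall i, i \notin A -> F i = 0) ->
  \sum_(i \in [set: T]) F i = \sum_(i <- A) F i.
Proof. exact: fsbigTE. Qed.

Lemma eq_fsum (P : nmodType) (F G : T -> P) :
  F =1 G -> \sum_(i \in [set: T]) F i = \sum_(i \in [set: T]) G i.
Proof. by move=> /funext ->. Qed.

Lemma fsum0 (P : nmodType) (F : T -> P) :
  (forall i, F i = 0) -> \sum_(i \in [set: T]) F i = 0.
Proof. by move=> F0; apply: fsbig1. Qed.

Lemma fsum1 (P : nmodType) (F : T -> P) i :
  (forall j, j != i -> F j = 0) -> \sum_(j \in [set: T]) F j = F i.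
Proof.
move=> Fi; rewrite (@fsumE _ [fset i]%fset) ?big_seq_fset1 // => j.
by rewrite inE; exact: Fi.
Qed.

Lemma fsumD (P : nmodType) (F G : T -> P) : fsupp F -> fsupp G ->
  \sum_(i \in [set: T]) (F i + G i)
  = \sum_(i \in [set: T]) F i + \sum_(i \in [set: T]) G i.
Proof.
move=> /fsuppP[A FA] /fsuppP[B FB].
have FAB i : i \notin (A `|` B)%fset -> F i = 0.
  by rewrite inE negb_or => /andP[+ _]; exact: FA.
have GAB i : i \notin (A `|` B)%fset -> G i = 0.
  by rewrite inE negb_or => /andP[_]; exact: FB.
rewrite !(@fsumE _ (A `|` B)%fset) ?big_split // => i iAB.
by rewrite FAB // GAB // addr0.
Qed.

Lemma fsum_lin (K : fieldType) (P Q : lmodType K) (f : P -> Q) (F : T -> P) :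
  linear f -> fsupp F ->
  f (\sum_(i \in [set: T]) F i) = \sum_(i \in [set: T]) f (F i).
Proof.
move=> fl /fsuppP[A FA]; rewrite !(@fsumE _ A) ?lin_sum // => i iA.
by rewrite FA // lin0.
Qed.

Lemma linear_scale (K : fieldType) (P : lmodType K) (a : K) :
  linear (fun x : P => a *: x).
Proof. by move=> b x y; rewrite scalerDr !scalerA mulrC. Qed.

Lemma fsumZ (K : fieldType) (P : lmodType K) a (F : T -> P) : fsupp F ->
  a *: \sum_(i \in [set: T]) F i = \sum_(i \in [set: T]) a *: F i.
Proof. exact: fsum_lin (linear_scale a). Qed.

Lemma fsumN (P : zmodType) (F : T -> P) : fsupp F ->
  - \sum_(i \in [set: T]) F i = \sum_(i \in [set: T]) - F i.
Proof.
move=> /fsuppP[A FA]; rewrite !(@fsumE _ A) ?sumrN // => i iA.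
by rewrite FA // oppr0.
Qed.

Lemma fsuppN (P : zmodType) (F : T -> P) : fsupp F -> fsupp (fun i => - F i).
Proof. by move=> fF; apply: (fsupp_le fF) => i ->; rewrite oppr0. Qed.

Lemma fsumB (P : zmodType) (F G : T -> P) : fsupp F -> fsupp G ->
  \sum_(i \in [set: T]) (F i - G i)
  = \sum_(i \in [set: T]) F i - \sum_(i \in [set: T]) G i.
Proof. by move=> fF fG; rewrite fsumD ?fsumN //; exact: fsuppN. Qed.

Lemma fsum_sum (P : nmodType) I (r : seq I) (F : I -> T -> P) :
  (forall j, fsupp (F j)) ->
  \sum_(i \in [set: T]) \sum_(j <- r) F j i
  = \sum_(j <- r) \sum_(i \in [set: T]) F j i.
Proof.
move=> fF; elim: r => [|j r IH].
  by rewrite big_nil fsum0 // => i; rewrite big_nil.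
rewrite big_cons -IH -fsumD //; first by apply: eq_fsum => i; rewrite big_cons.
elim: r {IH} => [|k r IH].
  by apply: (fsupp_le (fF j)) => i _; rewrite big_nil.
have -> : (fun i => \sum_(j <- k :: r) F j i)
  = (fun i => F k i + \sum_(j <- r) F j i).
  by apply/funext => i; rewrite big_cons.
exact: fsuppD.
Qed.

End FiniteSums.

Lemma fsupp_bij (T T' : choiceType) (P : nmodType) (h : T' -> T) (F : T -> P) :
  bijective h -> fsupp F -> fsupp (F \o h).
Proof.
move=> [g hg gh] /fsuppP[A FA]; apply/fsuppP; exists [fset g i | i in A]%fset.
move=> i /= iA; apply: FA; apply: contraNN iA => hA.
by apply/imfsetP; exists (h i).
Qed.

Section FinitePairSums.
Variables (T1 T2 : choiceType) (P : nmodType).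
Implicit Types F : T1 -> T2 -> P.

Definition fsupp2 F := fsupp (fun p : T1 * T2 => F p.1 p.2).

Lemma fsupp2P F : fsupp2 F <-> exists (A : {fset T1}) (B : {fset T2}),
  forall i j, F i j != 0 -> i \in A /\ j \in B.
Proof.
rewrite /fsupp2; split=> [/fsuppP[C CF]|[A [B AB]]].
  exists [fset p.1 | p in C]%fset, [fset p.2 | p in C]%fset => i j Fij.
  have ijC : (i, j) \in C by apply: contraNT Fij => /CF/eqP.
  by split; apply/imfsetP; exists (i, j).
apply/fsuppP; exists (A `*` B)%fset => -[i j] /= ij.
apply/eqP; apply: contraNT ij => /AB[iA jB]; by rewrite inE /= iA.
Qed.

Lemma fsupp2_slice F i : fsupp2 F -> fsupp (F i).
Proof.
move=> /fsupp2P[A [B AB]]; apply/fsuppP; exists B => j jB.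
by apply/eqP; apply: contraNT jB => /AB[].
Qed.

Lemma fsum_pair F : fsupp2 F ->
  \sum_(p \in [set: T1 * T2]) F p.1 p.2
  = \sum_(i \in [set: T1]) \sum_(j \in [set: T2]) F i j.
Proof.
move=> /fsupp2P[A [B AB]].
have Aout i j : i \notin A -> F i j = 0.
  by move=> iA; apply/eqP; apply: contraNT iA => /AB[].
have Bout i j : j \notin B -> F i j = 0.
  by move=> jB; apply/eqP; apply: contraNT jB => /AB[].
rewrite -(@fsbig_widen _ _ _ _ ([set` A] `*` [set` B])) //; last first.
  by move=> [i j] /= [_] /not_andP[/negP/Aout|/negP/Bout].
rewrite -pair_fsbig //; try exact: finite_fset.
rewrite -[RHS](@fsbig_widen _ _ _ _ [set` A]) //; last first.
  by move=> i /= [_] /negP iA; apply: fsum0 => j; exact: Aout.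
apply: eq_fsbigr => i _; apply: fsbig_widen => // j /= [_] /negP; exact: Bout.
Qed.

End FinitePairSums.

Lemma fsum_exchange (T1 T2 : choiceType) (P : nmodType) (F : T1 -> T2 -> P) :
  fsupp2 F ->
  \sum_(i \in [set: T1]) \sum_(j \in [set: T2]) F i j
  = \sum_(j \in [set: T2]) \sum_(i \in [set: T1]) F i j.
Proof.
move=> fF; have fF' : fsupp2 (fun j i => F i j).
  have /fsupp2P[A [B AB]] := fF.
  by apply/fsupp2P; exists B, A => j i /AB[].
rewrite -(fsum_pair fF) -(fsum_pair fF').
rewrite (@reindex_fsbigT _ _ _ _ _ (fun p : T2 * T1 => (p.2, p.1))) //.
by exists (fun p => (p.2, p.1)) => -[].
Qed.

Section BilinearSums.
Variables (K : fieldType) (V W P : lmodType K) (f : V -> W -> P).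
Variables (T1 T2 : choiceType) (F : T1 -> V) (G : T2 -> W).
Hypotheses (bf : is_bilinear f) (fF : fsupp F) (fG : fsupp G).

Lemma fsupp2_bil : fsupp2 (fun i j => f (F i) (G j)).
Proof.
have [/fsuppP[A FA] /fsuppP[B GB]] := (fF, fG).
apply/fsupp2P; exists A, B => i j nz; split; apply: contraNT nz.
  by move=> /FA ->; rewrite bil0l.
by move=> /GB ->; rewrite bil0r.
Qed.

Lemma fsum_bil :
  f (\sum_(i \in [set: T1]) F i) (\sum_(j \in [set: T2]) G j)
  = \sum_(i \in [set: T1]) \sum_(j \in [set: T2]) f (F i) (G j).
Proof.
rewrite (fsum_lin (bf.1 _) fF); apply: eq_fsum => i /=.
exact: (fsum_lin (bf.2 _) fG).
Qed.

End BilinearSums.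

(** A subspace [A] maximal among those avoiding [w] is a complement of the line K w, and [e x] is
    the scalar a for which x - a w lies in [A]. *)
Lemma linear_functional_neq0 (K : fieldType) (W : lmodType K) (w : W) :
  w != 0 ->
  exists2 e : W -> K, forall a x y, e (a *: x + y) = a * e x + e y & e w = 1.
Proof.
move=> w0.
(* [lin] does not ask for 0, so that the union of the empty chain satisfies it; maximality excludes
   an empty [A] afterwards. *)
pose lin (A : set W) := forall (a : K) x y, A x -> A y -> A (a *: x + y).
have [F FP totF|A [[Alin Aw] Amax]] := @Zorn_bigcup W (fun A => lin A /\ ~ A w).
  split; last by move=> [A /FP[]].
  move=> a x y [A FA Ax] [B FB By].
  have [/(_ _ Ax) Bx|/(_ _ By) Ay] := totF A B FA FB.
    by exists B => //; apply: (FP B FB).1.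
  by exists A => //; apply: (FP A FA).1.
have A0 : A 0.
  have [[x Ax]|A_0] := pselect (A !=set0).
    by rewrite -(addNr x) -scaleN1r; exact: Alin.
  case: (Amax [set 0]).
    split=> [x Ax|sub]; first by case: A_0; exists x.
    by apply: A_0; exists 0; exact: sub.
  by split=> [a x y -> ->|/= /eqP]; rewrite ?scaler0 ?addr0 // (negPf w0).
have AZ a x : A x -> A (a *: x) by move=> Ax; rewrite -[_ *: _]addr0; exact: Alin.
have AB x y : A x -> A y -> A (x - y).
  by move=> Ax Ay; rewrite addrC -scaleN1r; exact: Alin.
have /choice[e eP] (x : W) : exists a : K, A (x - a *: w).
  have [Ax|nAx] := pselect (A x); first by exists 0; rewrite scale0r subr0.
  have [[y [b Ay wE]]|nB] :=
      pselect (exists y, exists2 b : K, A y & w = y + b *: x).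
    have b0 : b != 0.
      by apply: contra_notN Aw => /eqP b0; rewrite wE b0 scale0r addr0.
    exists b^-1; rewrite {1}wE scalerDr scalerA mulVf // scale1r opprD addrCA.
    by rewrite subrr addr0 -scaleNr; exact: AZ.
  case: (Amax [set z | exists y, exists2 b : K, A y & z = y + b *: x]).
    split=> [y Ay|sub]; first by exists y, 0; rewrite // scale0r addr0.
    by apply: nAx; apply: sub; exists 0, 1; rewrite // scale1r add0r.
  split=> // c _ _ [y [b Ay ->]] [y' [b' Ay' ->]].
  exists (c *: y + y'), (c * b + b'); first exact: Alin.
  by rewrite scalerDr scalerA scalerDl addrACA.
have eU x a : A (x - a *: w) -> e x = a.
  move=> Axa; apply/eqP; apply: contra_notT Aw => ea.
  have := AB _ _ (eP x) Axa; rewrite opprB addrC addrA subrK.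
  rewrite -scalerBl => /(AZ (a - e x)^-1); rewrite scalerA mulVf ?scale1r //.
  by rewrite subr_eq0 eq_sym.
exists e => [a x y|]; apply: eU; last by rewrite scale1r subrr.
by rewrite scalerDl -scalerA opprD addrACA -scalerBr; apply: Alin.
Qed.

(** * Generalized eigenspaces and the projections onto them *)

Section LocallyNilpotent.
Variables (K : fieldType) (W : lmodType K).
Implicit Types (f g L : W -> W) (x : W).

Lemma iter_lin f n : linear f -> linear (iter n f).
Proof. by move=> fl; elim: n => [|n IH] a x y //=; rewrite IH fl. Qed.

Lemma iter_eq0_le f m n x : linear f -> (m <= n)%N -> iter m f x = 0 ->
  iter n f x = 0.
Proof.
by move=> fl mn fx; rewrite -(subnK mn) iterD fx (lin0 (iter_lin _ fl)).
Qed.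

Lemma iter_comm f g n x : (forall y, f (g y) = g (f y)) ->
  iter n f (g x) = g (iter n f x).
Proof. by move=> fg; elim: n => //= n ->; rewrite fg. Qed.

(** Instead of the binomial theorem, one factor f + g is applied to x: f x needs one power of f
    less, g x one power of g less, and the induction is on m + n. *)
Lemma nil_add f g m n x : linear f -> linear g ->
  (forall y, f (g y) = g (f y)) ->
  iter m f x = 0 -> iter n g x = 0 ->
  iter (m + n) (fun y => f y + g y) x = 0.
Proof.
move=> fl gl fg; have fgl : linear (fun y => f y + g y).
  by move=> a y z; rewrite fl gl scalerDr addrACA.
have [k] := ubnP (m + n).
elim: k m n x => // k IH [|m] [|n] x mnk fx gx.
- exact: fx.
- by have -> : x = 0 := fx; rewrite (lin0 (iter_lin _ fgl)).
- by have -> : x = 0 := gx; rewrite (lin0 (iter_lin _ fgl)).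
have fx' : iter m f (f x) = 0 by rewrite -iterSr.
have gx' : iter n g (g x) = 0 by rewrite -iterSr.
have gfx : iter n.+1 g (f x) = 0 by rewrite iter_comm ?gx ?lin0.
have fgx : iter m.+1 f (g x) = 0 by rewrite (iter_comm _ _ fg) fx lin0.
rewrite addSn in mnk; rewrite addSn iterSr (linD (iter_lin _ fgl)).
by rewrite (IH _ _ _ mnk fx' gfx) add0r -addSnnS IH // addSnnS.
Qed.

Lemma shift_lin L a : linear L -> linear (fun x => L x - a *: x).
Proof.
move=> Ll b x y; rewrite Ll scalerDr opprD addrACA scalerBr.
by rewrite !scalerA [a * b]mulrC.
Qed.

Section GenEigenspace.
Variables (L : W -> W) (Ll : linear L).

Lemma gen_eigen0 a : gen_eigenspace L a 0.
Proof. by exists 0%N. Qed.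

Lemma gen_eigen_lin a b x y : gen_eigenspace L a x -> gen_eigenspace L a y ->
  gen_eigenspace L a (b *: x + y).
Proof.
have sl := shift_lin a Ll.
move=> [m mx] [n ny]; exists (m + n)%N; rewrite (iter_lin _ sl).
rewrite (iter_eq0_le sl (leq_addr _ _) mx) (iter_eq0_le sl (leq_addl _ _) ny).
by rewrite scaler0 addr0.
Qed.

Lemma gen_eigenD a x y : gen_eigenspace L a x -> gen_eigenspace L a y ->
  gen_eigenspace L a (x + y).
Proof. by rewrite -{2}[x]scale1r; exact: gen_eigen_lin. Qed.

Lemma gen_eigenZ a b x : gen_eigenspace L a x -> gen_eigenspace L a (b *: x).
Proof.
by move=> ax; rewrite -[_ *: _]addr0; apply: gen_eigen_lin => //; exact: gen_eigen0.
Qed.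

End GenEigenspace.

Lemma gen_eigen_add L M a b x : linear L -> linear M ->
  (forall y, L (M y) = M (L y)) ->
  gen_eigenspace L a x -> gen_eigenspace M b x ->
  gen_eigenspace (fun y => L y + M y) (a + b) x.
Proof.
move=> Ll Ml LM [m mx] [n nx]; exists (m + n)%N.
have -> : (fun y => L y + M y - (a + b) *: y)
        = (fun y => (L y - a *: y) + (M y - b *: y)).
  by apply/funext => y; rewrite scalerDl opprD addrACA.
apply: nil_add => // [||y]; [exact: shift_lin|exact: shift_lin|].
rewrite (linB Ll) (linB Ml) (linZ Ll) (linZ Ml) LM !scalerBr !scalerA.
rewrite [a * b]mulrC !opprB !addrA addrAC [RHS]addrAC; congr (_ + _).
exact: addrAC.
Qed.

Lemma gen_eigenN L a x : linear L ->
  gen_eigenspace L a x -> gen_eigenspace (fun y => - L y) (- a) x.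
Proof.
move=> Ll [m mx]; exists m; have sl := shift_lin a Ll.
have -> : (fun y => - L y - - a *: y) = (fun y => - (L y - a *: y)).
  by apply/funext => y; rewrite scaleNr opprB opprK addrC.
suff -> : iter m (fun y => - (L y - a *: y)) x
        = (-1) ^+ m *: iter m (fun y => L y - a *: y) x by rewrite mx scaler0.
elim: m {mx} => [|m /= ->]; first by rewrite scale1r.
by rewrite exprS -scalerA scaleN1r (linZ sl).
Qed.

Lemma gen_eigen_transport (W' : lmodType K) L (L' : W' -> W') (f : W -> W') a b x :
  linear f -> (forall y, L' (f y) - b *: f y = f (L y - a *: y)) ->
  gen_eigenspace L a x -> gen_eigenspace L' b (f x).
Proof.
move=> fl fL [n nx]; exists n; rewrite -(lin0 fl) -nx.
by elim: n {nx} => //= n ->; rewrite fL.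
Qed.

End LocallyNilpotent.

Section Decomposition.
Variables (K : fieldType) (W : lmodType K) (L : W -> W).
Hypotheses (Ll : linear L) (dec : decomposes L).

Lemma decomp_uniq (f g : K -> W) : fsupp f -> fsupp g ->
  (forall a, gen_eigenspace L a (f a)) -> (forall a, gen_eigenspace L a (g a)) ->
  \sum_(a \in [set: K]) f a = \sum_(a \in [set: K]) g a -> f = g.
Proof.
move=> ff fg Lf Lg fgE; have [h [_ hU]] := dec (\sum_(a \in [set: K]) f a).
by rewrite -(hU f) // -(hU g).
Qed.

Definition wproj (a : K) (w : W) : W := sval (cid (dec w)) a.

Lemma wproj_fsupp w : fsupp (wproj ^~ w).
Proof. by rewrite /wproj; case: cid => f [[]]. Qed.

Lemma wproj_eigen a w : gen_eigenspace L a (wproj a w).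
Proof. by rewrite /wproj; case: cid => f [[]] /=. Qed.

Lemma wproj_sum w : w = \sum_(a \in [set: K]) wproj a w.
Proof. by rewrite /wproj; case: cid => f /= [[_ _ wE] _]; exact: wE. Qed.

Lemma wprojE (f : K -> W) : fsupp f -> (forall a, gen_eigenspace L a (f a)) ->
  forall a, wproj a (\sum_(b \in [set: K]) f b) = f a.
Proof.
move=> ff Lf a; rewrite -[RHS](_ : wproj^~ (\sum_(b \in [set: K]) f b) a = f a) //.
congr (_ a); apply: decomp_uniq => // [|b|]; first exact: wproj_fsupp.
  exact: wproj_eigen.
by rewrite -wproj_sum.
Qed.

Lemma wproj_lin a : linear (wproj a).
Proof.
move=> b x y.
have fx : fsupp (fun c => b *: wproj c x).
  by apply: (fsupp_lin (linear_scale b)); exact: wproj_fsupp.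
rewrite {1}[x]wproj_sum {1}[y]wproj_sum fsumZ; last exact: wproj_fsupp.
rewrite -fsumD //; last exact: wproj_fsupp.
rewrite wprojE // => [|c]; first by apply: fsuppD => //; exact: wproj_fsupp.
by apply: gen_eigen_lin => //; exact: wproj_eigen.
Qed.

Lemma wproj_gen a b w : gen_eigenspace L a w ->
  wproj b w = if b == a then w else 0.
Proof.
move=> aw; pose f c := if c == a then w else 0.
have -> : w = \sum_(c \in [set: K]) f c.
  by rewrite (@fsum1 _ _ _ a) /f ?eqxx // => c /negPf ->.
rewrite wprojE.
- by rewrite (@fsum1 _ _ _ a) /f ?eqxx // => c /negPf ->.
- by apply/fsuppP; exists [fset a]%fset => c; rewrite inE /f => /negPf ->.
- by move=> c; rewrite /f; case: eqP => [->|_] //; exact: gen_eigen0.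
Qed.

Lemma decomp_ind (P : W -> Prop) :
  (forall x y, P x -> P y -> P (x + y)) ->
  (forall a x, gen_eigenspace L a x -> P x) -> forall w, P w.
Proof.
move=> PD PL w; rewrite [w]wproj_sum; apply: (big_ind P) => // [|a _].
  by apply: (PL 0); exact: gen_eigen0.
by apply: (PL a); exact: wproj_eigen.
Qed.

Section Extension.
Variables (P : lmodType K) (g : K -> W -> P).
Hypothesis gl : forall a, linear (g a).

(** Only the values of [g a] on the generalized eigenspace of [a] matter. This turns a formula that
    mentions the weight of its argument into a linear map on all of W. *)
Definition wext w := \sum_(a \in [set: K]) g a (wproj a w).

Lemma wext_fsupp w : fsupp (fun a => g a (wproj a w)).
Proof. by apply: (fsupp_le (wproj_fsupp w)) => a ->; exact: lin0. Qed.

Lemma wext_lin : linear wext.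
Proof.
move=> b x y; rewrite /wext fsumZ -?fsumD; try exact: wext_fsupp.
  by apply: eq_fsum => a; rewrite wproj_lin gl.
by apply: (fsupp_lin (linear_scale b)); exact: wext_fsupp.
Qed.

Lemma wextE a w : gen_eigenspace L a w -> wext w = g a w.
Proof.
move=> aw; rewrite /wext (@fsum1 _ _ _ a) => [|b /negPf ba].
  by rewrite (wproj_gen _ aw) eqxx.
by rewrite (wproj_gen _ aw) ba lin0.
Qed.

End Extension.
End Decomposition.

(** It suffices to compare both sides on generalized eigenvectors. The shift [c] is 0 for modes of U
    and the degree of the mode for modes of V. *)
Lemma wproj_comm (K : fieldType) (W W' : lmodType K) (L : W -> W)
    (L' : W' -> W') (dec : decomposes L) (dec' : decomposes L') (f : W -> W')
    (c : K) : linear L -> linear L' -> linear f ->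
  (forall a x, gen_eigenspace L a x -> gen_eigenspace L' (a + c) (f x)) ->
  forall a x, wproj dec' (a + c) (f x) = f (wproj dec a x).
Proof.
move=> Ll Ll' fl fL a; apply: (decomp_ind dec) => [x y xP yP|b x bx].
  by rewrite !(linD fl) !(linD (wproj_lin Ll' dec' _)) xP yP
             (linD (wproj_lin Ll dec _)) linD.
rewrite (wproj_gen dec _ bx) (wproj_gen dec' _ (fL _ _ bx)).
by rewrite (inj_eq (addIr c)); case: eqP => // _; rewrite lin0.
Qed.

(** * The Jacobi identity and weak modules *)

Section GeneralizedBinomials.
Variable K : numFieldType.

Lemma fact_neq0 i : (i`!)%:R != 0 :> K.
Proof. by rewrite pnatr_eq0 -lt0n fact_gt0. Qed.

Lemma binz0 l : binz K l 0 = 1.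
Proof. by rewrite /binz big_geq // fact0 divr1. Qed.

Lemma binzS l i : binz K (l + 1) i.+1 = binz K l i.+1 + binz K l i.
Proof.
rewrite /binz big_nat_recl // subr0 [X in _ = X / _ + _]big_nat_recr //=.
rewrite (eq_bigr (fun j => l%:~R - j%:R)) => [|j _]; last first.
  by rewrite intrD -natr1 opprD addrACA subrr addr0.
have := fact_neq0 i.+1; rewrite factS natrM -natr1 intrD => i0; field.
by rewrite mulf_eq0 negb_or in i0; rewrite andbC.
Qed.

Lemma binz_0S i : binz K 0 i.+1 = 0.
Proof. by rewrite /binz big_nat_recl // subr0 !mul0r. Qed.

Lemma binz_1SS i : binz K 1 i.+2 = 0.
Proof. by rewrite -[1]add0r binzS !binz_0S addr0. Qed.

Lemma binz11 : binz K 1 1 = 1.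
Proof. by rewrite -[X in binz K X _]add0r binzS binz_0S add0r binz0. Qed.

Lemma binz_N1 i : (-1) ^+ i * binz K (-1) i = 1.
Proof.
elim: i => [|i IH]; first by rewrite binz0 mulr1.
have /eqP := binz_0S i; rewrite -[X in binz K X _]/(-1 + 1 : int) binzS addr_eq0 => /eqP ->.
by rewrite exprS mulN1r mulrNN.
Qed.

Lemma binz_N2 i : (-1) ^+ i * binz K (-2) i = i.+1%:R.
Proof.
elim: i => [|i IH]; first by rewrite binz0 mulr1.
have e : (-1) ^+ i.+1 * binz K (-2) i = - i.+1%:R.
  by rewrite exprS mulN1r mulNr IH.
have := binz_N1 i.+1; rewrite -[X in binz K X _]/(-2 + 1 : int) binzS mulrDr e.
by move=> /eqP; rewrite subr_eq addrC natr1 => /eqP.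
Qed.

(** Since binz (s + a) a is the coefficient of z^a in (1 - z)^(-s-1), this is the Vandermonde
    identity for (1 - z)^(-s-1) (1 - z)^(-t-1). Both sides obey Pascal's rule in s, so an induction
    upwards and downwards from s = -1 proves it. *)
Lemma binz_conv (s t : int) N :
  \sum_(a < N.+1) binz K (s + a%:Z) a * binz K (t + (N - a)%:Z) (N - a)
  = binz K (s + t + N%:Z + 1) N.
Proof.
pose C s t N := \sum_(a < N.+1) binz K (s + a%:Z) a * binz K (t + (N - a)%:Z) (N - a).
rewrite -/(C s t N).
have binzD u a : binz K (u + a.+1%:Z) a.+1
    = binz K (u + a%:Z) a + binz K (u - 1 + a.+1%:Z) a.+1.
  have -> : u + a.+1%:Z = u + a%:Z + 1 by lia.
  have -> : u - 1 + a.+1%:Z = u + a%:Z by lia.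
  by rewrite binzS addrC.
have step s' N' : C s' t N'.+1 = C s' t N' + C (s' - 1) t N'.+1.
  rewrite /C [LHS]big_ord_recl [X in _ = _ + X]big_ord_recl !binz0 addrCA.
  congr (_ + _); rewrite -big_split; apply: eq_bigr => i _ /=.
  by rewrite /bump /= add1n subSS binzD mulrDl.
have stepR s' N' : binz K (s' + t + N'.+1%:Z + 1) N'.+1
    = binz K (s' + t + N'%:Z + 1) N' + binz K (s' - 1 + t + N'.+1%:Z + 1) N'.+1.
  have -> : s' + t + N'.+1%:Z + 1 = (s' + t + 1) + N'.+1%:Z by lia.
  by rewrite binzD; congr (binz K _ _ + binz K _ _); lia.
(* For s = -1 the first series is the constant 1: binz (a - 1) a is 0 for a > 0. *)
have base N' : C (-1) t N' = binz K (-1 + t + N'%:Z + 1) N'.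
  rewrite /C big_ord_recl !binz0 mul1r subn0 big1 ?addr0 => [|i _].
    by congr (binz K _ _); lia.
  rewrite lift0; have -> : -1 + (i.+1)%:Z = i%:Z by lia.
  by rewrite /binz big_nat_recr //= subrr mulr0 !mul0r.
elim: N s => [|N IH] s.
  by rewrite /C big_ord_recl big_ord0 !binz0 mulr1 addr0.
have pos n : C n%:Z t N.+1 = binz K (n%:Z + t + N.+1%:Z + 1) N.+1.
  elim: n => [|n IHn].
    by rewrite step stepR IH; congr (_ + _); exact: base.
  rewrite step stepR IH; congr (_ + _).
  by have -> : n.+1%:Z - 1 = n%:Z by lia.
have neg n : C (-1 - n%:Z) t N.+1 = binz K (-1 - n%:Z + t + N.+1%:Z + 1) N.+1.
  elim: n => [|n]; first by rewrite subr0; exact: base.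
  rewrite step stepR IH => /addrI; have -> : -1 - n%:Z - 1 = -1 - n.+1%:Z by lia.
  by [].
case: s => n; first exact: pos.
by have -> : Negz n = -1 - n%:Z by lia; exact: neg.
Qed.

End GeneralizedBinomials.

Lemma fsupp_nat (P : nmodType) (F : nat -> P) N :
  (forall i, (N <= i)%N -> F i = 0) -> fsupp F.
Proof.
move=> F0; apply: (fsupp_sub (finite_II N)) => i /= Fi.
by rewrite ltnNge; apply: contra_neqN Fi => /F0.
Qed.

Lemma fsum_nat1 (P : nmodType) (F : nat -> P) :
  (forall i, F i.+1 = 0) -> \sum_(i \in [set: nat]) F i = F 0%N.
Proof. by move=> F0; rewrite (@fsum1 _ _ _ 0%N) // => -[]. Qed.

Lemma fsum_nat2 (P : nmodType) (F : nat -> P) :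
  (forall i, F i.+2 = 0) -> \sum_(i \in [set: nat]) F i = F 0%N + F 1%N.
Proof.
move=> F0; rewrite (@fsumE _ _ [fset 0%N; 1%N]%fset) => [|[|[|i]]];
  rewrite ?inE //.
by rewrite big_fsetU1 ?inE //= big_seq_fset1.
Qed.

Section Jacobi.
Variables (K : numFieldType) (A : pzRingType) (V W1 W2 W3 : lmodType K).
Variables (Y1 : V -> int -> W1 -> W1) (Y2 : V -> int -> W2 -> W2).
Variables (Y3 : V -> int -> W3 -> W3) (I : W1 -> A -> W2 -> W3).

Definition truncated_modes (W : lmodType K) (Y : V -> int -> W -> W) :=
  forall v w, exists N : int, forall n, N <= n -> Y v n w = 0.

Definition truncated_coefs (W W' W'' : lmodType K) (J : W -> A -> W' -> W'') :=
  forall w1 w2 h, exists N : nat, forall n, (N <= n)%N -> J w1 (h + n%:R) w2 = 0.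

Hypotheses (b1 : forall n, is_bilinear (fun v w => Y1 v n w))
  (b2 : forall n, is_bilinear (fun v w => Y2 v n w))
  (b3 : forall n, is_bilinear (fun v w => Y3 v n w))
  (bI : forall h, is_bilinear (fun v w => I v h w)).

(** The case l = 0 of the Jacobi identity, Borcherds' commutator formula. *)
Lemma mode_commutator v w1 w2 m h : jacobi Y1 Y2 Y3 I ->
  Y3 v m (I w1 h w2) - I w1 h (Y2 v m w2)
  = \sum_(i \in [set: nat]) binz K m i *: I (Y1 v i%:Z w1) (h + m%:~R - i%:R) w2.
Proof.
move=> jac; have := jac v w1 w2 0 m h.
rewrite fsum_nat1 => [|i]; last by rewrite binz_0S mulr0 scale0r.
rewrite fsum_nat1 => [|i]; last by rewrite binz_0S mulr0 scale0r.
rewrite binz0 !mulr1 expr0 !addr0 !scale1r subr0 => ->.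
by apply: eq_fsum => i; rewrite add0r.
Qed.

Lemma mode1_commutator v w1 w2 h : jacobi Y1 Y2 Y3 I ->
  Y3 v 1 (I w1 h w2) - I w1 h (Y2 v 1 w2)
  = I (Y1 v 0 w1) (h + 1) w2 + I (Y1 v 1 w1) h w2.
Proof.
move=> jac; rewrite mode_commutator // fsum_nat2 => [|i].
  by rewrite binz0 binz11 !scale1r subr0 addrK.
by rewrite binz_1SS scale0r.
Qed.

Hypotheses (t1 : truncated_modes Y1) (t2 : truncated_modes Y2)
  (tI : truncated_coefs I).

Lemma fsupp_jacobi1 c v w1 w2 n h :
  fsupp (fun i : nat => c i *: Y3 v (n - i%:Z) (I w1 (h + i%:R) w2)).
Proof.
have [N I0] := tI w1 w2 h; apply: (@fsupp_nat _ _ N) => i /I0 ->.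
by rewrite (bil0r (b3 _)) scaler0.
Qed.

Lemma fsupp_jacobi2 c v w1 w2 m h :
  fsupp (fun i : nat => c i *: I w1 (h - i%:R) (Y2 v (m + i%:Z) w2)).
Proof.
have [N Y0] := t2 v w2; apply: (@fsupp_nat _ _ `|N - m|%N) => i iN.
by rewrite Y0 ?(bil0r (bI _)) ?scaler0 //; lia.
Qed.

Lemma fsupp_jacobi3 c v w1 w2 l h :
  fsupp (fun i : nat => c i *: I (Y1 v (l + i%:Z) w1) (h - i%:R) w2).
Proof.
have [N Y0] := t1 v w1; apply: (@fsupp_nat _ _ `|N - l|%N) => i iN.
by rewrite Y0 ?(bil0l (bI _)) ?scaler0 //; lia.
Qed.

End Jacobi.

Section WeakModules.
Variables (K : numFieldType) (V : voa_data K).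
Hypothesis V_voa : is_VOA V.
Implicit Types W : module_data V.

Lemma Lmode_lin W n : is_weak_module W -> linear (Lmode (W := W) n).
Proof. by move=> wW; case: (act_bilinear wW (n + 1)) => _; exact. Qed.

Lemma Lmode_N1E (v : V) : Lmode (W := adjoint V) (-1) v = vmode v (-2) (vacuum V).
Proof.
rewrite -[LHS](voa_creation V_voa) (voa_derivative V_voa).
by rewrite scaleN1r opprK.
Qed.

(** This is not among the axioms of a weak module. It follows from L(-1) v = v_(-2) 1 and the Jacobi
    identity for v and the vacuum at (l, m) = (-2, 0), where every mode of the vacuum except the one
    of index -1 vanishes. *)
Lemma act_derivative W (v : V) n (w : W) : is_weak_module W ->
  act (Lmode (W := adjoint V) (-1) v) n w = - (n%:~R *: act v (n - 1) w).
Proof.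
move=> wW; rewrite Lmode_N1E.
have := act_jacobi wW v (vacuum V) w (-2) 0 n.
rewrite [RHS]fsum_nat1 => [|i]; last by rewrite binz_0S scale0r.
rewrite binz0 scale1r !addr0 => <-.
under eq_fsum => i do rewrite binz_N2 (act_vacuum wW).
under [X in _ - X]eq_fsum => i.
  rewrite expfzDr ?oppr_eq0 ?oner_eq0 // -mulrA -exprnP binz_N2.
  rewrite (act_vacuum wW) [X in X * _](_ : _ = 1) ?mul1r ?add0r; last first.
    by rewrite -[X in _ ^ X]/(Negz 1) /exprz expr2 mulrNN mulr1 invr1.
  over.
have bact := act_bilinear wW.
(* The vacuum mode -1 occurs in neither sum for n = 0, only in the second for n > 0 and only in the
   first for n < 0. *)
case: n => [[|n]|n].
- rewrite !fsum0 ?scale0r ?oppr0 ?addr0 ?subrr // => i.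
    by case: eqP => [|_]; [lia | rewrite scaler0].
  by case: eqP => [|_]; [lia | rewrite (bil0r (bact _)) scaler0].
- rewrite fsum0 => [|i]; last first.
    by case: eqP => [|_]; [lia | rewrite (bil0r (bact _)) scaler0].
  rewrite (@fsum1 _ _ _ n) => [|i ni]; last first.
    by case: eqP => [|_]; [lia | rewrite scaler0].
  rewrite sub0r; case: eqP => [_|]; last by lia.
  by congr (- (_ *: act v _ w)); lia.
rewrite [X in _ - X]fsum0 => [|i]; last first.
  by case: eqP => [|_]; [lia | rewrite scaler0].
rewrite (@fsum1 _ _ _ n) => [|i ni]; last first.
  by case: eqP => [|_]; [lia | rewrite (bil0r (bact _)) scaler0].
case: eqP => [_|]; last by lia.
rewrite subr0 NegzE mulrNz scaleNr opprK.
by congr (_ *: act v _ w); lia.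
Qed.

Lemma iop_L0 (A : pzRingType) (W1 W2 W3 : module_data V) (I : W1 -> A -> W2 -> W3) w1 h w2 :
  jacobi (@act K V W1) (@act K V W2) (@act K V W3) I ->
  Lmode 0 (I w1 h w2)
  = I w1 h (Lmode 0 w2) + I (Lmode (-1) w1) (h + 1) w2 + I (Lmode 0 w1) h w2.
Proof.
move=> jac; have /eqP := mode1_commutator (conformal V) w1 w2 h jac.
by rewrite subr_eq addrC addrA => /eqP.
Qed.

Lemma act_L0 W (v : V) n (w : W) : is_weak_module W ->
  Lmode 0 (act v n w) = act (Lmode (W := adjoint V) 0 v) n w
    - (n + 1)%:~R *: act v n w + act v n (Lmode 0 w).
Proof.
move=> wW; have := @iop_L0 _ (adjoint V) W W (@act K V W) v n w (act_jacobi wW).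
rewrite (act_derivative _ _ _ wW) addrK => ->.
by rewrite addrC addrA [RHS]addrAC.
Qed.

Lemma act_weight W a k n (v : V) (w : W) : is_weak_module W ->
  weight_space n v -> gen_eigenspace (Lmode (W := W) 0) a w ->
  gen_eigenspace (Lmode (W := W) 0) (a + (n - k - 1)%:~R) (act v k w).
Proof.
move=> wW vn; have bact := act_bilinear wW k.
apply: (gen_eigen_transport (bact.2 v)) => y /=.
rewrite (act_L0 _ _ _ wW) vn (bilZl bact) (bilBr bact) (bilZr bact).
rewrite -scalerBl -intrB scalerDl.
have -> : n - (k + 1) = n - k - 1 by lia.
rewrite [- (a *: _ + _)]opprD.
by rewrite [_ *: act v k y + _]addrC addrACA subrr addr0.
Qed.

End WeakModules.

(** * Log-free intertwining operators *)

Lemma fsum_comb (K : fieldType) (P : lmodType K) (L : P -> P) (c : K) (F G1 G2 G3 : nat -> P) :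
  linear L -> fsupp F -> fsupp G1 -> fsupp G2 -> fsupp G3 ->
  \sum_(i \in [set: nat]) (L (F i) + c *: F i - G1 i - G2 i - G3 i)
  = L (\sum_(i \in [set: nat]) F i) + c *: (\sum_(i \in [set: nat]) F i)
    - \sum_(i \in [set: nat]) G1 i - \sum_(i \in [set: nat]) G2 i
    - \sum_(i \in [set: nat]) G3 i.
Proof.
move=> Ll fF g1 g2 g3.
have fL := fsupp_lin Ll fF.
have fcF : fsupp (fun i => c *: F i) := fsupp_lin (linear_scale c) fF.
have h0 := fsuppD fL fcF.
have h1 := fsuppD h0 (fsuppN g1); have h2 := fsuppD h1 (fsuppN g2).
rewrite (fsumB h2 g3) (fsumB h1 g2) (fsumB h0 g1) (fsumD fL fcF).
by rewrite (fsum_lin Ll fF) (fsumZ _ fF).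
Qed.

Section LogLevels.
Variables (K : numFieldType) (V : voa_data K).
Hypothesis V_voa : is_VOA V.
Variables W1 W2 W3 : module_data V.
Hypotheses (w1 : is_weak_module W1) (w2 : is_weak_module W2)
  (w3 : is_weak_module W3).

Let L1 := Lmode (W := W1) 0.
Let L2 := Lmode (W := W2) 0.
Let L3 := Lmode (W := W3) 0.

Let l1 : linear L1. Proof. exact: Lmode_lin. Qed.
Let l2 : linear L2. Proof. exact: Lmode_lin. Qed.
Let l3 : linear L3. Proof. exact: Lmode_lin. Qed.

(* If J is the coefficient of x^(-h-1) (log x)^k in an intertwining operator, *)
(* then raise_log h J is k + 1 times that of x^(-h-1) (log x)^(k+1).          *)
Definition raise_log (h : K) (J : W1 -> W2 -> W3) (x : W1) (y : W2) : W3 :=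
  L3 (J x y) + (h + 1) *: J x y - J (L1 x) y - J x (L2 y).

Lemma raise_log_bilinear h J : is_bilinear J -> is_bilinear (raise_log h J).
Proof.
move=> [bl br]; rewrite /raise_log; split=> [y|x].
  apply: linear_subf; last exact: bl.
  apply: linear_subf; last by apply: (linear_compf (bl y)).
  by apply: linear_addf; [apply: linear_compf | apply: linear_scalef].
apply: linear_subf; last by apply: (linear_compf (br x)).
apply: linear_subf; last exact: br.
apply: linear_addf; last by apply: linear_scalef; exact: br.
by apply: linear_compf => //; exact: br.
Qed.

(* Both sides of the Jacobi identity are homogeneous for L(0): applying       *)
(* raise_log to I turns each of the three sums S into L(0) S minus the same   *)
(* sum with L(0) applied to v, w1 and w2, up to a common scalar.              *)
Lemma raise_log_jacobi (I : W1 -> K -> W2 -> W3) :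
  (forall h, is_bilinear (fun x y => I x h y)) -> truncated_coefs I ->
  jacobi (@act K V W1) (@act K V W2) (@act K V W3) I ->
  jacobi (@act K V W1) (@act K V W2) (@act K V W3)
    (fun x h => raise_log h (fun x => I x h) x).
Proof.
move=> bI tI jac v x y l m h.
have [[b1 b2] b3] := (act_bilinear w1, act_bilinear w2, act_bilinear w3).
have [t1 t2] := (act_truncated w1, act_truncated w2).
pose v' := Lmode (W := adjoint V) 0 v; pose c := (m + l + 1)%:~R + h + 1.
pose S1 v x y i :=
  ((-1) ^+ i * binz K l i) *: act v (m + l - i%:Z) (I x (h + i%:R) y).
pose S2 v x y i := ((-1) ^ (l + i%:Z) * binz K l i)
  *: I x (h + l%:~R - i%:R) (act v (m + i%:Z) y).
pose S3 v x y i :=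
  binz K m i *: I (act v (l + i%:Z) x) (h + m%:~R - i%:R) y.
have f1 u z t : fsupp (S1 u z t) by exact: fsupp_jacobi1.
have f2 u z t : fsupp (S2 u z t) by exact: fsupp_jacobi2.
have f3 u z t : fsupp (S3 u z t) by exact: fsupp_jacobi3.
pose C (S : V -> W1 -> W2 -> nat -> W3) i :=
  L3 (S v x y i) + c *: S v x y i - S v' x y i - S v (L1 x) y i - S v x (L2 y) i.
have act_L3 u n z : act u n (L3 z) = L3 (act u n z)
    - act (Lmode (W := adjoint V) 0 u) n z + (n + 1)%:~R *: act u n z.
  by rewrite /L3 (act_L0 V_voa _ _ _ w3); lmod K.
have E1 : \sum_(i \in [set: nat]) C S1 i = \sum_(i \in [set: nat])
    ((-1) ^+ i * binz K l i) *: act v (m + l - i%:Z)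
      (raise_log (h + i%:R) (fun x => I x (h + i%:R)) x y).
  apply: eq_fsum => i; rewrite /C /S1 /raise_log.
  rewrite !(bilBr (b3 _)) (bilDr (b3 _)) (bilZr (b3 _)) act_L3 (linZ l3).
  by rewrite -/v' /c !intrD mulrNz; lmod K.
have E2 : \sum_(i \in [set: nat]) C S2 i = \sum_(i \in [set: nat])
    ((-1) ^ (l + i%:Z) * binz K l i) *: raise_log (h + l%:~R - i%:R)
       (fun x => I x (h + l%:~R - i%:R)) x (act v (m + i%:Z) y).
  apply: eq_fsum => i; rewrite /C /S2 /raise_log /L2 (act_L0 V_voa _ _ _ w2).
  rewrite (bilDr (bI _)) (bilBr (bI _)) (bilZr (bI _)) (linZ l3) -/v' -/L2.
  by rewrite /c !intrD; lmod K.
have E3 : \sum_(i \in [set: nat]) C S3 i = \sum_(i \in [set: nat])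
    binz K m i *: raise_log (h + m%:~R - i%:R)
       (fun x => I x (h + m%:~R - i%:R)) (act v (l + i%:Z) x) y.
  apply: eq_fsum => i; rewrite /C /S3 /raise_log /L1 (act_L0 V_voa _ _ _ w1).
  rewrite (bilDl (bI _)) (bilBl (bI _)) (bilZl (bI _)) (linZ l3) -/v' -/L1.
  by rewrite /c !intrD; lmod K.
suff : \sum_(i \in [set: nat]) C S1 i - \sum_(i \in [set: nat]) C S2 i
    = \sum_(i \in [set: nat]) C S3 i by rewrite E1 E2 E3.
have sumE u z t : \sum_(i \in [set: nat]) S3 u z t i
    = \sum_(i \in [set: nat]) S1 u z t i - \sum_(i \in [set: nat]) S2 u z t i.
  by rewrite -[LHS](jac u z t l m h).
rewrite (fsum_comb c l3 (f1 v x y) (f1 v' x y) (f1 v (L1 x) y) (f1 v x (L2 y))).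
rewrite (fsum_comb c l3 (f2 v x y) (f2 v' x y) (f2 v (L1 x) y) (f2 v x (L2 y))).
rewrite (fsum_comb c l3 (f3 v x y) (f3 v' x y) (f3 v (L1 x) y) (f3 v x (L2 y))).
rewrite (sumE v x y) (sumE v' x y) (sumE v (L1 x) y) (sumE v x (L2 y)) (linB l3).
by clearbody S1 S2 S3; lmod_conv K.
Qed.

Lemma raise_log_truncated (I : W1 -> K -> W2 -> W3) :
  truncated_coefs I -> truncated_coefs (fun x h => raise_log h (fun x => I x h) x).
Proof.
move=> tI x y h; have [N0 I0] := tI x y h.
have [N1 I1] := tI (L1 x) y h; have [N2 I2] := tI x (L2 y) h.
exists (maxn N0 (maxn N1 N2)) => n; rewrite !geq_max => /and3P[n0 n1 n2].
by rewrite /raise_log I0 // I1 // I2 // (lin0 l3) scaler0 !subr0 addr0.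
Qed.

Section Iterates.
Variables (h a b : K) (J : W1 -> W2 -> W3).
Hypothesis bJ : is_bilinear J.

Let N1 x := L1 x - a *: x.
Let N2 y := L2 y - b *: y.
Let N3 z := L3 z - (a + b - h - 1) *: z.

(** The scalars a + b - (a + b - h - 1) add up to h + 1, so on vectors of weights a and b only the
    nilpotent parts of L(0) remain. *)
Lemma raise_logE : raise_log h J
  = fun x y => N3 (J x y) - J (N1 x) y - J x (N2 y).
Proof.
apply/funext => x; apply/funext => y; rewrite /raise_log /N1 /N2 /N3.
by rewrite (bilBl bJ) (bilBr bJ) (bilZl bJ) (bilZr bJ); lmod K.
Qed.

End Iterates.

Lemma iter_raise_bilinear h n J : is_bilinear J ->
  is_bilinear (iter n (raise_log h) J).
Proof. by move=> bJ; elim: n => //= n; exact: raise_log_bilinear. Qed.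

Lemma iter_raise_vanish h a b J x y : is_bilinear J ->
  (forall i j, J (iter i (fun x => L1 x - a *: x) x)
                 (iter j (fun y => L2 y - b *: y) y) = 0) ->
  forall n, iter n (raise_log h) J x y = 0.
Proof.
move=> bJ J0 n.
suff /(_ 0%N 0%N) : forall i j,
    iter n (raise_log h) J (iter i (fun x => L1 x - a *: x) x)
      (iter j (fun y => L2 y - b *: y) y) = 0 by [].
elim: n => //= n IH i j; rewrite (raise_logE h a b (iter_raise_bilinear h n bJ)).
have := IH i.+1 j; have := IH i j.+1; rewrite /= IH => -> ->.
by rewrite (lin0 l3) scaler0 !subr0.
Qed.

(** By [raise_logE], raising is a signed sum of three commuting operations on J: composing with
    [N3], [N1] and [N2]. Each is nilpotent on the orbits of x and y, and one raising lowers p, q or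
    r in each of the three terms, as in [nil_add]. *)
Lemma iter_raise_nil h a b n p q r J x y : (p + q + r <= n)%N ->
  is_bilinear J ->
  iter p (fun x => L1 x - a *: x) x = 0 ->
  iter q (fun y => L2 y - b *: y) y = 0 ->
  (forall i j, iter r (fun z => L3 z - (a + b - h - 1) *: z)
    (J (iter i (fun x => L1 x - a *: x) x)
       (iter j (fun y => L2 y - b *: y) y)) = 0) ->
  iter n (raise_log h) J x y = 0.
Proof.
set N1 := fun x => L1 x - a *: x; set N2 := fun y => L2 y - b *: y.
set N3 := fun z => L3 z - _ *: z.
have n1 : linear N1 by exact: shift_lin.
have n2 : linear N2 by exact: shift_lin.
have n3 : linear N3 by exact: shift_lin.
elim: n p q r J x y => [|n IH] p q r J x y pqr bJ px qy rJ.
  have p0 : p = 0%N by lia.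
  by rewrite p0 in px; have -> : x = 0 := px; rewrite /= (bil0l bJ).
case: p => [|p] in pqr px *.
  have -> : x = 0 := px.
  exact: (bil0l (iter_raise_bilinear h n.+1 bJ)).
case: q => [|q] in pqr qy *.
  have -> : y = 0 := qy.
  exact: (bil0r (iter_raise_bilinear h n.+1 bJ)).
case: r => [|r] in pqr rJ *; first exact: (iter_raise_vanish h bJ rJ).
pose J3 x y := N3 (J x y).
have bJ3 : is_bilinear J3.
  by split=> t; apply: (linear_compf n3); [exact: bJ.1 | exact: bJ.2].
have NL1 u : N1 (L1 u) = L1 (N1 u) by rewrite /N1 (linB l1) (linZ l1).
have NL2 u : N2 (L2 u) = L2 (N2 u) by rewrite /N2 (linB l2) (linZ l2).
have raise1 m (F : W1 -> W2 -> W3) :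
    iter m (raise_log h) (fun x y => F (N1 x) y)
    = fun x y => iter m (raise_log h) F (N1 x) y.
  elim: m => //= m ->; apply/funext => u; apply/funext => t.
  by rewrite /raise_log NL1.
have raise2 m (F : W1 -> W2 -> W3) :
    iter m (raise_log h) (fun x y => F x (N2 y))
    = fun x y => iter m (raise_log h) F x (N2 y).
  elim: m => //= m ->; apply/funext => u; apply/funext => t.
  by rewrite /raise_log NL2.
have raiseB (F G : W1 -> W2 -> W3) : raise_log h (fun x y => F x y - G x y)
    = fun x y => raise_log h F x y - raise_log h G x y.
  apply/funext => u; apply/funext => v; rewrite /raise_log (linB l3); lmod K.
rewrite iterSr (raise_logE h a b bJ).
have iterB m (F G : W1 -> W2 -> W3) :
    iter m (raise_log h) (fun x y => F x y - G x y)
    = fun x y => iter m (raise_log h) F x y - iter m (raise_log h) G x y.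
  by elim: m => //= m ->; rewrite raiseB.
rewrite (iterB n (fun x y => N3 (J x y) - J (N1 x) y)) iterB raise1 raise2.
have px' : iter p N1 (N1 x) = 0 by rewrite -iterSr.
have qy' : iter q N2 (N2 y) = 0 by rewrite -iterSr.
rewrite -/(J3 _ _) (IH p.+1 q.+1 r J3 x y) //; last 2 first.
- lia.
- by move=> i j; rewrite /J3 -iterSr.
rewrite (IH p q.+1 r.+1 J (N1 x) y) //; last first.
  by move=> i j; rewrite -[iter i _ _]iterSr.
rewrite (IH p.+1 q r.+1 J x (N2 y)) ?subr0 //.
  lia.
by move=> i j; rewrite -[iter j _ _]iterSr.
Qed.

End LogLevels.

(* The axioms satisfied by the log-free coefficients I x h 0 y of an          *)
(* intertwining operator; conversely they determine one, see log_levels.      *)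
Record is_logfree (K : numFieldType) (V : voa_data K) (W1 W2 W3 : module_data V)
    (I : W1 -> K -> W2 -> W3) : Prop := {
  lf_bilinear : forall h, is_bilinear (fun x y => I x h y);
  lf_truncated : truncated_coefs I;
  lf_jacobi : jacobi (@act K V W1) (@act K V W2) (@act K V W3) I;
  lf_weight : forall a b h x y,
    gen_eigenspace (Lmode (W := W1) 0) a x ->
    gen_eigenspace (Lmode (W := W2) 0) b y ->
    gen_eigenspace (Lmode (W := W3) 0) (a + b - h - 1) (I x h y) }.

Lemma nat_bound (Q : nat -> nat -> Prop) a :
  (forall i, exists n, forall k, (n <= k)%N -> Q i k) ->
  exists n, forall i k, (i < a)%N -> (n <= k)%N -> Q i k.
Proof.
move=> QP; elim: a => [|a [n IH]]; first by exists 0%N.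
have [m Qm] := QP a; exists (maxn n m) => i k; rewrite geq_max ltnS leq_eqVlt.
by move=> /predU1P[->|ia] /andP[nk mk]; [exact: Qm | exact: IH].
Qed.

Lemma jacobi_ext (K : numFieldType) (A : pzRingType) (U X1 X2 X3 : lmodType K) (Y1 : U -> int -> X1 -> X1)
    (Y2 : U -> int -> X2 -> X2) (Y3 : U -> int -> X3 -> X3)
    (I J : X1 -> A -> X2 -> X3) :
  (forall x h y, I x h y = J x h y) -> jacobi Y1 Y2 Y3 I -> jacobi Y1 Y2 Y3 J.
Proof. by move=> IJ; have -> : I = J by do 3!apply/funext => ?; exact: IJ. Qed.

Section FromLogfreeFamilies.
Variables (K : numFieldType) (V : voa_data K).
Hypothesis V_voa : is_VOA V.
Variables W1 W2 W3 : module_data V.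
Hypotheses (w1 : is_weak_module W1) (w2 : is_weak_module W2)
  (w3 : is_weak_module W3).

(** The derivative axiom leaves no other choice, by [iop_raise]: passing from level k to level k + 1
    is raising followed by division by k + 1. *)
Definition log_levels (I : W1 -> K -> W2 -> W3) : iop W1 W2 W3 :=
  fun x h k y => (k`!%:R)^-1 *: iter k (raise_log h) (fun x y => I x h y) x y.

Lemma jacobiZ (A : pzRingType) (c : K) (I : W1 -> A -> W2 -> W3) :
  (forall h, is_bilinear (fun x y => I x h y)) -> truncated_coefs I ->
  jacobi (@act K V W1) (@act K V W2) (@act K V W3) I ->
  jacobi (@act K V W1) (@act K V W2) (@act K V W3) (fun x h y => c *: I x h y).
Proof.
move=> bI tI jac v x y l m h.
have b3 := act_bilinear w3.
have /(congr1 (fun z => c *: z)) := jac v x y l m h.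
rewrite scalerBr !fsumZ; first last.
- exact: (fsupp_jacobi1 b3 tI).
- exact: (fsupp_jacobi2 bI (act_truncated w2)).
- exact: (fsupp_jacobi3 bI (act_truncated w1)).
have swap (a : K) (z : W3) : c *: (a *: z) = a *: (c *: z).
  by rewrite !scalerA mulrC.
under eq_fsum => i do rewrite swap -(bilZr (b3 _)).
under [X in _ - X]eq_fsum => i do rewrite swap.
by under [X in _ = X -> _]eq_fsum => i do rewrite swap.
Qed.

Section FromLogfree.
Variable I : W1 -> K -> W2 -> W3.
Hypothesis fI : is_logfree I.
Hypotheses (d1 : decomposes (Lmode (W := W1) 0))
           (d2 : decomposes (Lmode (W := W2) 0)).

Let it k x h y := iter k (raise_log h) (fun x y => I x h y) x y.

Let it_facts k : (forall h, is_bilinear (fun x y => it k x h y)) /\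
  truncated_coefs (it k) /\
  jacobi (@act K V W1) (@act K V W2) (@act K V W3) (it k).
Proof.
elim: k => [|k [IHb [IHt IHj]]].
  by case: fI => b t j _; split.
split; first by move=> h; exact: (raise_log_bilinear w1 w2 w3 h (IHb h)).
split; first exact: (raise_log_truncated w3 IHt).
exact: (raise_log_jacobi V_voa w1 w2 w3 IHb IHt IHj).
Qed.

Lemma log_levels0 x h y : log_levels I x h 0 y = I x h y.
Proof. by rewrite /log_levels fact0 invr1 scale1r. Qed.

(* On generalized eigenvectors x and y, the vectors I (N^i x) h (N^j y) with  *)
(* N the nilpotent part of L(0) form a finite grid.                           *)
Let grid_log x h y : exists k0, forall k, (k0 <= k)%N -> it k x h y = 0.
Proof.
have [bI _ _ wI] := fI.
have bit k := (it_facts k).1 h.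
elim/(decomp_ind d1): x => [x x' [m mx] [n nx]|a x ax].
  exists (maxn m n) => k; rewrite geq_max => /andP[/mx xk /nx xk'].
  by rewrite (bilDl (bit k)) xk xk' addr0.
elim/(decomp_ind d2): y => [y y' [m my] [n ny]|b y yb].
  exists (maxn m n) => k; rewrite geq_max => /andP[/my yk /ny yk'].
  by rewrite (bilDr (bit k)) yk yk' addr0.
have l1 := Lmode_lin 0 w1; have l2 := Lmode_lin 0 w2; have l3 := Lmode_lin 0 w3.
have s1 := shift_lin a l1; have s2 := shift_lin b l2.
have s3 := shift_lin (a + b - h - 1) l3.
have [p px] := ax; have [q qy] := yb.
pose N1 x := Lmode (W := W1) 0 x - a *: x.
pose N2 y := Lmode (W := W2) 0 y - b *: y.
pose N3 z := Lmode (W := W3) 0 z - (a + b - h - 1) *: z.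
have eN1 i : gen_eigenspace (Lmode (W := W1) 0) a (iter i N1 x).
  by exists p; rewrite -iterD addnC iterD [iter p _ _]px (lin0 (iter_lin _ s1)).
have eN2 j : gen_eigenspace (Lmode (W := W2) 0) b (iter j N2 y).
  by exists q; rewrite -iterD addnC iterD [iter q _ _]qy (lin0 (iter_lin _ s2)).
have [r rP] : exists r, forall i k, (i < p)%N -> (r <= k)%N ->
    forall j, (j < q)%N -> iter k N3 (I (iter i N1 x) h (iter j N2 y)) = 0.
  apply: (@nat_bound (fun i k => forall j, (j < q)%N ->
    iter k N3 (I (iter i N1 x) h (iter j N2 y)) = 0)) => i.
  have [|r rP] := @nat_bound (fun j k =>
    iter k N3 (I (iter i N1 x) h (iter j N2 y)) = 0) q.
    move=> j; have [n nP] := wI _ _ h _ _ (eN1 i) (eN2 j).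
    by exists n => k nk; exact: iter_eq0_le nP.
  by exists r => k rk j jq; exact: rP.
exists (p + q + r)%N => k pqrk.
apply: (iter_raise_nil w1 w2 w3 pqrk (bI h) px qy) => i j.
have [ip|pi] := ltnP i p; last first.
  by rewrite [iter i _ x](iter_eq0_le s1 pi px) (bil0l (bI h)) (lin0 (iter_lin _ s3)).
have [jq|qj] := ltnP j q; last first.
  by rewrite [iter j _ y](iter_eq0_le s2 qj qy) (bil0r (bI h)) (lin0 (iter_lin _ s3)).
exact: rP.
Qed.

(** Truncation must be uniform in k. For generalized eigenvectors one bound serves the finite grid
    of all (N1^i x, N2^j y), and raising only combines values on that grid. *)
Let grid_trunc x y h : exists N, forall n, (N <= n)%N ->
  forall k, it k x (h + n%:R) y = 0.
Proof.
have [bI tI _ wI] := fI.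
have bit k g := (it_facts k).1 g.
elim/(decomp_ind d1): x => [x x' [m mx] [n nx]|a x ax].
  exists (maxn m n) => k; rewrite geq_max => /andP[/mx xk /nx xk'] g.
  by rewrite (bilDl (bit g _)) xk xk' addr0.
elim/(decomp_ind d2): y => [y y' [m my] [n ny]|b y yb].
  exists (maxn m n) => k; rewrite geq_max => /andP[/my yk /ny yk'] g.
  by rewrite (bilDr (bit g _)) yk yk' addr0.
have l1 := Lmode_lin 0 w1; have l2 := Lmode_lin 0 w2.
have s1 := shift_lin a l1; have s2 := shift_lin b l2.
have [p px] := ax; have [q qy] := yb.
pose N1 x := Lmode (W := W1) 0 x - a *: x.
pose N2 y := Lmode (W := W2) 0 y - b *: y.
have [N NP] : exists N, forall i k, (i < p)%N -> (N <= k)%N ->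
    forall j, (j < q)%N -> I (iter i N1 x) (h + k%:R) (iter j N2 y) = 0.
  apply: (@nat_bound (fun i k => forall j, (j < q)%N ->
    I (iter i N1 x) (h + k%:R) (iter j N2 y) = 0)) => i.
  have [r rP] := @nat_bound (fun j k =>
    I (iter i N1 x) (h + k%:R) (iter j N2 y) = 0) q
    (fun j => tI (iter i N1 x) (iter j N2 y) h).
  by exists r => k rk j jq; exact: rP.
exists N => n Nn k; apply: (iter_raise_vanish w1 w2 w3 (h + n%:R) (a := a) (b := b) (bI _)) => i j.
have [ip|pi] := ltnP i p; last first.
  by rewrite [iter i _ x](iter_eq0_le s1 pi px) (bil0l (bI _)).
have [jq|qj] := ltnP j q; last first.
  by rewrite [iter j _ y](iter_eq0_le s2 qj qy) (bil0r (bI _)).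
exact: NP.
Qed.

Lemma log_levels_intertwining : is_intertwining (log_levels I).
Proof.
split.
- move=> h k; have [bit _] := it_facts k.
  by split=> [y|x]; apply: linear_scalef; [exact: (bit h).1 | exact: (bit h).2].
- move=> x h y; have [k0 k0P] := grid_log x h y; exists k0 => k /k0P itk.
  by rewrite /log_levels [iter _ _ _ _ _]itk scaler0.
- move=> x y h; have [N NP] := grid_trunc x y h; exists N => n /NP itn k.
  by rewrite /log_levels [iter _ _ _ _ _]itn scaler0.
- by move=> k; have [b [t j]] := it_facts k; exact: jacobiZ.
move=> x h k y; have [bit [tit jit]] := it_facts k.
(* At exponent index h - 1 the commutator of L(0) contains L(-1) x at index h. Its terms with L(0) x
   and L(0) y cancel against those of [raise_log]. *)
have := iop_L0 x (h - 1) y jit; rewrite subrK => L0E.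
have kf : k.+1%:R * (k.+1`!%:R)^-1 = (k`!%:R)^-1 :> K.
  by rewrite factS natrM invfM mulrA divff ?mul1r // pnatr_eq0.
have R : iter k.+1 (raise_log (h - 1)) (fun x y => I x (h - 1) y) x y
    = Lmode 0 (it k x (h - 1) y) + (h - 1 + 1) *: it k x (h - 1) y
      - it k (Lmode 0 x) (h - 1) y - it k x (h - 1) (Lmode 0 y) by [].
rewrite /log_levels [k.+1%:R *: (_ *: _)]scalerA kf R L0E.
rewrite -/(it k _ h y) -/(it k x (h - 1) y).
by lmod_conv K.
Qed.

End FromLogfree.
End FromLogfreeFamilies.

(** * Fusion products *)

Section IntertwiningOperators.
Variables (K : numFieldType) (V : voa_data K).
Hypothesis V_voa : is_VOA V.
Variables W1 W2 W3 : module_data V.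
Hypotheses (w1 : is_weak_module W1) (w2 : is_weak_module W2)
  (w3 : is_weak_module W3).
Variable Y : iop W1 W2 W3.
Hypothesis iY : is_intertwining Y.

Lemma iop_truncated_coefs k : truncated_coefs (fun x h => Y x h k).
Proof. by move=> x y h; have [N NP] := iop_truncated iY x y h; exists N => n /NP. Qed.

(** The derivative axiom at h + 1 and the commutator with L(0) both contain L(-1) x at index h + 1;
    eliminating it leaves this recursion. *)
Lemma iop_raise x h k y :
  k.+1%:R *: Y x h k.+1 y = raise_log h (fun x y => Y x h k y) x y.
Proof.
have := iop_derivative iY x (h + 1) k y; rewrite addrK /raise_log.
rewrite (iop_L0 x h y (iop_jacobi iY k)) => ->.
lmod K.
Qed.

(** L(0) - (a + b - h - 1) sends the coefficient at level k to the coefficients with x replaced by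
    N1 x, with y replaced by N2 y, and at level k + 1. With r a common bound for the powers of log x
    on the grid of x and y, each of these lowers p + q + (r - k). *)
Lemma iop_weight a b h k x y :
  gen_eigenspace (Lmode (W := W1) 0) a x ->
  gen_eigenspace (Lmode (W := W2) 0) b y ->
  gen_eigenspace (Lmode (W := W3) 0) (a + b - h - 1) (Y x h k y).
Proof.
have l1 := Lmode_lin 0 w1; have l2 := Lmode_lin 0 w2; have l3 := Lmode_lin 0 w3.
have s1 := shift_lin a l1; have s2 := shift_lin b l2.
have bY := iop_bilinear iY h.
move=> [p px] [q qy].
pose N1 x := Lmode (W := W1) 0 x - a *: x.
pose N2 y := Lmode (W := W2) 0 y - b *: y.
have [r rP] : exists r, forall i k, (i < p)%N -> (r <= k)%N ->
    forall j, (j < q)%N -> Y (iter i N1 x) h k (iter j N2 y) = 0.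
  apply: (@nat_bound (fun i k => forall j, (j < q)%N ->
    Y (iter i N1 x) h k (iter j N2 y) = 0)) => i.
  have [r rP] := @nat_bound (fun j k =>
    Y (iter i N1 x) h k (iter j N2 y) = 0) q
    (fun j => iop_log iY (iter i N1 x) h (iter j N2 y)).
  by exists r => m rk j jq; exact: rP.
have {rP} rP i j m : (r <= m)%N -> Y (iter i N1 x) h m (iter j N2 y) = 0.
  move=> rm; have [ip|pi] := ltnP i p; last first.
    by rewrite [iter i _ x](iter_eq0_le s1 pi px) (bil0l (bY _)).
  have [jq|qj] := ltnP j q; last first.
    by rewrite [iter j _ y](iter_eq0_le s2 qj qy) (bil0r (bY _)).
  exact: rP.
have [n] := ubnP (p + q + (r - k)).
elim: n p q k x y px qy rP => // n IH [|p] [|q] k x y px qy rP pqr.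
- by have -> : x = 0 := px; rewrite (bil0l (bY _)); exact: gen_eigen0.
- by have -> : x = 0 := px; rewrite (bil0l (bY _)); exact: gen_eigen0.
- by have -> : y = 0 := qy; rewrite (bil0r (bY _)); exact: gen_eigen0.
have [rk|kr] := leqP r k.
  by rewrite (rP 0%N 0%N k rk); exact: gen_eigen0.
suff [m mP] : gen_eigenspace (Lmode (W := W3) 0) (a + b - h - 1)
    (Lmode 0 (Y x h k y) - (a + b - h - 1) *: Y x h k y).
  by exists m.+1; rewrite iterSr.
have -> : Lmode 0 (Y x h k y) - (a + b - h - 1) *: Y x h k y
    = Y (N1 x) h k y + Y x h k (N2 y) + k.+1%:R *: Y x h k.+1 y.
  rewrite iop_raise /raise_log /N1 /N2 (bilBl (bY _)) (bilBr (bY _)).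
  by rewrite (bilZl (bY _)) (bilZr (bY _)); lmod K.
apply: gen_eigenD => //; first apply: gen_eigenD => //.
- have lt : (p + q.+1 + (r - k) < n)%N by lia.
  apply: (IH p q.+1 k (N1 x) y _ qy _ lt); first by rewrite -iterSr.
  by move=> i j m rm; rewrite -[iter i _ _]iterSr; exact: rP.
- have lt : (p.+1 + q + (r - k) < n)%N by lia.
  apply: (IH p.+1 q k x (N2 y) px _ _ lt); first by rewrite -iterSr.
  by move=> i j m rm; rewrite -[iter j _ _]iterSr; exact: rP.
have lt : (p.+1 + q.+1 + (r - k.+1) < n)%N by lia.
by apply: gen_eigenZ => //; exact: (IH p.+1 q.+1 k.+1 x y px qy rP lt).
Qed.

(** The derivative axiom, solved for its last term, writes level k + 1 as a combination of
    coefficients of level k. *)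
Lemma iop_levels_ind (S : W3 -> Prop) :
  (forall c u v, S u -> S v -> S (c *: u + v)) ->
  (forall x h y, S (Y x h 0 y)) -> forall x h k y, S (Y x h k y).
Proof.
move=> Sl S0 x h k y; elim: k x h => // k IH x h.
have k0 : k.+1%:R != 0 :> K by rewrite pnatr_eq0.
have S00 : S 0 by have := Sl (-1) _ _ (S0 x h y) (S0 x h y); rewrite scaleN1r addNr.
have -> : Y x h k.+1 y
    = (k.+1%:R^-1) *: (Y (Lmode (-1) x) (h + 1) k y + (h + 1) *: Y x h k y).
  have := iop_derivative iY x (h + 1) k y; rewrite addrK => ->.
  by rewrite addrC addrA subrr add0r scalerA mulVf ?scale1r.
rewrite -[_ *: _]addr0; apply: (Sl) => //; rewrite addrC.
by apply: Sl; exact: IH.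
Qed.

Lemma iop_levels_eq (X : module_data V) (wX : is_weak_module X) (J : iop W1 W2 X)
    (f : W3 -> X) : is_intertwining J -> is_hom f ->
  (forall x h y, f (Y x h 0 y) = J x h 0 y) ->
  forall x h k y, f (Y x h k y) = J x h k y.
Proof.
move=> iJ [fl fh] f0 x h k y; elim: k x h => // k IH x h.
have k0 : k.+1%:R != 0 :> K by rewrite pnatr_eq0.
have solve (P : zmodType) (A B D : P) : A = - B + D -> D = A + B.
  by move=> ->; rewrite addrAC addNr add0r.
have := iop_derivative iY x (h + 1) k y; have := iop_derivative iJ x (h + 1) k y.
rewrite !addrK => /solve JE /solve YE.
by apply: (scalerI k0); rewrite -(linZ fl) JE YE (linD fl) (linZ fl) !IH.
Qed.

End IntertwiningOperators.

Section IntertwiningTransfer.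
Variables (K : numFieldType) (V : voa_data K) (W1 W2 W3 X : module_data V).
Hypotheses (w1 : is_weak_module W1) (w2 : is_weak_module W2)
  (w3 : is_weak_module W3) (wX : is_weak_module X).
Variables (e : W3 -> X) (Y : iop W1 W2 W3).
Hypothesis he : is_hom e.

Lemma intertwining_comp : is_intertwining Y ->
  is_intertwining (fun x h k y => e (Y x h k y) : X).
Proof.
case: he => el eh iY; split.
- move=> h k; split=> [y|x].
    by apply: (linear_compf el); exact: (iop_bilinear iY h k).1.
  by apply: (linear_compf el); exact: (iop_bilinear iY h k).2.
- by move=> x h y; have [k0 P] := iop_log iY x h y; exists k0 => k /P ->; exact: lin0.
- move=> x y h; have [N P] := iop_truncated iY x y h.
  by exists N => n /P Pn k; rewrite Pn lin0.
- move=> k v x y l m h.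
  have bY g := iop_bilinear iY g k; have tY := iop_truncated_coefs iY k.
  have b3 := act_bilinear w3.
  have := congr1 e (iop_jacobi iY k v x y l m h).
  rewrite (linB el) !(fsum_lin el).
  + under eq_fsum => i do rewrite (linZ el) eh.
    under [X in _ - X]eq_fsum => i do rewrite (linZ el).
    by under [X in _ = X -> _]eq_fsum => i do rewrite (linZ el).
  + exact: (fsupp_jacobi3 bY (act_truncated w1)).
  + exact: (fsupp_jacobi2 bY (act_truncated w2)).
  exact: (fsupp_jacobi1 b3 tY).
move=> x h k y; rewrite (iop_derivative iY) (linD el) (linN el).
by rewrite !(linZ el).
Qed.

Hypothesis ei : injective e.

(** Every axiom is an equation or a vanishing statement and can be tested after an injective
    homomorphism. This is used to restrict the target of an operator to its image. *)
Lemma intertwining_inj :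
  is_intertwining (fun x h k y => e (Y x h k y) : X) -> is_intertwining Y.
Proof.
case: he => el eh iY.
have bY h k : is_bilinear (fun x y => Y x h k y).
  have bil := iop_bilinear iY h k.
  by split=> [y|x] c u v; apply: ei; rewrite el; [exact: bil.1 | exact: bil.2].
have e0 u : e u = 0 -> u = 0 by move=> eu; apply: ei; rewrite eu lin0.
split=> //.
- by move=> x h y; have [k0 P] := iop_log iY x h y; exists k0 => k /P/e0.
- move=> x y h; have [N P] := iop_truncated iY x y h.
  by exists N => n /P Pn k; exact: e0.
- move=> k v x y l m h.
  have tY : truncated_coefs (fun x h => Y x h k).
    move=> {}x {}y {}h; have [N P] := iop_truncated iY x y h.
    by exists N => n /P Pn; exact: e0.
  have b3 := act_bilinear w3.
  apply: ei; rewrite (linB el) !(fsum_lin el).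
  + under eq_fsum => i do rewrite (linZ el) eh.
    under [X in _ - X]eq_fsum => i do rewrite (linZ el).
    under [X in _ = X]eq_fsum => i do rewrite (linZ el).
    exact: (iop_jacobi iY k v x y l m h).
  + exact: (fsupp_jacobi3 (bY^~ k) (act_truncated w1)).
  + exact: (fsupp_jacobi2 (bY^~ k) (act_truncated w2)).
  exact: (fsupp_jacobi1 b3 tY).
move=> x h k y; apply: ei; rewrite (linD el) (linN el) !(linZ el).
exact: (iop_derivative iY).
Qed.

End IntertwiningTransfer.

Lemma mem_span (K : fieldType) (X : lmodType K) (G : set X) x : G x -> x \in Defs.span G.
Proof.
move=> Gx; apply/asboolP; exists [:: (1, x)]; rewrite big_seq1 scale1r.
by split=> // p; rewrite inE => /eqP ->.
Qed.

Lemma span_ind (K : fieldType) (X : lmodType K) (S : X -> Prop) (G : set X) :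
  (forall c u v, S u -> S v -> S (c *: u + v)) -> S 0 ->
  (forall x, G x -> S x) -> forall x, x \in Defs.span G -> S x.
Proof.
move=> Sl S0 SG _ /asboolP[s [sG ->]].
elim: s sG => [|p s IH] sG; first by rewrite big_nil.
rewrite big_cons; apply: (Sl); first by apply/SG/sG; rewrite mem_head.
by apply: IH => q qs; apply: sG; rewrite in_cons qs orbT.
Qed.

(** * Images of intertwining operators *)

Section ImageModule.
Variables (K : numFieldType) (V : voa_data K) (W1 W2 X : module_data V).
Hypotheses (w1 : is_weak_module W1) (w2 : is_weak_module W2)
  (wX : is_weak_module X).
Variable J : iop W1 W2 X.
Hypothesis iJ : is_intertwining J.

(** The commutator formula writes v_n of a coefficient as a finite sum of coefficients, so the
    default value in [image_module] is never reached. *)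
Lemma span_iop_stable v n x :
  x \in Defs.span (iop_coefs J) -> act v n x \in Defs.span (iop_coefs J).
Proof.
have bv := act_bilinear wX n.
apply: (span_ind (S := fun x => act v n x \in Defs.span (iop_coefs J))).
- move=> c x1 x2 x1J x2J; rewrite (bilDr bv) (bilZr bv).
  by apply: rpredD => //; apply: rpredZ.
- by rewrite (bil0r bv) rpred0.
move=> _ [y1 [h [k [y2 ->]]]].
have /eqP := mode_commutator v y1 y2 n h (iop_jacobi iJ k).
rewrite subr_eq => /eqP ->; apply: rpredD; last first.
  by apply: mem_span; exists y1, h, k, (act v n y2).
apply: rpred_sum => i _; apply: rpredZ; apply: mem_span.
by exists (act v i%:Z y1), (h + n%:~R - i%:R), k, y2.
Qed.

Lemma image_val_hom : is_hom (W := image_module J) (fun z => val z : X).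
Proof.
split=> [|v n z]; first exact: linearP.
by rewrite insubdK //; apply: span_iop_stable; exact: valP.
Qed.

Definition image_iop : iop W1 W2 (image_module J) := fun x h k y =>
  SpanElt (mem_span (ex_intro _ x (ex_intro _ h (ex_intro _ k
    (ex_intro _ y (erefl (J x h k y))))))).

Lemma image_iop_intertwining : is_weak_module (image_module J) ->
  is_intertwining image_iop.
Proof.
move=> wI.
have inj : injective (fun z : image_module J => val z : X) by exact: val_inj.
exact: (intertwining_inj w1 w2 wI (Y := image_iop) image_val_hom inj iJ).
Qed.

End ImageModule.

Lemma is_hom_comp (K : fieldType) (V : voa_data K) (A B D : module_data V) (g : B -> D) (f : A -> B) :
  is_hom g -> is_hom f -> is_hom (fun x => g (f x)).
Proof.
move=> [gl gh] [fl fh]; split; first exact: linear_compf.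
by move=> v n w; rewrite fh gh.
Qed.

Section FusionProducts.
Variables (K : numFieldType) (V : voa_data K).
Hypothesis V_voa : is_VOA V.
Variable C : module_data V -> Prop.
Hypothesis C_cat : is_category C.
Variables (W1 W2 P : module_data V) (Y : iop W1 W2 P).
Hypotheses (C1 : C W1) (C2 : C W2) (fus : is_fusion_product C Y).
Variable X : module_data V.
Hypotheses (wX : is_weak_module X)
  (CX : forall J : iop W1 W2 X, is_intertwining J -> C (image_module J)).

Let w1 : is_weak_module W1. Proof. by case: (C_cat.1 _ C1). Qed.
Let w2 : is_weak_module W2. Proof. by case: (C_cat.1 _ C2). Qed.
Let wP : is_weak_module P.
Proof. by case: (C_cat.1 _ (fusion_object fus)). Qed.

Lemma fusion_factor (J : iop W1 W2 X) : is_intertwining J ->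
  exists f : P -> image_module J,
    is_hom f /\ forall x h k y, f (Y x h k y) = image_iop J x h k y.
Proof.
move=> iJ; have CJ := CX iJ.
have [f [fP _]] := fusion_universal fus CJ
  (image_iop_intertwining w1 w2 wX iJ (C_cat.1 _ CJ).1).
by exists f.
Qed.

(** [log_levels] completes [I] to an intertwining operator whose image is in [C] by [CX]; f is the
    factorization through this image followed by the inclusion into X. *)
Lemma fusion_logfree (I : W1 -> K -> W2 -> X) : is_logfree I ->
  exists2 f : P -> X, is_hom f & forall x h y, f (Y x h 0 y) = I x h y.
Proof.
move=> fI; have iJ := log_levels_intertwining V_voa w1 w2 wX fI
  (C_cat.1 _ C1).2 (C_cat.1 _ C2).2.
have [f [fh fE]] := fusion_factor iJ.
exists (fun p => val (f p) : X); first exact: is_hom_comp (image_val_hom wX iJ) fh.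
by move=> x h y; rewrite fE /= log_levels0.
Qed.

(* The retraction g serves to compare the image of e \o Y with that of Y,     *)
(* which is not known to be an object of C beforehand.                        *)
Lemma fusion_span (e : P -> X) (g : X -> P) : is_hom e -> is_hom g ->
  cancel e g -> forall S : P -> Prop,
  (forall c u v, S u -> S v -> S (c *: u + v)) ->
  (forall x h y, S (Y x h 0 y)) -> forall p, S p.
Proof.
move=> he hg eg S Sl SY; have iY := fusion_intertwining fus.
have iJ := intertwining_comp w1 w2 wP he iY.
have [f [fh fE]] := fusion_factor iJ.
pose f' p := g (val (f p) : X).
have hf' : is_hom f' by apply: is_hom_comp hg _; exact: is_hom_comp (image_val_hom wX iJ) fh.
(* [f'] and the identity both carry [Y] to itself, so they coincide, and every vector is [g] of a
   combination of coefficients of [e \o Y]. *)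
have [u [_ uU]] := fusion_universal fus (fusion_object fus) iY.
have f'id : f' = id.
  rewrite -(uU f'); last by split=> // x h k y; rewrite /f' fE /= eg.
  by rewrite -(uU id).
have SYk := iop_levels_ind iY Sl SY.
move=> p; rewrite -[p]/(id p) -f'id /f'.
case: (f p) => x; apply: (span_ind (S := fun x => S (g x))) => [c x1 x2 S1 S2||].
- by rewrite hg.1; exact: Sl.
- by rewrite (lin0 hg.1) -(subrr (Y 0 0 0%N 0)) -scaleN1r addrC; exact: Sl.
by move=> _ [x1 [h [k [x2 ->]]]]; rewrite eg.
Qed.

End FusionProducts.

(** * Modules for the tensor product *)

Lemma tensor_ind (K : fieldType) (M W : lmodType K) (S : tensor M W -> Prop) :
  (forall s t, S s -> S t -> S (s + t)) -> (forall m w, S (tpure m w)) ->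
  forall t, S t.
Proof.
move=> SD Sp t; have [s ->] := tensor_spanned t.
apply: (big_ind S) => //.
by rewrite -(bil0l (tpure_bilinear M W) 0).
Qed.

Lemma tpureE0 (K : fieldType) (M W : lmodType K) :
  ((forall w : W, tpure (0 : M) w = 0) * (forall m : M, tpure m (0 : W) = 0))%type.
Proof. by split=> x; rewrite ?(bil0l (tpure_bilinear M W)) ?(bil0r (tpure_bilinear M W)). Qed.

Lemma linear_fsum (K : fieldType) (V W : lmodType K) (T : choiceType)
    (F : T -> V -> W) :
  (forall i, linear (F i)) -> (forall x, fsupp (F ^~ x)) ->
  linear (fun x => \sum_(i \in [set: T]) F i x).
Proof.
move=> Fl fF a x y; rewrite (fsumZ _ (fF x)) -fsumD //.
  by apply: eq_fsum => i; rewrite Fl.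
exact: (fsupp_lin (linear_scale a) (fF x)).
Qed.

Section TensorAction.
Variables (K : numFieldType) (U V : voa_data K).
Variables (M : module_data U) (W : module_data V).
Hypotheses (wM : is_weak_module M) (wW : is_weak_module W).

Let bM := act_bilinear wM.
Let bW := act_bilinear wW.
Let bt := tpure_bilinear M W.

Lemma tensor_act_fsupp u v (n : int) (m : M) (w : W) :
  fsupp (fun i : int => tpure (act u i m) (act v (n - 1 - i) w)).
Proof.
have [N1 m0] := act_truncated wM u m; have [N2 w0] := act_truncated wW v w.
pose B := (absz (N1 - (n - 1 - N2)%R)%R).+1; pose e (k : nat) := n - 1 - N2 + k%:Z.
have fA : finite_set (e @` `I_B) by apply: finite_image; exact: finite_II.
apply: (sub_finite_set _ fA) => i /= nz.
have [Ni|iN] := leP N1 i; first by rewrite m0 // tpureE0 eqxx in nz.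
have [Nj|jN] := leP N2 (n - 1 - i); first by rewrite w0 // tpureE0 eqxx in nz.
by exists (absz (i - (n - 1 - N2)%R)%R) => /=; rewrite /e /B; lia.
Qed.

Lemma tensor_act_bilinear1 u v (n : int) : is_bilinear (fun (m : M) (w : W) =>
  \sum_(i \in [set: int]) tpure (act u i m) (act v (n - 1 - i) w)).
Proof.
split=> [w|m].
  apply: linear_fsum => [i|m]; last exact: tensor_act_fsupp.
  by apply: (linear_compf (bt.1 _)); exact: (bM i).2.
apply: linear_fsum => [i|w]; last exact: tensor_act_fsupp.
by apply: (linear_compf (bt.2 _)); exact: (bW _).2.
Qed.

Lemma tensor_act_bilinear2 (n : int) x : is_bilinear (fun (u : U) (v : V) =>
  tlift (fun (m : M) (w : W) =>
    \sum_(i \in [set: int]) tpure (act u i m) (act v (n - 1 - i) w)) x).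
Proof.
have tl u v := tlift_linear (tensor_act_bilinear1 u v n).
elim/tensor_ind: x => [s t sb tb|m w].
  split=> [v a u u'|u a v v'] /=.
    rewrite (linD (tl (a *: u + u') v)) (linD (tl u v)) (linD (tl u' v)).
    by rewrite sb.1 tb.1 scalerDr addrACA.
  rewrite (linD (tl u (a *: v + v'))) (linD (tl u v)) (linD (tl u v')).
  by rewrite sb.2 tb.2 scalerDr addrACA.
split=> [v|u] a x y; rewrite !tliftE; try exact: tensor_act_bilinear1.
  apply: (linear_fsum (F := fun i u => tpure (act u i m) (act v (n - 1 - i) w))).
    by move=> i; apply: (linear_compf (bt.1 _)); exact: (bM i).1.
  by move=> z; exact: tensor_act_fsupp.
apply: (linear_fsum (F := fun i v => tpure (act u i m) (act v (n - 1 - i) w))).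
  by move=> i; apply: (linear_compf (bt.2 _)); exact: (bW _).1.
by move=> z; exact: tensor_act_fsupp.
Qed.

Lemma tensor_actE (u : U) (v : V) n (m : M) (w : W) :
  tensor_act (tpure u v) n (tpure m w)
  = \sum_(i \in [set: int]) tpure (act u i m) (act v (n - 1 - i) w).
Proof.
rewrite /tensor_act tliftE ?tliftE //; first exact: tensor_act_bilinear1.
exact: tensor_act_bilinear2.
Qed.

Lemma tensor_act_left (u : U) n (m : M) (w : W) :
  tensor_act (tpure u (vacuum V)) n (tpure m w) = tpure (act u n m) w.
Proof.
rewrite tensor_actE (@fsum1 _ _ _ n) => [|i ni]; rewrite (act_vacuum wW).
  by case: eqP => [_|] //; lia.
by case: eqP => [|_]; [lia | rewrite tpureE0].
Qed.

Lemma tensor_act_right (v : V) n (m : M) (w : W) :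
  tensor_act (tpure (vacuum U) v) n (tpure m w) = tpure m (act v n w).
Proof.
rewrite tensor_actE (@fsum1 _ _ _ (-1)) => [|i ni]; rewrite (act_vacuum wM).
  by rewrite eqxx; congr (tpure m (act v _ w)); lia.
by rewrite (negPf ni) tpureE0.
Qed.

End TensorAction.

Section TensorModules.
Variables (K : numFieldType) (U V : voa_data K).
Hypotheses (U_voa : is_VOA U) (V_voa : is_VOA V).

Let bUV := tpure_bilinear U V.
Let wU := voa_adjoint U_voa.
Let wV := voa_adjoint V_voa.

Section Restriction.
Variable X : module_data (tensor_voa U V).
Hypothesis wX : is_weak_module X.
Let bX := act_bilinear wX.

Lemma restrict_left_weak : is_weak_module (restrict_left X).
Proof.
split.
- move=> n; split=> [x|u]; last exact: (bX n).2.
  by apply: (linear_compf ((bX n).1 x) (bUV.1 _)).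
- by move=> u x; exact: (act_truncated wX (tpure u (vacuum V)) x).
- by move=> n x; exact: (act_vacuum wX).
move=> u u' x l m h.
have := act_jacobi wX (tpure u (vacuum V)) (tpure u' (vacuum V)) x l m h.
under [X in _ = X -> _]eq_fsum => i do
  rewrite [vmode _ _ _](tensor_act_left wU wV).
exact.
Qed.

Lemma restrict_right_weak : is_weak_module (restrict_right X).
Proof.
split.
- move=> n; split=> [x|u]; last exact: (bX n).2.
  by apply: (linear_compf ((bX n).1 x) (bUV.2 _)).
- by move=> v x; exact: (act_truncated wX (tpure (vacuum U) v) x).
- by move=> n x; exact: (act_vacuum wX).
move=> v v' x l m h.
have := act_jacobi wX (tpure (vacuum U) v) (tpure (vacuum U) v') x l m h.
under [X in _ = X -> _]eq_fsum => i do
  rewrite [vmode _ _ _](tensor_act_right wU wV).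
exact.
Qed.

Lemma left_right_product u v n : 0 <= n ->
  vmode (v := tensor_voa U V) (tpure u (vacuum V)) n (tpure (vacuum U) v) = 0.
Proof.
move=> n0; rewrite [LHS](tensor_act_left wU wV) [act _ _ _](voa_creation0 U_voa) //.
by rewrite tpureE0.
Qed.

(** All products of nonnegative index of u (x) 1 with 1 (x) v vanish, so the commutator formula has
    no terms. *)
Lemma left_right_comm u v m n (x : X) :
  act (m := restrict_left X) u m (act (m := restrict_right X) v n x)
  = act (m := restrict_right X) v n (act (m := restrict_left X) u m x).
Proof.
have := mode_commutator (tpure u (vacuum V)) (tpure (vacuum U) v) x m n
  (act_jacobi wX).
rewrite fsum0 => [/eqP|i]; first by rewrite subr_eq0 => /eqP.
by rewrite left_right_product // (bil0l (bX _)) scaler0.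
Qed.

(* The normally ordered product, i.e. the Jacobi identity for u (x) 1 and     *)
(* 1 (x) v at (l, m) = (-1, 0).                                               *)
Lemma act_tpure u v n (x : X) :
  act (tpure u v : tensor_voa U V) n x
  = \sum_(i \in [set: nat]) ((-1) ^+ i * binz K (-1) i) *:
      act (m := restrict_left X) u (0 - 1 - i%:Z)
        (act (m := restrict_right X) v (n + i%:R) x)
  - \sum_(i \in [set: nat]) ((-1) ^ (-1 + i%:Z) * binz K (-1) i) *:
      act (m := restrict_right X) v (n + (-1)%:~R - i%:R)
        (act (m := restrict_left X) u (0 + i%:Z) x).
Proof.
have := act_jacobi wX (tpure u (vacuum V)) (tpure (vacuum U) v) x (-1) 0 n.
rewrite [RHS]fsum_nat1 => [|i]; last by rewrite binz_0S scale0r.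
rewrite binz0 scale1r addr0 => E; apply: (etrans _ (esym E)).
have -> : vmode (v := tensor_voa U V) (tpure u (vacuum V)) (-1 + 0%N%:Z)
    (tpure (vacuum U) v) = tpure u v.
  rewrite [LHS](tensor_act_left wU wV).
  by congr (tpure _ v); exact: (voa_creation U_voa).
by congr (act _ _ _); rewrite ?addr0 ?subr0.
Qed.

Lemma Lmode_tensor n (x : X) : Lmode n x
  = Lmode (W := restrict_left X) n x + Lmode (W := restrict_right X) n x.
Proof. exact: (bilDl (bX _)). Qed.

Lemma Lmode_comm m n (x : X) :
  Lmode (W := restrict_left X) m (Lmode (W := restrict_right X) n x)
  = Lmode (W := restrict_right X) n (Lmode (W := restrict_left X) m x).
Proof. exact: left_right_comm. Qed.

End Restriction.

(** By [act_tpure] the modes of u (x) v are sums of compositions of modes of u (x) 1 and 1 (x) v,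
    finite on each vector. *)
Lemma tensor_hom (X X' : module_data (tensor_voa U V)) (f : X -> X') :
  is_weak_module X -> is_weak_module X' ->
  is_hom (W := restrict_left X) (W' := restrict_left X') f ->
  is_hom (W := restrict_right X) (W' := restrict_right X') f -> is_hom f.
Proof.
move=> wX wX' [fl fL] [_ fR]; split=> // t n x.
have bX := act_bilinear wX n; have bX' := act_bilinear wX' n.
elim/tensor_ind: t => [s t sE tE|u v].
  by rewrite (bilDl bX) (bilDl bX') (linD fl) sE tE.
rewrite (act_tpure wX) (act_tpure wX') (linB fl) !(fsum_lin fl).
- under eq_fsum => i do rewrite (linZ fl) fL fR.
  by under [X in _ - X = _]eq_fsum => i do rewrite (linZ fl) fR fL.
- apply: (@fsupp_jacobi2 _ _ _ _ _ _ (act (m := restrict_left X))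
    (fun v n x => act (m := restrict_right X) v n x)).
    exact: act_bilinear (restrict_right_weak wX).
  exact: act_truncated (restrict_left_weak wX).
apply: (@fsupp_jacobi1 _ _ _ _ _ _ (act (m := restrict_left X))
    (fun v n x => act (m := restrict_right X) v n x)).
  exact: act_bilinear (restrict_left_weak wX).
move=> v' x' h; have [N N0] := act_truncated (restrict_right_weak wX) v' x'.
by exists `|N - h|%N => k kN; rewrite N0 // natz; lia.
Qed.

End TensorModules.

(** * The tensor product of two intertwining operators *)

Section CosetSupports.
Variable K : numFieldType.

(* S lies in a finite union of sets a - N.                                    *)
Definition lowfin (S : K -> Prop) := exists s : seq K, forall h, S h ->
  exists2 a, a \in s & exists n : nat, h = a - n%:R.

Lemma lowfin_sub (S T : K -> Prop) : lowfin T -> (forall h, S h -> T h) -> lowfin S.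
Proof. by move=> [s sP] ST; exists s => h /ST/sP. Qed.

Lemma lowfinU (S T : K -> Prop) : lowfin S -> lowfin T ->
  lowfin (fun h => S h \/ T h).
Proof.
move=> [s sP] [t tP]; exists (s ++ t) => h [/sP[a]|/tP[a]] aI an.
  by exists a; rewrite ?mem_cat ?aI.
by exists a; rewrite ?mem_cat ?aI ?orbT.
Qed.

(** If h1 = a - n1 and h2 = b - n2, then n + n1 + n2 = a + b - x. This is one of finitely many
    natural numbers, the values of [D], and it bounds both n and n1. *)
Lemma lowfin_pair (S T : K -> Prop) (x : K) : lowfin S -> lowfin T ->
  exists (B : nat) (H : set K), finite_set H /\ forall h1 h2 (n : nat),
    S h1 -> T h2 -> h1 + h2 = x + n%:R -> (n < B)%N /\ H h1.
Proof.
move=> [s sP] [t tP].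
pose D a b := xget 0%N [set d | a + b - x = d%:R].
have DP a b d : a + b - x = d%:R -> D a b = d.
  move=> E; apply/eqP; rewrite -(eqr_nat K) -E; apply/eqP/esym.
  by apply: (@xgetPex _ 0%N [set d | a + b - x = d%:R]); exists d.
pose B := (\max_(a <- s) \max_(b <- t) D a b).+1.
exists B, (\bigcup_(a in [set` s]) ((fun n : nat => a - n%:R) @` `I_B)); split.
  by apply: bigcup_finite => [|a _]; [exact: finite_seq | exact/finite_image/finite_II].
move=> h1 h2 n /sP[a aI [n1 h1E]] /tP[b bI [n2 h2E]] E.
have DE : D a b = (n + n1 + n2)%N.
  apply: DP; rewrite !natrD; apply/eqP; rewrite -subr_eq0; apply/eqP.
  have -> : a + b - x - (n%:R + n1%:R + n2%:R) = (a - n1%:R) + (b - n2%:R) - (x + n%:R).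
    by ring.
  by rewrite -h1E -h2E E subrr.
have DB : (D a b < B)%N.
  rewrite ltnS; apply: (@leq_trans (\max_(b' <- t) D a b')).
    exact: leq_bigmax_seq.
  exact: (leq_bigmax_seq (F := fun a' => \max_(b' <- t) D a' b')).
split; first by lia.
by exists a => //; exists n1 => //=; lia.
Qed.

Lemma finite_int_interval (lo hi : int) : finite_set [set p : int | lo <= p < hi].
Proof.
apply: (sub_finite_set (B := (fun k : nat => lo + k%:Z) @` `I_(absz (hi - lo)%R))).
  by move=> p /= /andP[lop phi]; exists (absz (p - lo)%R) => /=; lia.
exact/finite_image/finite_II.
Qed.

End CosetSupports.

Lemma fsum_ord (P : nmodType) (F : nat -> P) N :
  (forall i, (N <= i)%N -> F i = 0) ->
  \sum_(i \in [set: nat]) F i = \sum_(i < N) F i.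
Proof.
move=> F0; rewrite fsbig_ord; apply/esym/fsbig_widen => // i [_] /= /negP.
by rewrite -leqNgt; exact: F0.
Qed.

Lemma fsupp_bound (P : nmodType) (F : nat -> P) : fsupp F ->
  exists N, forall i, (N <= i)%N -> F i = 0.
Proof.
move=> /fsuppP[A FA]; exists (\max_(i <- A) i).+1 => i Ni; apply: FA.
apply: contraTN Ni => iA; rewrite -ltnNge ltnS.
exact: (leq_bigmax_seq (F := id)).
Qed.

Lemma fsum_natS (P : nmodType) (F : nat -> P) : fsupp F ->
  \sum_(i \in [set: nat]) F i = F 0%N + \sum_(i \in [set: nat]) F i.+1.
Proof.
move=> /fsupp_bound[N F0]; rewrite (@fsum_ord _ _ N.+1); last by move=> i /ltnW/F0.
rewrite (@fsum_ord _ (fun i => F i.+1) N) ?big_ord_recl // => i Ni.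
by rewrite F0 // leqW.
Qed.

(** * The Jacobi identity for arrays of coefficients and for their products *)

Section Arrays.
Variables (K : numFieldType).

Section OneArray.
Variable P : lmodType K.
Implicit Types c d : int -> K -> P.

(* An array c stands for the series whose coefficient at x1^(-p-1) x2^(-h-1)  *)
(* is c p h. Those of kind 1 come from Y(u, x1) I(m1, x2) m2, those of kind 2 *)
(* from I(m1, x2) Y(u, x1) m2 and I(Y(u, x1) m1, x2) m2. Multiplication by    *)
(* x1 + s x2 is dplus s, and sum1, sum2, sum3 are the three sums of jacobi.   *)
Definition kind1 c := lowfin (fun h => exists p, c p h != 0) /\
  forall h, exists N : int, forall p, N <= p -> c p h = 0.
Definition kind2 c := (exists N : int, forall p h, N <= p -> c p h = 0) /\
  forall p, lowfin (fun h => c p h != 0).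

Definition dplus (s : K) c p h := c (p + 1) h + s *: c p (h + 1).

Definition trunc_h c := forall h, exists N : nat, forall i p, (N <= i)%N ->
  c p (h + i%:R) = 0.
Definition trunc_p c := exists N : int, forall p h, N <= p -> c p h = 0.

Definition sum1 c l m h := \sum_(i \in [set: nat])
  ((-1) ^+ i * binz K l i) *: c (m + l - i%:Z) (h + i%:R).
Definition sum2 c l m h := \sum_(i \in [set: nat])
  ((-1) ^ (l + i%:Z) * binz K l i) *: c (m + i%:Z) (h + l%:~R - i%:R).
Definition sum3 c l m h := \sum_(i \in [set: nat])
  binz K m i *: c (l + i%:Z) (h + m%:~R - i%:R).

Definition jac_arrays c1 c2 c3 :=
  forall l m h, sum1 c1 l m h - sum2 c2 l m h = sum3 c3 l m h.

Lemma kind1_trunc c : kind1 c -> trunc_h c.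
Proof.
move=> [cl _] h.
have [B [H [_ BP]]] := lowfin_pair h cl (T := fun x => x = 0)
  (ex_intro _ [:: 0] (fun h h0 => ex_intro2 _ _ 0 (mem_head _ _)
     (ex_intro _ 0%N (etrans h0 (esym (subr0 0)))))).
exists B => i p Bi; apply/eqP; apply: contraTT Bi => nz.
rewrite -ltnNge; apply: (BP (h + i%:R) 0 i _ erefl _).1; last by rewrite addr0.
by exists p.
Qed.

Lemma fsupp_sum1 c (a : nat -> K) (q : nat -> int) h : trunc_h c ->
  fsupp (fun i : nat => a i *: c (q i) (h + i%:R)).
Proof.
by move=> /(_ h)[N cN]; apply: (@fsupp_nat _ _ N) => i Ni; rewrite cN // scaler0.
Qed.

Lemma fsupp_sum2 c (a : nat -> K) m (g : nat -> K) : trunc_p c ->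
  fsupp (fun i : nat => a i *: c (m + i%:Z) (g i)).
Proof.
move=> [N cN]; apply: (@fsupp_nat _ _ (absz (N - m)%R)) => i Ni.
by rewrite cN ?scaler0 //; lia.
Qed.

(** Pascal's rule, which here is multiplication by x0 = x1 - x2 under the delta function. [sum2_rec]
    and [sum3_rec] are the same relation in the other two expansions. *)
Lemma sum1_rec c l m h : trunc_h c ->
  sum1 c (l + 1) m h = sum1 c l (m + 1) h - sum1 c l m (h + 1).
Proof.
move=> tc; rewrite /sum1.
rewrite (fsum_natS (fsupp_sum1 (fun i => (-1) ^+ i * binz K (l + 1) i)
  (fun i : nat => m + (l + 1) - i%:Z) h tc)).
rewrite (fsum_natS (fsupp_sum1 (fun i => (-1) ^+ i * binz K l i)
  (fun i : nat => m + 1 + l - i%:Z) h tc)).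
have fT : fsupp (fun i : nat =>
    ((-1) ^+ i.+1 * binz K l i.+1) *: c (m + 1 + l - i.+1%:Z) (h + i.+1%:R)).
  have [N cN] := tc h; apply: (@fsupp_nat _ _ N) => i Ni.
  by rewrite cN ?scaler0 // leqW.
have fS := fsupp_sum1 (fun i => (-1) ^+ i * binz K l i)
  (fun i : nat => m + l - i%:Z) (h + 1) tc.
have /= E := fsumB fT fS.
rewrite -[RHS]addrA -E !binz0; congr (_ *: c _ _ + _); first by lia.
apply: eq_fsum => i; rewrite binzS mulrDr scalerDl exprS mulN1r !mulNr !scaleNr.
have -> : m + (l + 1) - i.+1%:Z = m + l - i%:Z by lia.
have -> : m + 1 + l - i.+1%:Z = m + l - i%:Z by lia.
by rewrite -natr1 [i%:R + 1]addrC addrA.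
Qed.

Lemma fsupp_sum2S c (a : nat -> K) m (g : nat -> K) : trunc_p c ->
  fsupp (fun i : nat => a i *: c (m + i.+1%:Z) (g i)).
Proof.
move=> [N cN]; apply: (@fsupp_nat _ _ (absz (N - m)%R)) => i Ni.
by rewrite cN ?scaler0 //; lia.
Qed.

Lemma sum2_rec c l m h : trunc_p c ->
  sum2 c (l + 1) m h = sum2 c l (m + 1) h - sum2 c l m (h + 1).
Proof.
move=> tc; have m1 : (-1 : K) != 0 by rewrite oppr_eq0 oner_eq0.
rewrite /sum2.
rewrite (fsum_natS (fsupp_sum2 (fun i : nat => (-1) ^ (l + 1 + i%:Z) * binz K (l + 1) i)
  m (fun i : nat => h + (l + 1)%:~R - i%:R) tc)).
rewrite (fsum_natS (fsupp_sum2 (fun i : nat => (-1) ^ (l + i%:Z) * binz K l i)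
  m (fun i : nat => h + 1 + l%:~R - i%:R) tc)).
have fS := fsupp_sum2 (fun i : nat => (-1) ^ (l + i%:Z) * binz K l i)
  (m + 1) (fun i : nat => h + l%:~R - i%:R) tc.
have fT := fsupp_sum2S (fun i : nat => (-1) ^ (l + i.+1%:Z) * binz K l i.+1)
  m (fun i : nat => h + 1 + l%:~R - i.+1%:R) tc.
have /= E := fsumB fS fT.
rewrite [- (_ *: _ + _)]opprD [RHS]addrCA -E !binz0; congr (_ + _).
  rewrite !addr0 expfzDr // expr1z mulrN1 mulNr scaleNr.
  by rewrite intrD [l%:~R + 1]addrC addrA.
apply: eq_fsum => i; rewrite binzS mulrDr scalerDl addrC.
have -> : l + 1 + i.+1%:Z = l + i%:Z + 2 by lia.
have -> : l + i.+1%:Z = l + i%:Z + 1 by lia.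
have -> : m + i.+1%:Z = m + 1 + i%:Z by lia.
have -> : (-1 : K) ^ (l + i%:Z + 2) = (-1) ^ (l + i%:Z).
  by rewrite expfzDr // -[X in _ * _ ^ X]/(Posz 2) -exprnP expr2 mulrNN !mulr1.
rewrite [(-1) ^ (_ + 1)]expfzDr // expr1z mulrN1 mulNr scaleNr opprK.
by congr (_ *: c _ _ + _ *: c _ _); rewrite ?intrD -natr1; ring.
Qed.

Lemma sum3_rec c l m h : trunc_p c ->
  sum3 c l (m + 1) h = sum3 c (l + 1) m h + sum3 c l m (h + 1).
Proof.
move=> tc; rewrite /sum3.
rewrite (fsum_natS (fsupp_sum2 (binz K (m + 1)) l
  (fun i : nat => h + (m + 1)%:~R - i%:R) tc)).
rewrite (fsum_natS (fsupp_sum2 (binz K m) l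
  (fun i : nat => h + 1 + m%:~R - i%:R) tc)).
have fS := fsupp_sum2 (binz K m) (l + 1) (fun i : nat => h + m%:~R - i%:R) tc.
have fT := fsupp_sum2S (fun i => binz K m i.+1) l
  (fun i : nat => h + 1 + m%:~R - i.+1%:R) tc.
have /= E := fsumD fS fT.
rewrite [RHS]addrCA -E !binz0; congr (_ + _).
  by rewrite intrD [m%:~R + 1]addrC addrA.
apply: eq_fsum => i; rewrite binzS scalerDl addrC.
have -> : l + i.+1%:Z = l + 1 + i%:Z by lia.
by congr (_ *: c _ _ + _ *: c _ _); rewrite ?intrD -natr1; ring.
Qed.

Lemma sum1_0 c m h : sum1 c 0 m h = c m h.
Proof.
rewrite /sum1 fsum_nat1 => [|i]; last by rewrite binz_0S mulr0 scale0r.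
by rewrite binz0 mulr1 scale1r !addr0.
Qed.

Lemma sum2_0 c m h : sum2 c 0 m h = c m h.
Proof.
rewrite /sum2 fsum_nat1 => [|i]; last by rewrite binz_0S mulr0 scale0r.
by rewrite binz0 mulr1 !addr0 scale1r subr0.
Qed.

Lemma sum3_0 c l h : sum3 c l 0 h = c l h.
Proof.
rewrite /sum3 fsum_nat1 => [|i]; last by rewrite binz_0S scale0r.
by rewrite binz0 scale1r !addr0 subr0.
Qed.

(** For a natural number l the expansion is polynomial and the sum is a coefficient of (x1 - x2)^l
    c. Together with [sum2_nat] this turns the vanishing of the third sum into weak
    commutativity. *)
Lemma sum1_nat c (l : nat) m h : trunc_h c ->
  sum1 c l%:Z m h = iter l (dplus (-1)) c m h.
Proof.
move=> tc; elim: l m h => [|l IH] m h; first exact: sum1_0.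
have -> : l.+1%:Z = l%:Z + 1 by lia.
by rewrite sum1_rec // !IH /= /dplus scaleN1r.
Qed.

Lemma sum2_nat c (l : nat) m h : trunc_p c ->
  sum2 c l%:Z m h = iter l (dplus (-1)) c m h.
Proof.
move=> tc; elim: l m h => [|l IH] m h; first exact: sum2_0.
have -> : l.+1%:Z = l%:Z + 1 by lia.
by rewrite sum2_rec // !IH /= /dplus scaleN1r.
Qed.

Lemma sum3_nat c (m : nat) l h : trunc_p c ->
  sum3 c l m%:Z h = iter m (dplus 1) c l h.
Proof.
move=> tc; elim: m l h => [|m IH] l h; first exact: sum3_0.
have -> : m.+1%:Z = m%:Z + 1 by lia.
by rewrite sum3_rec // !IH /= /dplus scale1r.
Qed.

(** For such m only the first and third sums of the Jacobi identity are left, which is weak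
    associativity. *)
Lemma sum2_eq0 c : trunc_p c -> exists M : int, forall l m h, M <= m ->
  sum2 c l m h = 0.
Proof.
move=> [N cN]; exists N => l m h Nm; apply: fsum0 => i.
by rewrite cN ?scaler0 //; lia.
Qed.

Lemma sum3_eq0 c : trunc_p c -> exists L : int, forall l m h, L <= l ->
  sum3 c l m h = 0.
Proof.
move=> [N cN]; exists N => l m h Nm; apply: fsum0 => i.
by rewrite cN ?scaler0 //; lia.
Qed.

(* The defect of the Jacobi identity satisfies the recursion                  *)
(* J (l + 1) m h = J l (m + 1) h - J l m (h + 1), so that it vanishes as soon *)
(* as it does for one value of l and for one value of m.                      *)
Lemma jac_arraysP c1 c2 c3 : trunc_h c1 -> trunc_p c2 -> trunc_p c3 ->
  (exists l, forall m h, sum1 c1 l m h - sum2 c2 l m h = sum3 c3 l m h) ->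
  (exists m, forall l h, sum1 c1 l m h - sum2 c2 l m h = sum3 c3 l m h) ->
  jac_arrays c1 c2 c3.
Proof.
move=> t1 t2 t3 [L JL] [M JM].
pose J l m h := sum1 c1 l m h - sum2 c2 l m h - sum3 c3 l m h.
have Jrec l m h : J (l + 1) m h = J l (m + 1) h - J l m (h + 1).
  have E : sum3 c3 (l + 1) m h = sum3 c3 l (m + 1) h - sum3 c3 l m (h + 1).
    by rewrite (sum3_rec l m h t3) addrK.
  by rewrite /J (sum1_rec l m h t1) (sum2_rec l m h t2) E; lmod_conv K.
have JL0 (n : nat) m h : J (L + n%:Z) m h = 0.
  elim: n m h => [|n IH] m h; first by rewrite addr0 /J JL subrr.
  have -> : L + n.+1%:Z = L + n%:Z + 1 by lia.
  by rewrite Jrec !IH subrr.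
have JM0 (n : nat) l h : J l (M + n%:Z) h = 0.
  elim: n l h => [|n IH] l h; first by rewrite addr0 /J JM subrr.
  have := Jrec l (M + n%:Z) h; rewrite !IH subr0 => /esym.
  by have -> : M + n.+1%:Z = M + n%:Z + 1 by lia.
have JLE l m h : L <= l -> J l m h = 0.
  move=> Ll; rewrite -[RHS](JL0 (absz (l - L)%R) m h).
  by congr (J _ m h); lia.
have JME l m h : M <= m -> J l m h = 0.
  move=> Mm; rewrite -[RHS](JM0 (absz (m - M)%R) l h).
  by congr (J l _ h); lia.
(* Below both thresholds the recursion at h - 1 expresses J l m h through values at l + 1 and m + 1,
   so the induction is on the distance to (L, M). *)
have J0 (n : nat) : forall l m h, L - l + (M - m) <= n%:Z -> J l m h = 0.
  elim: n => [|n IH] l m h LM.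
    by have [Ll|lL] := leP L l; [exact: JLE | apply: JME; lia].
  have [Ll|lL] := leP L l; first exact: JLE.
  have [Mm|mM] := leP M m; first exact: JME.
  have e1 : J (l + 1) m (h - 1) = 0 by apply: IH; lia.
  have e2 : J l (m + 1) (h - 1) = 0 by apply: IH; lia.
  have := Jrec l m (h - 1); rewrite e1 e2 subrK sub0r => /esym/eqP.
  by rewrite oppr_eq0 => /eqP.
move=> l m h; apply/eqP; rewrite -subr_eq0; apply/eqP.
apply: (J0 (absz (L - l + (M - m))%R) l m h); lia.
Qed.

End OneArray.

Section Convolution.
Variables (P Q R : lmodType K) (f : P -> Q -> R).
Hypothesis bf : is_bilinear f.
Implicit Types (c : int -> K -> P) (d : int -> K -> Q).

(** The coefficient of x1^(-n-1) x2^(-h-1) in the product of the two series. The exponents are -p-1,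
    so indices p and q of the factors satisfy p + q = n - 1; likewise for the powers of x2. *)
Definition conv c d n h := \sum_(x \in [set: int * K])
  f (c x.1 x.2) (d (n - 1 - x.1) (h - 1 - x.2)).

Definition convolvable c d := forall n h,
  fsupp (fun x : int * K => f (c x.1 x.2) (d (n - 1 - x.1) (h - 1 - x.2))).

Lemma bilinear_neq0 p q : f p q != 0 -> (p != 0) && (q != 0).
Proof.
move=> nz; apply/andP; split; apply: contraNneq nz => ->.
  by rewrite (bil0l bf).
by rewrite (bil0r bf).
Qed.

(** [lowfin_pair] leaves finitely many h1 and h2, hence common upper bounds N1 for p and N2 for q.
    As n < B, the equation p + q = y - n then also bounds p from below. *)
Lemma kind1_pair c d (y : int) (x : K) : kind1 c -> kind1 d ->
  exists (B : nat) (E : set (int * K)), finite_set E /\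
  forall p h1 q h2 (n : nat), c p h1 != 0 -> d q h2 != 0 ->
    h1 + h2 = x + n%:R -> p + q = y - n%:Z -> (n < B)%N /\ E (p, h1).
Proof.
move=> [cl ct] [dl dt].
have [B [H1 [fH1 BP]]] := lowfin_pair x cl dl.
have [B2 [H2 [fH2 BP2]]] := lowfin_pair x dl cl.
have bound (X : lmodType K) (e : int -> K -> X) (H : set K) : finite_set H ->
    (forall h, exists N : int, forall p, N <= p -> e p h = 0) ->
    exists N : int, forall h p, H h -> N <= p -> e p h = 0.
  move=> /finite_seqP[s ->] /choice[N eN]; pose F h := absz (N h).
  pose M := (\max_(h <- s) F h)%N; exists M%:Z => h p /= hs Np; apply: eN.
  have FM : (F h <= M)%N by exact: leq_bigmax_seq.
  have FE : F h = absz (N h) by [].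
  by clearbody M F; lia.
have [N1 cN] := bound _ c H1 fH1 ct; have [N2 dN] := bound _ d H2 fH2 dt.
exists B, ([set p : int | y - B%:Z - N2 <= p < N1] `*` H1); split.
  by apply: finite_setX => //; exact: finite_int_interval.
move=> p h1 q h2 n cnz dnz hE pE.
have [nB H1h] := BP h1 h2 n (ex_intro _ p cnz) (ex_intro _ q dnz) hE.
have [_ H2h] := BP2 h2 h1 n (ex_intro _ q dnz) (ex_intro _ p cnz) (etrans (addrC _ _) hE).
split=> //; split=> //=.
have pN : p < N1 by rewrite ltNge; apply: contra_neqN cnz => /(cN _ _ H1h).
have qN : q < N2 by rewrite ltNge; apply: contra_neqN dnz => /(dN _ _ H2h).
lia.
Qed.

Lemma kind1_convolvable c d : kind1 c -> kind1 d -> convolvable c d.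
Proof.
move=> k1 k2 n h; have [B [E [fE EP]]] := kind1_pair (n - 1) (h - 1) k1 k2.
apply: (sub_finite_set _ fE) => -[p g] /= /bilinear_neq0/andP[cnz dnz].
by apply: (EP _ _ _ _ 0%N cnz dnz _ _).2; [ring | lia].
Qed.

Lemma kind2_convolvable c d : kind2 c -> kind2 d -> convolvable c d.
Proof.
move=> [[N1 cN] cl] [[N2 dN] dl] n h.
have fH p : exists H : set K, finite_set H /\ forall g,
    c p g != 0 -> d (n - 1 - p) (h - 1 - g) != 0 -> H g.
  have [B [H [fH HP]]] := lowfin_pair (h - 1) (cl p) (dl (n - 1 - p)).
  exists H; split=> // g cnz dnz.
  by apply: (HP _ _ 0%N cnz dnz _).2; ring.
have [H HP] := choice fH.
pose E := \bigcup_(p in [set p : int | n - 1 - N2 < p < N1]) [set (p, g) | g in H p].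
have fE : finite_set E.
  apply: bigcup_finite => [|p _]; last exact/finite_image/(HP p).1.
  apply: sub_finite_set (finite_int_interval (n - 1 - N2) N1) => p /=; lia.
apply: (sub_finite_set _ fE) => -[p g] /= /bilinear_neq0/andP[cnz dnz].
exists p => /=; last by exists g => //; exact: (HP p).2.
have pN : p < N1 by rewrite ltNge; apply: contra_neqN cnz => /cN.
have qN : n - 1 - p < N2 by rewrite ltNge; apply: contra_neqN dnz => /dN.
lia.
Qed.

Lemma conv_dplus_l s c d : convolvable c d ->
  convolvable (dplus s c) d /\ conv (dplus s c) d = dplus s (conv c d).
Proof.
move=> cd.
pose e1 (x : int * K) : int * K := (x.1 + 1, x.2).
pose e2 (x : int * K) : int * K := (x.1, x.2 + 1).
have b1 : bijective e1.
  by exists (fun x : int * K => (x.1 - 1, x.2) : int * K) => -[p h]; rewrite /e1 /= ?addrK ?subrK.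
have b2 : bijective e2.
  by exists (fun x : int * K => (x.1, x.2 - 1) : int * K) => -[p h]; rewrite /e2 /= ?addrK ?subrK.
have termE (n : int) h (x : int * K) : f (dplus s c x.1 x.2) (d (n - 1 - x.1) (h - 1 - x.2))
    = f (c (e1 x).1 (e1 x).2) (d (n + 1 - 1 - (e1 x).1) (h - 1 - (e1 x).2))
      + s *: f (c (e2 x).1 (e2 x).2) (d (n - 1 - (e2 x).1) (h + 1 - 1 - (e2 x).2)).
  rewrite /dplus /= (bilDl bf) (bilZl bf).
  by congr (f _ (d _ _) + _ *: f _ (d _ _)); ring.
have fs1 (n : int) h := fsupp_bij b1 (cd (n + 1) h).
have fs2 (n : int) h := fsupp_lin (linear_scale s) (fsupp_bij b2 (cd n (h + 1))).
split=> [n h|].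
  by apply: (fsupp_le (fsuppD (fs1 n h) (fs2 n h))) => x /= <-; rewrite termE.
apply/funext => n; apply/funext => h; rewrite /conv (eq_fsum (termE n h)).
rewrite (fsumD (fs1 n h) (fs2 n h)) -(fsumZ _ (fsupp_bij b2 (cd n (h + 1)))).
congr (_ + _ *: _).
  by rewrite [RHS](@reindex_fsbigT _ _ _ _ _ e1 _ b1).
by rewrite [RHS](@reindex_fsbigT _ _ _ _ _ e2 _ b2).
Qed.

Lemma conv_dplus_r s c d : convolvable c d ->
  convolvable c (dplus s d) /\ conv c (dplus s d) = dplus s (conv c d).
Proof.
move=> cd.
have termE (n : int) h (x : int * K) :
    f (c x.1 x.2) (dplus s d (n - 1 - x.1) (h - 1 - x.2))
    = f (c x.1 x.2) (d (n + 1 - 1 - x.1) (h - 1 - x.2))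
      + s *: f (c x.1 x.2) (d (n - 1 - x.1) (h + 1 - 1 - x.2)).
  rewrite /dplus (bilDr bf) (bilZr bf).
  by congr (f _ (d _ _) + _ *: f _ (d _ _)); ring.
have fs1 (n : int) h := cd (n + 1) h.
have fs2 (n : int) h := fsupp_lin (linear_scale s) (cd n (h + 1)).
split=> [n h|].
  by apply: (fsupp_le (fsuppD (fs1 n h) (fs2 n h))) => x /= <-; rewrite termE.
apply/funext => n; apply/funext => h; rewrite /conv (eq_fsum (termE n h)).
by rewrite (fsumD (fs1 n h) (fs2 n h)) -(fsumZ _ (cd n (h + 1))).
Qed.

(** A power of x1 + s x2 multiplying a product may be shared between the two factors. This is why
    the orders of weak commutativity and associativity add up. *)
Lemma conv_iter s m n c d : convolvable c d ->
  convolvable (iter m (dplus s) c) (iter n (dplus s) d) /\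
  conv (iter m (dplus s) c) (iter n (dplus s) d)
  = iter (m + n) (dplus s) (conv c d).
Proof.
move=> cd; elim: m => [|m [IHf IH]] /=.
  elim: n => [|n [IHf IH]] //=; have [g E] := conv_dplus_r s IHf.
  by split=> //; rewrite E IH.
by have [g E] := conv_dplus_l s IHf; split=> //; rewrite E IH.
Qed.

Lemma fsum_antidiag (F : nat -> nat -> R) : fsupp2 F ->
  \sum_(i \in [set: nat]) \sum_(j \in [set: nat]) F i j
  = \sum_(N \in [set: nat]) \sum_(i < N.+1) F i (N - i)%N.
Proof.
move=> fF.
pose G (N i : nat) := if (i <= N)%N then F i (N - i)%N else 0.
have [B BP] : exists B, forall i j, F i j != 0 -> (i < B)%N /\ (j < B)%N.
  have /fsupp2P[A [A' AP]] := fF.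
  have M (D : {fset nat}) i : i \in D -> (i < (\max_(k <- D) k).+1)%N.
    by move=> iD; rewrite ltnS; exact: (leq_bigmax_seq (F := id)).
  exists (maxn (\max_(k <- A) k).+1 (\max_(k <- A') k).+1) => i j /AP[iA jA'].
  by rewrite !leq_max (M _ _ iA) (M _ _ jA') orbT.
have fG : fsupp2 G.
  have fB : finite_set (`I_(B + B) `*` `I_B) by apply: finite_setX; exact: finite_II.
  apply: (sub_finite_set _ fB) => -[N i] /=; rewrite /G.
  have [iN|_] := leqP i N => nz; last by rewrite eqxx in nz.
  by have [iB jB] := BP _ _ nz; split=> /=; lia.
have F0 i j : (B <= i)%N || (B <= j)%N -> F i j = 0.
  by move=> Bij; apply/eqP/negPn/negP => /BP[]; lia.
transitivity (\sum_(i \in [set: nat]) \sum_(N \in [set: nat]) G N i).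
  apply: eq_fsum => i; apply/esym.
  rewrite (@fsum_ord _ _ (i + B)%N); last first.
    by move=> N Ni; rewrite /G; case: leqP => // iN; apply: F0; lia.
  rewrite big_split_ord /= big1 ?add0r; last first.
    by move=> [k ki] _; rewrite /G /= leqNgt ki.
  rewrite (@fsum_ord _ _ B); last by move=> j Bj; apply: F0; lia.
  by apply: eq_bigr => j _; rewrite /G /= leq_addr addKn.
rewrite -(fsum_exchange fG); apply: eq_fsum => N.
rewrite (@fsum_ord _ _ N.+1); last by move=> i Ni; rewrite /G leqNgt Ni.
by apply: eq_bigr => -[i iN] _; rewrite /G /= -ltnS iN.
Qed.

End Convolution.
End Arrays.

Section ConvolutionJacobi.
Variables (K : numFieldType) (P Q R : lmodType K) (f : P -> Q -> R).
Hypothesis bf : is_bilinear f.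
Implicit Types (c : int -> K -> P) (d : int -> K -> Q).

Lemma prod_sum1 (c : int -> K -> P) (d : int -> K -> Q) (m m' l l' : int) (h h' : K) :
  trunc_h c -> trunc_h d ->
  f (sum1 c l m h) (sum1 d l' m' h')
  = \sum_(y \in [set: nat * nat])
      (((-1) ^+ y.1 * binz K l y.1) * ((-1) ^+ y.2 * binz K l' y.2)) *:
      f (c (m + l - y.1%:Z) (h + y.1%:R)) (d (m' + l' - y.2%:Z) (h' + y.2%:R)).
Proof.
move=> tc td.
have fc := fsupp_sum1 (fun i => (-1) ^+ i * binz K l i)
  (fun i : nat => m + l - i%:Z) h tc.
have fd := fsupp_sum1 (fun i => (-1) ^+ i * binz K l' i)
  (fun i : nat => m' + l' - i%:Z) h' td.
rewrite /sum1 (fsum_bil bf fc fd) -(fsum_pair (fsupp2_bil bf fc fd)).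
by apply: eq_fsum => y; rewrite (bilZl bf) (bilZr bf) scalerA.
Qed.

(* Both sides are the expansion of c(x0 + x2, x2) d(x0 + x2, x2); the         *)
(* coefficients agree by the Vandermonde identity binz_conv.                  *)
Lemma sum1_conv c d a b l h : kind1 c -> kind1 d ->
  conv f (fun p h => sum1 c p a h) (fun p h => sum1 d p b h) l h
  = sum1 (conv f c d) l (a + b) h.
Proof.
move=> kc kd; have tc := kind1_trunc kc; have td := kind1_trunc kd.
pose s (i : nat) : K := (-1) ^+ i.
pose g (p : int) (k : K) (N : nat) :=
  f (c (a + p) k) (d (b + l - 1 - p - N%:Z) (h - 1 - k + N%:R)).
pose T (x : int * K) (y : nat * nat) :=
  ((s y.1 * binz K x.1 y.1) * (s y.2 * binz K (l - 1 - x.1) y.2)) *: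
  f (c (a + x.1 - y.1%:Z) (x.2 + y.1%:R))
    (d (b + (l - 1 - x.1) - y.2%:Z) (h - 1 - x.2 + y.2%:R)).
(* [T'] is [T] after replacing (p, k) by (p + i, k - i), which makes the vector [g] depend on i and
   j only through i + j. *)
pose T' (x : int * K) (y : nat * nat) :=
  ((s y.1 * binz K (x.1 + y.1%:Z) y.1)
    * (s y.2 * binz K (l - 1 - x.1 - y.1%:Z) y.2)) *: g x.1 x.2 (y.1 + y.2)%N.
have [B [E [fE EP]]] := kind1_pair (a + b + l - 1) (h - 1) kc kd.
have g_bound p k N : g p k N != 0 -> (N < B)%N /\ E (a + p, k).
  move=> /(bilinear_neq0 bf)/andP[cnz dnz]; apply: EP cnz dnz _ _; last by lia.
  by ring.
have fT' : fsupp2 T'.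
  pose e (z : (int * K) * (nat * nat)) : (int * K) * (nat * nat) :=
    ((z.1.1 - a, z.1.2), z.2).
  have fEB : finite_set (e @` (E `*` (`I_B `*` `I_B))).
    apply: finite_image; apply: finite_setX => //; apply: finite_setX; exact: finite_II.
  apply: (sub_finite_set _ fEB) => -[[p k] [i j]] /= nz.
  have /g_bound[ijB Epk] : g p k (i + j)%N != 0.
    by apply: contraNneq nz; rewrite /T' /= => ->; rewrite scaler0.
  exists ((a + p, k), (i, j)); last by rewrite /e /= addrAC subrr add0r.
  by split=> //; split=> /=; lia.
have reidx y : bijective (fun x : int * K => (x.1 + y%:Z, x.2 - y%:R) : int * K).
  by exists (fun x : int * K => (x.1 - y%:Z, x.2 + y%:R) : int * K) => -[p k];
    rewrite /= ?addrK ?subrK.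
have TT' x y : T (x.1 + y.1%:Z, x.2 - y.1%:R) y = T' x y.
  rewrite /T /T' /g /=; congr (_ * (_ * binz K _ _) *: f (c _ _) (d _ _)).
  - by lia.
  - by lia.
  - by rewrite subrK.
  - by lia.
  - by rewrite natrD; ring.
have fT : fsupp2 T.
  rewrite /fsupp2.
  pose e (z : (int * K) * (nat * nat)) : (int * K) * (nat * nat) :=
    ((z.1.1 - z.2.1%:Z, z.1.2 + z.2.1%:R), z.2).
  have be : bijective e.
    exists (fun z : (int * K) * (nat * nat) =>
      ((z.1.1 + z.2.1%:Z, z.1.2 - z.2.1%:R), z.2) : (int * K) * (nat * nat)).
      by move=> [[p k] [i j]]; rewrite /e /= ?addrK ?subrK.
    by move=> [[p k] [i j]]; rewrite /e /= ?addrK ?subrK.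
  have := fsupp_bij be fT'; congr (fsupp _); apply/funext => -[[p k] y] /=.
  by rewrite -TT' /= addrK subrK.
have -> : conv f (fun p h => sum1 c p a h) (fun p h => sum1 d p b h) l h
    = \sum_(x \in [set: int * K]) \sum_(y \in [set: nat * nat]) T x y.
  by apply: eq_fsum => x; rewrite prod_sum1.
rewrite (fsum_exchange fT).
have -> : \sum_(y \in [set: nat * nat]) \sum_(x \in [set: int * K]) T x y
    = \sum_(y \in [set: nat * nat]) \sum_(x \in [set: int * K]) T' x y.
  apply: eq_fsum => y.
  rewrite (@reindex_fsbigT _ _ _ _ _ _ _ (reidx y.1)).
  by apply: eq_fsum => x; exact: TT'.
rewrite -(fsum_exchange fT').
pose G (x : int * K) N := (s N * binz K l N) *: g x.1 x.2 N.
have fG : fsupp2 G.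
  pose e (z : (int * K) * nat) : (int * K) * nat := ((z.1.1 - a, z.1.2), z.2).
  have fEB : finite_set (e @` (E `*` `I_B)).
    by apply: finite_image; apply: finite_setX => //; exact: finite_II.
  apply: (sub_finite_set _ fEB) => -[[p k] N] /= nz.
  have /g_bound[NB Epk] : g p k N != 0.
    by apply: contraNneq nz; rewrite /G /= => ->; rewrite scaler0.
  by exists ((a + p, k), N) => //; rewrite /e /= addrAC subrr add0r.
transitivity (\sum_(x \in [set: int * K]) \sum_(N \in [set: nat]) G x N).
  apply: eq_fsum => x.
  have fx : fsupp2 (fun i j => T' x (i, j)).
    by have := fsupp2_slice x fT'; congr (fsupp _); apply/funext => -[].
  rewrite (_ : \sum_(y \in [set: nat * nat]) T' x y
    = \sum_(i \in [set: nat]) \sum_(j \in [set: nat]) T' x (i, j)); last first.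
    by rewrite -(fsum_pair fx); apply: eq_fsum => -[].
  rewrite (fsum_antidiag fx); apply: eq_fsum => N.
  (* The upper indices are brought to the form of [binz_conv] with s = x.1 and t = l - 1 - x.1 -
     N. *)
  rewrite /G; have -> : l = x.1 + (l - 1 - x.1 - N%:Z) + N%:Z + 1 by lia.
  rewrite -binz_conv mulr_sumr scaler_suml; apply: eq_bigr => -[i iN] _.
  rewrite /T' /= subnKC //; congr (_ *: _).
  rewrite mulrACA -exprD subnKC //; congr (_ * (_ * binz K _ _)).
  by lia.
rewrite (fsum_exchange fG); apply: eq_fsum => N.
rewrite /G -fsumZ; last first.
  pose e (z : int * K) : int * K := (z.1 - a, z.2).
  apply: (sub_finite_set _ (finite_image e fE)) => -[p k] /= /g_bound[_ Epk].
  by exists (a + p, k) => //; rewrite /e /= addrAC subrr add0r.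
congr (_ *: _); rewrite /conv.
pose e (x : int * K) : int * K := (a + x.1, x.2).
have be : bijective e.
  exists (fun x : int * K => (x.1 - a, x.2) : int * K) => -[p k]; rewrite /e /=.
    by rewrite addrAC subrr add0r.
  by rewrite addrCA subrr addr0.
rewrite [RHS](@reindex_fsbigT _ _ _ _ _ e _ be); apply: eq_fsum => -[p k] /=.
by rewrite /g; congr (f _ (d _ _)); [lia | ring].
Qed.

Lemma trunc_h_conv c d : kind1 c -> kind1 d -> trunc_h (conv f c d).
Proof.
move=> [cl _] [dl _] h; have [B [H [_ BP]]] := lowfin_pair (h - 1) cl dl.
exists B => i p Bi; apply: fsum0 => -[q k] /=; apply/eqP.
apply: contraTT Bi => /(bilinear_neq0 bf)/andP[cnz dnz]; rewrite -ltnNge.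
apply: (BP k (h + i%:R - 1 - k) i _ _ _).1; last by ring.
  by exists q.
by exists (p - 1 - q).
Qed.

Lemma trunc_p_conv c d : trunc_p c -> trunc_p d -> trunc_p (conv f c d).
Proof.
move=> [N1 cN] [N2 dN]; exists (N1 + N2) => p h Np; apply: fsum0 => -[q k] /=.
have [Nq|qN] := leP N1 q; first by rewrite cN // (bil0l bf).
by rewrite dN ?(bil0r bf) //; lia.
Qed.

(* Weak commutativity and weak associativity are each stable under            *)
(* convolution, and together they amount to the Jacobi identity.              *)
Lemma jac_conv (c1 c2 c3 : int -> K -> P) (d1 d2 d3 : int -> K -> Q) :
  kind1 c1 -> kind2 c2 -> kind2 c3 -> kind1 d1 -> kind2 d2 -> kind2 d3 ->
  jac_arrays c1 c2 c3 -> jac_arrays d1 d2 d3 ->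
  jac_arrays (conv f c1 d1) (conv f c2 d2) (conv f c3 d3).
Proof.
move=> kc1 kc2 kc3 kd1 kd2 kd3 jc jd.
have tc1 := kind1_trunc kc1; have td1 := kind1_trunc kd1.
have [tc2 tc3 td2 td3] := And4 kc2.1 kc3.1 kd2.1 kd3.1.
have t1 := trunc_h_conv kc1 kd1; have t2 := trunc_p_conv tc2 td2.
have t3 := trunc_p_conv tc3 td3.
have v1 := kind1_convolvable bf kc1 kd1; have v2 := kind2_convolvable bf kc2 kd2.
have v3 := kind2_convolvable bf kc3 kd3.
apply: jac_arraysP => //.
  (* Weak commutativity: for l large the third sum vanishes, so (x1 - x2)^l makes the first two
     arrays equal. *)
  have comm (X : lmodType K) (e1 e2 e3 : int -> K -> X) :
      trunc_h e1 -> trunc_p e2 -> trunc_p e3 -> jac_arrays e1 e2 e3 ->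
      exists L : nat, forall n, (L <= n)%N ->
        iter n (dplus (-1)) e1 = iter n (dplus (-1)) e2.
    move=> u1 u2 u3 je; have [L LP] := sum3_eq0 u3.
    exists (absz L) => n Ln; apply/funext => m; apply/funext => h.
    rewrite -sum1_nat // -sum2_nat //; apply/eqP; rewrite -subr_eq0 je LP //.
    by lia.
  have [Lc cP] := comm _ _ _ _ tc1 tc2 tc3 jc.
  have [Ld dP] := comm _ _ _ _ td1 td2 td3 jd.
  have [L LP] := sum3_eq0 t3.
  (* [Lc] factors x1 - x2 go to c and the others to d; the extra [absz L] kills the third sum of the
     product. *)
  exists (Lc + (Ld + absz L))%N%:Z => m h.
  rewrite sum1_nat // sum2_nat // LP; last by lia.
  have [_ <-] := conv_iter bf (-1) Lc (Ld + absz L) v1.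
  have [_ <-] := conv_iter bf (-1) Lc (Ld + absz L) v2.
  by rewrite cP // dP ?leq_addr // subrr.
(* Weak associativity: for m large the second sum vanishes, and the first becomes (x0 + x2)^m times
   the third array. *)
have assoc (X : lmodType K) (e1 e2 e3 : int -> K -> X) :
    trunc_p e2 -> trunc_p e3 -> jac_arrays e1 e2 e3 ->
    exists M : nat, forall n, (M <= n)%N ->
      (fun l h => sum1 e1 l n%:Z h) = iter n (dplus 1) e3.
  move=> u2 u3 je; have [M MP] := sum2_eq0 u2.
  exists (absz M) => n Mn; apply/funext => l; apply/funext => h.
  by rewrite -sum3_nat // -je MP ?subr0 //; lia.
have [Mc cP] := assoc _ _ _ _ tc2 tc3 jc.
have [Md dP] := assoc _ _ _ _ td2 td3 jd.
have [M MP] := sum2_eq0 t2.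
exists (Mc + (Md + absz M))%N%:Z => l h.
rewrite sum3_nat // MP ?subr0; last by lia.
have [_ <-] := conv_iter bf 1 Mc (Md + absz M) v3.
by rewrite -cP // -dP ?leq_addr // sum1_conv.
Qed.

End ConvolutionJacobi.

(** The three sums are additive in v, x and y. Additive generation is enough for the uses below,
    pure tensors and homogeneous vectors, since both are stable under scalars. *)
Lemma jacobi_additive (K : numFieldType) (T : voa_data K) (X1 X2 X3 : module_data T)
    (I : X1 -> K -> X2 -> X3) (Gv : set T) (G1 : set X1) (G2 : set X2) :
  is_weak_module X1 -> is_weak_module X2 -> is_weak_module X3 ->
  (forall h, is_bilinear (fun x y => I x h y)) -> truncated_coefs I ->
  (forall S : T -> Prop, (forall s t, S s -> S t -> S (s + t)) ->
     (forall v, Gv v -> S v) -> forall v, S v) ->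
  (forall S : X1 -> Prop, (forall s t, S s -> S t -> S (s + t)) ->
     (forall v, G1 v -> S v) -> forall v, S v) ->
  (forall S : X2 -> Prop, (forall s t, S s -> S t -> S (s + t)) ->
     (forall v, G2 v -> S v) -> forall v, S v) ->
  (forall v x y, Gv v -> G1 x -> G2 y -> forall l m h,
    \sum_(i \in [set: nat])
       ((-1) ^+ i * binz K l i) *: act v (m + l - i%:Z) (I x (h + i%:R) y)
    - \sum_(i \in [set: nat])
       ((-1) ^ (l + i%:Z) * binz K l i)
         *: I x (h + l%:~R - i%:R) (act v (m + i%:Z) y)
    = \sum_(i \in [set: nat])
       binz K m i *: I (act v (l + i%:Z) x) (h + m%:~R - i%:R) y) ->
  jacobi (@act K T X1) (@act K T X2) (@act K T X3) I.
Proof.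
move=> x1 x2 x3 bI tI indv ind1 ind2 gen v x y l m h; move: l m h.
have [[b1 b2] b3] := (act_bilinear x1, act_bilinear x2, act_bilinear x3).
have f1 u z t l m h : fsupp (fun i : nat => ((-1) ^+ i * binz K l i) *:
    act u (m + l - i%:Z) (I z (h + i%:R) t)) by exact: fsupp_jacobi1.
have f2 u z t l m h : fsupp (fun i : nat => ((-1) ^ (l + i%:Z) * binz K l i)
    *: I z (h + l%:~R - i%:R) (act u (m + i%:Z) t)).
  exact: (fsupp_jacobi2 bI (act_truncated x2)).
have f3 u z t l m h : fsupp (fun i : nat => binz K m i *:
    I (act u (l + i%:Z) z) (h + m%:~R - i%:R) t).
  exact: (fsupp_jacobi3 bI (act_truncated x1)).
have comb (F1 F2 F3 G1' G2' G3' H1 H2 H3 : nat -> X3) :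
  fsupp F1 -> fsupp F2 -> fsupp F3 -> fsupp G1' -> fsupp G2' -> fsupp G3' ->
  (forall i, H1 i = F1 i + G1' i) -> (forall i, H2 i = F2 i + G2' i) ->
  (forall i, H3 i = F3 i + G3' i) ->
  \sum_(i \in [set: nat]) F1 i - \sum_(i \in [set: nat]) F2 i
    = \sum_(i \in [set: nat]) F3 i ->
  \sum_(i \in [set: nat]) G1' i - \sum_(i \in [set: nat]) G2' i
    = \sum_(i \in [set: nat]) G3' i ->
  \sum_(i \in [set: nat]) H1 i - \sum_(i \in [set: nat]) H2 i
    = \sum_(i \in [set: nat]) H3 i.
  move=> fF1 fF2 fF3 fG1 fG2 fG3 /eq_fsum -> /eq_fsum -> /eq_fsum -> EF EG.
  rewrite (fsumD fF1 fG1) (fsumD fF2 fG2) (fsumD fF3 fG3).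
  by rewrite opprD addrACA; congr (_ + _).
elim/indv: v => [s t sJ tJ l m h|v Gvv].
  apply: (comb _ _ _ _ _ _ _ _ _ (f1 s x y l m h) (f2 s x y l m h) (f3 s x y l m h)
    (f1 t x y l m h) (f2 t x y l m h) (f3 t x y l m h) _ _ _ (sJ l m h) (tJ l m h)).
  - by move=> i; rewrite (bilDl (b3 _)) scalerDr.
  - by move=> i; rewrite (bilDl (b2 _)) (bilDr (bI _)) scalerDr.
  by move=> i; rewrite (bilDl (b1 _)) (bilDl (bI _)) scalerDr.
elim/ind1: x => [s t sJ tJ l m h|x G1x].
  apply: (comb _ _ _ _ _ _ _ _ _ (f1 v s y l m h) (f2 v s y l m h) (f3 v s y l m h)
    (f1 v t y l m h) (f2 v t y l m h) (f3 v t y l m h) _ _ _ (sJ l m h) (tJ l m h)).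
  - by move=> i; rewrite (bilDl (bI _)) (bilDr (b3 _)) scalerDr.
  - by move=> i; rewrite (bilDl (bI _)) scalerDr.
  by move=> i; rewrite (bilDr (b1 _)) (bilDl (bI _)) scalerDr.
elim/ind2: y => [s t sJ tJ l m h|y G2y].
  apply: (comb _ _ _ _ _ _ _ _ _ (f1 v x s l m h) (f2 v x s l m h) (f3 v x s l m h)
    (f1 v x t l m h) (f2 v x t l m h) (f3 v x t l m h) _ _ _ (sJ l m h) (tJ l m h)).
  - by move=> i; rewrite (bilDr (bI _)) (bilDr (b3 _)) scalerDr.
  - by move=> i; rewrite (bilDr (b2 _)) (bilDr (bI _)) scalerDr.
  by move=> i; rewrite (bilDr (bI _)) scalerDr.
exact: gen.
Qed.

Lemma jacobi_sum (K : numFieldType) (T : voa_data K) (X1 X2 X3 : module_data T) n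
    (F : 'I_n -> X1 -> K -> X2 -> X3) :
  is_weak_module X1 -> is_weak_module X2 -> is_weak_module X3 ->
  (forall i h, is_bilinear (fun x y => F i x h y)) ->
  (forall i, truncated_coefs (F i)) ->
  (forall i, jacobi (@act K T X1) (@act K T X2) (@act K T X3) (F i)) ->
  jacobi (@act K T X1) (@act K T X2) (@act K T X3)
    (fun x h y => \sum_(i < n) F i x h y).
Proof.
move=> x1 x2 x3 bF tF jF v x y l m h.
have b3 := act_bilinear x3.
under eq_fsum => i do rewrite (lin_sum _ _ ((b3 _).2 v)) scaler_sumr.
under [X in _ - X]eq_fsum => i do rewrite scaler_sumr.
under [X in _ = X]eq_fsum => i do rewrite scaler_sumr.
rewrite !fsum_sum.
- by rewrite -sumrB; apply: eq_bigr => i _; exact: jF.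
- by move=> i; exact: (fsupp_jacobi3 (bF i) (act_truncated x1)).
- by move=> i; exact: (fsupp_jacobi2 (bF i) (act_truncated x2)).
by move=> i; exact: (fsupp_jacobi1 b3 (tF i)).
Qed.

(** The Leibniz rule for the derivative in log x of a product of two polynomials in log x. *)
Lemma leibniz_sum (K : fieldType) (P : lmodType K) (t : nat -> nat -> P) k :
  \sum_(i < k.+1) (i.+1%:R *: t i.+1 (k - i)%N + (k - i).+1%:R *: t i (k - i).+1)
  = k.+1%:R *: \sum_(i < k.+2) t i (k.+1 - i)%N.
Proof.
transitivity (\sum_(i < k.+2) i%:R *: t i (k.+1 - i)%N
    + \sum_(i < k.+2) (k.+1 - i)%:R *: t i (k.+1 - i)%N); last first.
  rewrite -big_split scaler_sumr; apply: eq_bigr => -[i ik] _ /=.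
  by rewrite -scalerDl -natrD subnKC.
rewrite big_split /= [X in _ = X + _]big_ord_recl [X in _ = _ + X]big_ord_recr /=.
rewrite scale0r add0r subnn scale0r addr0; congr (_ + _).
by apply: eq_bigr => -[i ik] _ /=; rewrite subSn.
Qed.

Lemma Lmode_tpure (K : numFieldType) (U V : voa_data K) n (M : module_data U)
    (W : module_data V) x1 x2 :
  is_weak_module M -> is_weak_module W ->
  is_weak_module (tensor_module M W) ->
  Lmode (W := tensor_module M W) n (tpure x1 x2)
  = tpure (Lmode (W := M) n x1) x2 + tpure x1 (Lmode (W := W) n x2).
Proof.
move=> wM wW wT; rewrite (Lmode_tensor wT); congr (_ + _).
  exact: (tensor_act_left wM wW).
exact: (tensor_act_right wM wW).
Qed.

Section TensorFamilies.
Variables (K : numFieldType) (U V : voa_data K).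
Variables (M1 M2 M3 : module_data U) (W1 W2 W3 : module_data V).
Hypotheses (m1 : is_weak_module M1) (m2 : is_weak_module M2)
  (m3 : is_weak_module M3).
Hypotheses (w1 : is_weak_module W1) (w2 : is_weak_module W2)
  (w3 : is_weak_module W3).

(** The contribution of one power of log x from each factor. A coefficient of [tensor_iop] is a
    finite sum of these, and each satisfies the Jacobi identity on its own. *)
Definition tensor_family (A : M1 -> K -> M2 -> M3) (B : W1 -> K -> W2 -> W3)
    (x : tensor M1 W1) (h : K) (y : tensor M2 W2) : tensor M3 W3 :=
  tlift (fun x1 x2 => tlift (fun y1 y2 =>
    \sum_(g \in [set: K]) tpure (A x1 g y1) (B x2 (h - 1 - g) y2)) y) x.

Section Families.
Variables (A : M1 -> K -> M2 -> M3) (B : W1 -> K -> W2 -> W3).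
Hypotheses (bA : forall h, is_bilinear (fun x y => A x h y))
  (bB : forall h, is_bilinear (fun x y => B x h y)).
Hypotheses (lA : forall x y, lowfin (fun h => A x h y != 0))
  (lB : forall x y, lowfin (fun h => B x h y != 0)).

Let bt := tpure_bilinear M3 W3.

Lemma tensor_family_fsupp x1 y1 x2 y2 h :
  fsupp (fun g => tpure (A x1 g y1) (B x2 (h - 1 - g) y2)).
Proof.
have [N [H [fH HP]]] := lowfin_pair (h - 1) (lA x1 y1) (lB x2 y2).
apply: (sub_finite_set _ fH) => g /= /(bilinear_neq0 bt)/andP[Anz Bnz].
by apply: (HP _ _ 0%N Anz Bnz _).2; ring.
Qed.

Lemma tensor_family_bilinear1 x1 x2 h : is_bilinear (fun (y1 : M2) (y2 : W2) =>
  \sum_(g \in [set: K]) tpure (A x1 g y1) (B x2 (h - 1 - g) y2)).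
Proof.
split=> [y2|y1].
  apply: linear_fsum => [g|y1]; last exact: tensor_family_fsupp.
  by apply: (linear_compf (bt.1 _)); exact: (bA g).2.
apply: linear_fsum => [g|y2]; last exact: tensor_family_fsupp.
by apply: (linear_compf (bt.2 _)); exact: (bB _).2.
Qed.

Lemma tensor_family_bilinear2 h y : is_bilinear (fun (x1 : M1) (x2 : W1) =>
  tlift (fun (y1 : M2) (y2 : W2) =>
    \sum_(g \in [set: K]) tpure (A x1 g y1) (B x2 (h - 1 - g) y2)) y).
Proof.
have tl x1 x2 := tlift_linear (tensor_family_bilinear1 x1 x2 h).
elim/tensor_ind: y => [s t sb tb|y1 y2].
  split=> [v a u u'|u a v v'] /=.
    rewrite (linD (tl (a *: u + u') v)) (linD (tl u v)) (linD (tl u' v)).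
    by rewrite sb.1 tb.1 scalerDr addrACA.
  rewrite (linD (tl u (a *: v + v'))) (linD (tl u v)) (linD (tl u v')).
  by rewrite sb.2 tb.2 scalerDr addrACA.
split=> [v|u] a x y; rewrite !tliftE; try exact: tensor_family_bilinear1.
  apply: (linear_fsum (F := fun g u => tpure (A u g y1) (B v (h - 1 - g) y2))).
    by move=> g; apply: (linear_compf (bt.1 _)); exact: (bA g).1.
  by move=> z; exact: tensor_family_fsupp.
apply: (linear_fsum (F := fun g v => tpure (A u g y1) (B v (h - 1 - g) y2))).
  by move=> g; apply: (linear_compf (bt.2 _)); exact: (bB _).1.
by move=> z; exact: tensor_family_fsupp.
Qed.

Lemma tensor_familyE x1 x2 h y1 y2 :
  tensor_family A B (tpure x1 x2) h (tpure y1 y2)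
  = \sum_(g \in [set: K]) tpure (A x1 g y1) (B x2 (h - 1 - g) y2).
Proof.
rewrite /tensor_family tliftE ?tliftE //; first exact: tensor_family_bilinear1.
exact: tensor_family_bilinear2.
Qed.

Lemma tensor_family_bilinear h :
  is_bilinear (fun x y => tensor_family A B x h y).
Proof.
split=> [y|x]; first exact: (tlift_linear (tensor_family_bilinear2 h y)).
elim/tensor_ind: x => [s t sl tl|x1 x2] a y y'.
  rewrite /tensor_family !(linD (tlift_linear (tensor_family_bilinear2 h _))).
  by rewrite [X in X + _ = _]sl [X in _ + X = _]tl scalerDr addrACA.
rewrite /tensor_family !tliftE; try exact: tensor_family_bilinear2.
exact: (tlift_linear (tensor_family_bilinear1 x1 x2 h)).
Qed.

Lemma tensor_family_truncated : truncated_coefs (tensor_family A B).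
Proof.
move=> x y h; have bF := tensor_family_bilinear.
elim/tensor_ind: x => [s t [N1 sN] [N2 tN]|x1 x2].
  exists (maxn N1 N2) => n; rewrite geq_max => /andP[n1 n2].
  by rewrite (bilDl (bF _)) sN // tN // addr0.
elim/tensor_ind: y => [s t [N1 sN] [N2 tN]|y1 y2].
  exists (maxn N1 N2) => n; rewrite geq_max => /andP[n1 n2].
  by rewrite (bilDr (bF _)) sN // tN // addr0.
have [N [H [fH HP]]] := lowfin_pair (h - 1) (lA x1 y1) (lB x2 y2).
exists N => n Nn; rewrite tensor_familyE; apply: fsum0 => g; apply/eqP.
apply: contraTT Nn => /(bilinear_neq0 bt)/andP[Anz Bnz]; rewrite -ltnNge.
by apply: (HP _ _ n Anz Bnz _).1; ring.
Qed.

Hypotheses (jA : jacobi (@act K U M1) (@act K U M2) (@act K U M3) A)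
  (jB : jacobi (@act K V W1) (@act K V W2) (@act K V W3) B).
Hypotheses (t1 : is_weak_module (tensor_module M1 W1))
  (t2 : is_weak_module (tensor_module M2 W2))
  (t3 : is_weak_module (tensor_module M3 W3)).

(** On pure tensors each of the three compositions is the [conv] of an array for U and one for V
    ([E1], [E2], [E3]), so [jac_conv] applies. *)
Lemma tensor_family_jacobi :
  jacobi (@act K (tensor_voa U V) (tensor_module M1 W1))
    (@act K (tensor_voa U V) (tensor_module M2 W2))
    (@act K (tensor_voa U V) (tensor_module M3 W3)) (tensor_family A B).
Proof.
pose pure (X Y : lmodType K) : set (tensor X Y) :=
  [set t | exists x y, t = tpure x y].
have indp (X Y : lmodType K) (S : tensor X Y -> Prop) :
    (forall s t, S s -> S t -> S (s + t)) -> (forall t, pure X Y t -> S t) ->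
    forall t, S t.
  by move=> SD Sp; apply: tensor_ind => // x y; apply: Sp; exists x, y.
apply: (jacobi_additive t1 t2 t3 tensor_family_bilinear tensor_family_truncated
  (@indp U V) (@indp M1 W1) (@indp M2 W2)).
move=> _ _ _ [u [v ->]] [x1 [x2 ->]] [y1 [y2 ->]] l m h.
pose c1 p h := act u p (A x1 h y1); pose c2 p h := A x1 h (act u p y1).
pose c3 p h := A (act u p x1) h y1.
pose d1 p h := act v p (B x2 h y2); pose d2 p h := B x2 h (act v p y2).
pose d3 p h := B (act v p x2) h y2.
have kc1 : kind1 c1.
  split=> [|g]; last exact: act_truncated.
  apply: lowfin_sub (lA x1 y1) _ => g [p]; apply: contraNneq.
  by rewrite /c1 => ->; rewrite (bil0r (act_bilinear m3 _)).
have kd1 : kind1 d1.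
  split=> [|g]; last exact: act_truncated.
  apply: lowfin_sub (lB x2 y2) _ => g [p]; apply: contraNneq.
  by rewrite /d1 => ->; rewrite (bil0r (act_bilinear w3 _)).
have kc2 : kind2 c2.
  split=> [|p]; last exact: lA.
  have [N NP] := act_truncated m2 u y1; exists N => p g /NP pN.
  by rewrite /c2 pN (bil0r (bA g)).
have kd2 : kind2 d2.
  split=> [|p]; last exact: lB.
  have [N NP] := act_truncated w2 v y2; exists N => p g /NP pN.
  by rewrite /d2 pN (bil0r (bB g)).
have kc3 : kind2 c3.
  split=> [|p]; last exact: lA.
  have [N NP] := act_truncated m1 u x1; exists N => p g /NP pN.
  by rewrite /c3 pN (bil0l (bA g)).
have kd3 : kind2 d3.
  split=> [|p]; last exact: lB.
  have [N NP] := act_truncated w1 v x2; exists N => p g /NP pN.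
  by rewrite /d3 pN (bil0l (bB g)).
have E1 n g : act (m := tensor_module M3 W3) (tpure u v) n
    (tensor_family A B (tpure x1 x2) g (tpure y1 y2)) = conv (@tpure _ M3 W3) c1 d1 n g.
  have cv := kind1_convolvable bt kc1 kd1 n g.
  rewrite tensor_familyE (fsum_lin ((act_bilinear t3 n).2 _)); last first.
    exact: tensor_family_fsupp.
  rewrite /conv (fsum_pair (F := fun p k =>
    tpure (c1 p k) (d1 (n - 1 - p) (g - 1 - k)))) //.
  rewrite fsum_exchange //; apply: eq_fsum => k.
  exact: (tensor_actE m3 w3).
have E2 n g : tensor_family A B (tpure x1 x2) g
    (act (m := tensor_module M2 W2) (tpure u v) n (tpure y1 y2))
    = conv (@tpure _ M3 W3) c2 d2 n g.
  have cv := kind2_convolvable bt kc2 kd2 n g.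
  rewrite [act _ _ _](tensor_actE m2 w2) (fsum_lin ((tensor_family_bilinear g).2 _)).
    rewrite /conv (fsum_pair (F := fun p k =>
      tpure (c2 p k) (d2 (n - 1 - p) (g - 1 - k)))) //.
    by apply: eq_fsum => p; rewrite tensor_familyE.
  exact: (tensor_act_fsupp m2 w2).
have E3 n g : tensor_family A B
    (act (m := tensor_module M1 W1) (tpure u v) n (tpure x1 x2)) g (tpure y1 y2)
    = conv (@tpure _ M3 W3) c3 d3 n g.
  have cv := kind2_convolvable bt kc3 kd3 n g.
  rewrite [act _ _ _](tensor_actE m1 w1) (fsum_lin ((tensor_family_bilinear g).1 _)).
    rewrite /conv (fsum_pair (F := fun p k =>
      tpure (c3 p k) (d3 (n - 1 - p) (g - 1 - k)))) //.
    by apply: eq_fsum => p; rewrite tensor_familyE.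
  exact: (tensor_act_fsupp m1 w1).
under eq_fsum => i do rewrite E1.
under [X in _ - X]eq_fsum => i do rewrite E2.
under [X in _ = X]eq_fsum => i do rewrite E3.
exact: (jac_conv bt kc1 kc2 kc3 kd1 kd2 kd3 (jA u x1 y1) (jB v x2 y2)).
Qed.

End Families.
End TensorFamilies.

Section IopSupports.
Variables (K : numFieldType) (V : voa_data K).
Variables W1 W2 W3 : module_data V.
Hypotheses (w1 : is_weak_module W1) (w2 : is_weak_module W2)
  (w3 : is_weak_module W3).
Hypotheses (d1 : decomposes (Lmode (W := W1) 0))
           (d2 : decomposes (Lmode (W := W2) 0)).
Hypothesis cosets : weights_in_finitely_many_cosets W3.
Variable Y : iop W1 W2 W3.
Hypothesis iY : is_intertwining Y.

(** For x and y of weights a and b the coefficient has weight a + b - h - 1. Condition (iii) for the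
    target leaves finitely many cosets for h, and lower truncation bounds h from above in each. *)
Lemma iop_lowfin x y : lowfin (fun h => exists k, Y x h k y != 0).
Proof.
have bY := iop_bilinear iY.
elim/(decomp_ind d1): x => [x x' lx lx'|a x ax].
  apply: lowfin_sub (lowfinU lx lx') _ => h [k nz].
  have [x0|xnz] := eqVneq (Y x h k y) 0; last by left; exists k.
  by right; exists k; rewrite (bilDl (bY h k)) x0 add0r in nz.
elim/(decomp_ind d2): y => [y y' ly ly'|b y yb].
  apply: lowfin_sub (lowfinU ly ly') _ => h [k nz].
  have [y0|ynz] := eqVneq (Y x h k y) 0; last by left; exists k.
  by right; exists k; rewrite (bilDr (bY h k)) y0 add0r in nz.
have [s sP] := cosets; have [N NP] := choice (iop_truncated iY x y).
pose c z := a + b - 1 - z.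
exists [seq c z + (N (c z))%:R | z <- s] => h [k nz].
have [z zs [n zE]] : exists2 z, z \in s & exists n : int, a + b - h - 1 = z + n%:~R.
  by apply: sP; exists (Y x h k y) => //; exact: (iop_weight w1 w2 w3 iY).
have hE : h = c z - n%:~R.
  rewrite /c; have -> : z = a + b - h - 1 - n%:~R by rewrite zE addrK.
  by ring.
exists (c z + (N (c z))%:R); first by apply/mapP; exists z.
have nN : - n < (N (c z))%:Z.
  rewrite ltNge; apply: contraNN nz => Nn; apply/eqP.
  have -> : h = c z + (absz (- n))%:R.
    by rewrite hE -mulrNz pmulrn; congr (_ + _%:~R); lia.
  by apply: NP; lia.
exists (absz (n + (N (c z))%:Z)%R).
have -> : (absz (n + (N (c z))%:Z)%R)%:R = n%:~R + (N (c z))%:R :> K.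
  rewrite pmulrn (_ : Posz (absz _) = n + (N (c z))%:Z) ?intrD //; lia.
by rewrite hE; ring.
Qed.

End IopSupports.

(** * Tensor products of logarithmic intertwining operators *)

Section TensorIop.
Variables (K : numFieldType) (U V : voa_data K).
Hypotheses (U_voa : is_VOA U) (V_voa : is_VOA V).
Variables (M1 M2 M3 : module_data U) (W1 W2 W3 : module_data V).
Hypotheses (m1 : is_weak_module M1) (m2 : is_weak_module M2)
  (m3 : is_weak_module M3).
Hypotheses (w1 : is_weak_module W1) (w2 : is_weak_module W2)
  (w3 : is_weak_module W3).
Hypotheses (t1 : is_weak_module (tensor_module M1 W1))
  (t2 : is_weak_module (tensor_module M2 W2))
  (t3 : is_weak_module (tensor_module M3 W3)).
Variables (I : iop M1 M2 M3) (J : iop W1 W2 W3).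
Hypotheses (iI : is_intertwining I) (iJ : is_intertwining J).
Hypotheses (lI : forall x y, lowfin (fun h => exists k, I x h k y != 0))
  (lJ : forall x y, lowfin (fun h => exists k, J x h k y != 0)).

Let bt := tpure_bilinear M3 W3.
Let bI := iop_bilinear iI.
Let bJ := iop_bilinear iJ.

Let fam k k' : tensor M1 W1 -> K -> tensor M2 W2 -> tensor M3 W3 :=
  tensor_family (fun x h => I x h k) (fun x h => J x h k').

Let lIk k x y : lowfin (fun h => I x h k y != 0).
Proof. by apply: lowfin_sub (lI x y) _ => h nz; exists k. Qed.
Let lJk k x y : lowfin (fun h => J x h k y != 0).
Proof. by apply: lowfin_sub (lJ x y) _ => h nz; exists k. Qed.

Let fam_bil k k' h : is_bilinear (fun x y => fam k k' x h y).
Proof. exact: tensor_family_bilinear. Qed.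

Let fam_pure k k' x1 x2 h y1 y2 : fam k k' (tpure x1 x2) h (tpure y1 y2)
  = \sum_(g \in [set: K]) tpure (I x1 g k y1) (J x2 (h - 1 - g) k' y2).
Proof. exact: tensor_familyE. Qed.

Let pure_fsupp k k' x1 y1 x2 y2 h :
  fsupp (fun g => tpure (I x1 g k y1) (J x2 (h - 1 - g) k' y2)).
Proof. exact: (tensor_family_fsupp (A := fun x h => I x h k) (B := fun x h => J x h k')). Qed.

Lemma tensor_iopE x h k y :
  tensor_iop I J x h k y = \sum_(i < k.+1) fam i (k - i) x h y.
Proof.
have sumE x1 x2 y1 y2 :
    \sum_(g \in [set: K]) \sum_(i < k.+1)
      tpure (I x1 g i y1) (J x2 (h - 1 - g) (k - i)%N y2)
    = \sum_(i < k.+1) \sum_(g \in [set: K])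
      tpure (I x1 g i y1) (J x2 (h - 1 - g) (k - i)%N y2).
  by apply: fsum_sum => i; exact: pure_fsupp.
pose F x1 x2 := fun y1 y2 => \sum_(g \in [set: K]) \sum_(i < k.+1)
      tpure (I x1 g i y1) (J x2 (h - 1 - g) (k - i)%N y2).
have bF1 x1 x2 : is_bilinear (F x1 x2).
  have fb (i : 'I_k.+1) := tensor_family_bilinear1 (bI^~ i) (bJ^~ (k - i)%N)
      (lIk i) (lJk (k - i)%N) x1 x2 h.
  split=> [z|z] a u u'; rewrite /F !sumE scaler_sumr -big_split;
    apply: eq_bigr => i _; [exact: (fb i).1 | exact: (fb i).2].
have F_E x1 x2 : tlift (F x1 x2) y = \sum_(i < k.+1) fam i (k - i) (tpure x1 x2) h y.
  elim/tensor_ind: y => [s t sE tE|y1 y2].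
    rewrite (linD (tlift_linear (bF1 x1 x2))) sE tE -big_split.
    by apply: eq_bigr => i _; rewrite (bilDr (fam_bil _ _ h)).
  rewrite tliftE // /F sumE; apply: eq_bigr => i _; by rewrite fam_pure.
have bF2 : is_bilinear (fun x1 x2 => tlift (F x1 x2) y).
  split=> [z|z] a u u'; rewrite !F_E scaler_sumr -big_split;
    apply: eq_bigr => i _.
    by rewrite (tpure_bilinear M1 W1).1 (fam_bil _ _ h).1.
  by rewrite (tpure_bilinear M1 W1).2 (fam_bil _ _ h).1.
rewrite /tensor_iop; elim/tensor_ind: x => [s t sE tE|x1 x2].
  rewrite (linD (tlift_linear bF2)) sE tE -big_split.
  by apply: eq_bigr => i _; rewrite (bilDl (fam_bil _ _ h)).
by rewrite (tliftE _ _ bF2); exact: F_E.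
Qed.

Lemma tensor_iop_bilinear h k : is_bilinear (fun x y => tensor_iop I J x h k y).
Proof.
split=> [z|z] a u u'; rewrite !tensor_iopE scaler_sumr -big_split;
  apply: eq_bigr => i _; [exact: (fam_bil _ _ h).1 | exact: (fam_bil _ _ h).2].
Qed.

Lemma tensor_iop_pure x1 x2 h k y1 y2 :
  tensor_iop I J (tpure x1 x2) h k (tpure y1 y2)
  = \sum_(g \in [set: K]) \sum_(i < k.+1)
      tpure (I x1 g i y1) (J x2 (h - 1 - g) (k - i)%N y2).
Proof.
rewrite tensor_iopE fsum_sum; last by move=> i; exact: pure_fsupp.
by apply: eq_bigr => i _; rewrite fam_pure.
Qed.

Let pure_pair x1 x2 h y1 y2 : exists (N : nat) (H : set K), finite_set H /\
  forall (n : nat) g k k', tpure (I x1 g k y1) (J x2 (h + n%:R - 1 - g) k' y2) != 0 ->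
    (n < N)%N /\ H g.
Proof.
have [N [H [fH HP]]] := lowfin_pair (h - 1) (lI x1 y1) (lJ x2 y2).
exists N, H; split=> // n g k k' /(bilinear_neq0 bt)/andP[Inz Jnz].
by apply: (HP g (h + n%:R - 1 - g)); [exists k | exists k' | ring].
Qed.

Lemma tensor_iop_truncated x y h : exists N : nat, forall n, (N <= n)%N ->
  forall k, tensor_iop I J x (h + n%:R) k y = 0.
Proof.
have bT := tensor_iop_bilinear.
elim/tensor_ind: x => [s t [N1 sN] [N2 tN]|x1 x2].
  exists (maxn N1 N2) => n; rewrite geq_max => /andP[n1 n2] k.
  by rewrite (bilDl (bT _ k)) sN // tN // addr0.
elim/tensor_ind: y => [s t [N1 sN] [N2 tN]|y1 y2].
  exists (maxn N1 N2) => n; rewrite geq_max => /andP[n1 n2] k.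
  by rewrite (bilDr (bT _ k)) sN // tN // addr0.
have [N [H [_ HP]]] := pure_pair x1 x2 h y1 y2.
exists N => n Nn k; rewrite tensor_iop_pure; apply: fsum0 => g.
apply: big1 => i _; apply/eqP; apply: contraTT Nn => /HP[].
by rewrite -ltnNge.
Qed.

Lemma tensor_iop_log x h y : exists k0 : nat, forall k, (k0 <= k)%N ->
  tensor_iop I J x h k y = 0.
Proof.
have bT := tensor_iop_bilinear h.
elim/tensor_ind: x => [s t [N1 sN] [N2 tN]|x1 x2].
  exists (maxn N1 N2) => n; rewrite geq_max => /andP[n1 n2].
  by rewrite (bilDl (bT _)) sN // tN // addr0.
elim/tensor_ind: y => [s t [N1 sN] [N2 tN]|y1 y2].
  exists (maxn N1 N2) => n; rewrite geq_max => /andP[n1 n2].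
  by rewrite (bilDr (bT _)) sN // tN // addr0.
have [N [H [/finite_seqP[s ->] HP]]] := pure_pair x1 x2 h y1 y2.
have [kI kIP] := choice (fun g => iop_log iI x1 g y1).
have [kJ kJP] := choice (fun g => iop_log iJ x2 g y2).
pose b1 := (\max_(g <- s) kI g)%N; pose b2 := (\max_(g <- s) kJ (h - 1 - g)%R)%N.
exists (b1 + b2)%N => k bk; rewrite tensor_iop_pure; apply: fsum0 => g.
apply: big1 => i _; apply/eqP/negPn/negP => nz.
have gs : g \in s.
  by have := HP 0%N g i (k - i)%N; rewrite addr0 => /(_ nz)[].
have g1 : (kI g <= b1)%N by exact: leq_bigmax_seq.
have g2 : (kJ (h - 1 - g)%R <= b2)%N.
  exact: (leq_bigmax_seq (F := fun g => kJ (h - 1 - g))).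
have [Inz Jnz] := andP (bilinear_neq0 bt nz).
have i1 : (i < kI g)%N by rewrite ltnNge; apply: contraNN Inz => /kIP ->.
have i2 : (k - i < kJ (h - 1 - g)%R)%N.
  by rewrite ltnNge; apply: contraNN Jnz => /kJP ->.
by clearbody b1 b2; lia.
Qed.

Lemma tensor_iop_jacobi k :
  jacobi (@act K (tensor_voa U V) (tensor_module M1 W1))
    (@act K (tensor_voa U V) (tensor_module M2 W2))
    (@act K (tensor_voa U V) (tensor_module M3 W3))
    (fun x h => tensor_iop I J x h k).
Proof.
apply: (jacobi_ext (I := fun x h y => \sum_(i < k.+1) fam i (k - i) x h y)).
  by move=> x h y; rewrite tensor_iopE.
apply: (jacobi_sum t1 t2 t3) => [i h|i|i].
- exact: fam_bil.
- exact: (tensor_family_truncated (bI^~ i) (bJ^~ (k - i)%N)).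
exact: (tensor_family_jacobi m1 m2 m3 w1 w2 w3 (bI^~ i) (bJ^~ (k - i)%N)
  (lIk i) (lJk (k - i)%N) (iop_jacobi iI i) (iop_jacobi iJ (k - i)%N) t1 t2 t3).
Qed.

Lemma tensor_iop_derivative x h k y :
  tensor_iop I J (Lmode (W := tensor_module M1 W1) (-1) x) h k y
  = - (h *: tensor_iop I J x (h - 1) k y)
    + k.+1%:R *: tensor_iop I J x (h - 1) k.+1 y.
Proof.
have bT := tensor_iop_bilinear.
elim/tensor_ind: x => [s t sE tE|x1 x2].
  rewrite (linD (Lmode_lin (-1) t1)) !(bilDl (bT _ _)) sE tE !scalerDr opprD.
  by rewrite addrACA.
elim/tensor_ind: y => [s t sE tE|y1 y2].
  by rewrite !(bilDr (bT _ _)) sE tE !scalerDr opprD addrACA.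
pose T g i j := tpure (I x1 g i y1) (J x2 (h - 1 - 1 - g) j y2).
rewrite (Lmode_tpure _ _ _ m1 w1 t1) (bilDl (bT _ _)) !tensor_iop_pure.
(* After this shift the terms from L(-1) x1 and from L(-1) x2 both have indices g and h - 2 - g,
   with scalars g + 1 and h - 1 - g of sum h. *)
rewrite (@reindex_fsbigT _ _ _ _ _ (fun g => g + 1)); last first.
  by exists (fun g => g - 1) => g; rewrite ?addrK ?subrK.
have fT n : fsupp (fun g => \sum_(i < n.+1) T g i (n - i)%N).
  have [N [H [fH HP]]] := pure_pair x1 x2 (h - 1) y1 y2.
  apply: (sub_finite_set _ fH) => g /= nz; apply: contrapT => nH.
  move/eqP: nz; apply; apply: big1 => i _; apply/eqP/negPn/negP => nz.
  by apply: nH; apply: (HP 0%N g i (n - i)%N _).2; rewrite addr0.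
have fhT := fsupp_lin (linear_scale h) (fT k).
have fkT := fsupp_lin (linear_scale k.+1%:R) (fT k.+1).
rewrite (fsumZ _ (fT k)) (fsumZ _ (fT k.+1)) (fsumN fhT) -(fsumD (fsuppN fhT) fkT).
have f1 : fsupp (fun g => \sum_(i < k.+1)
    tpure (I (Lmode (-1) x1) (g + 1) i y1) (J x2 (h - 1 - (g + 1)) (k - i)%N y2)).
  have [N [H [fH HP]]] := pure_pair (Lmode (-1) x1) x2 h y1 y2.
  apply: (sub_finite_set _ (finite_image (fun g => g - 1) fH)) => g /= nz.
  exists (g + 1); last by rewrite addrK.
  apply: contrapT => nH.
  move/eqP: nz; apply; apply: big1 => i _; apply/eqP/negPn/negP => nz.
  by apply: nH; apply: (HP 0%N (g + 1) i (k - i)%N _).2; rewrite addr0.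
have f2 : fsupp (fun g => \sum_(i < k.+1)
    tpure (I x1 g i y1) (J (Lmode (-1) x2) (h - 1 - g) (k - i)%N y2)).
  have [N [H [fH HP]]] := pure_pair x1 (Lmode (-1) x2) h y1 y2.
  apply: (sub_finite_set _ fH) => g /= nz; apply: contrapT => nH.
  move/eqP: nz; apply; apply: big1 => i _; apply/eqP/negPn/negP => nz.
  by apply: nH; apply: (HP 0%N g i (k - i)%N _).2; rewrite addr0.
have := fsumD f1 f2; move=> /= <-.
apply: eq_fsum => g.
rewrite -leibniz_sum scaler_sumr -sumrN -!big_split; apply: eq_bigr => -[i ik] _ /=.
rewrite (iop_derivative iI) (iop_derivative iJ) addrK.
have -> : h - 1 - (g + 1) = h - 1 - 1 - g by ring.
have -> : h - 1 - g - 1 = h - 1 - 1 - g by ring.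
rewrite (bilDl bt) (bilDr bt) (bilNl bt) (bilNr bt) !(bilZl bt) !(bilZr bt).
by rewrite /T; lmod_conv K.
Qed.

Lemma tensor_iop_intertwining : is_intertwining (tensor_iop I J).
Proof.
split.
- exact: tensor_iop_bilinear.
- exact: tensor_iop_log.
- exact: tensor_iop_truncated.
- exact: tensor_iop_jacobi.
exact: tensor_iop_derivative.
Qed.

End TensorIop.

(** * Splitting an intertwining operator *)

Lemma logfree_add (K : numFieldType) (V : voa_data K) (W1 W2 W3 : module_data V)
    (I J : W1 -> K -> W2 -> W3) :
  is_weak_module W1 -> is_weak_module W2 -> is_weak_module W3 ->
  is_logfree I -> is_logfree J -> is_logfree (fun x h y => I x h y + J x h y).
Proof.
move=> w1 w2 w3 [bI tI jI wI] [bJ tJ jJ wJ].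
have l3 := Lmode_lin 0 w3.
split.
- move=> h; split=> [y|x]; apply: linear_addf; try exact: (bI h).1;
    try exact: (bJ h).1; try exact: (bI h).2; exact: (bJ h).2.
- move=> x y h; have [N1 I0] := tI x y h; have [N2 J0] := tJ x y h.
  exists (maxn N1 N2) => n; rewrite geq_max => /andP[n1 n2].
  by rewrite I0 // J0 // addr0.
- move=> v x y l m h; have b3 := act_bilinear w3.
  under eq_fsum => i do rewrite (bilDr (b3 _)) scalerDr.
  under [X in _ - X]eq_fsum => i do rewrite scalerDr.
  under [X in _ = X]eq_fsum => i do rewrite scalerDr.
  have [t1 t2] := (act_truncated w1, act_truncated w2).
  rewrite (fsumD (fsupp_jacobi1 b3 tI _ _ _ _ _ _) (fsupp_jacobi1 b3 tJ _ _ _ _ _ _)).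
  rewrite (fsumD (fsupp_jacobi2 bI t2 _ _ _ _ _ _) (fsupp_jacobi2 bJ t2 _ _ _ _ _ _)).
  rewrite (fsumD (fsupp_jacobi3 bI t1 _ _ _ _ _ _) (fsupp_jacobi3 bJ t1 _ _ _ _ _ _)).
  by rewrite opprD addrACA; congr (_ + _); [exact: jI | exact: jJ].
by move=> a b h x y ax yb; apply: gen_eigenD => //; [exact: wI | exact: wJ].
Qed.

Section TwoVariables.
Variables (K : numFieldType) (U V : voa_data K).
Hypotheses (U_voa : is_VOA U) (V_voa : is_VOA V).
Variables (M1 M2 : module_data U) (W1 W2 : module_data V).
Variable X : module_data (tensor_voa U V).
Hypotheses (m1 : is_weak_module M1) (m2 : is_weak_module M2)
  (w1 : is_weak_module W1) (w2 : is_weak_module W2)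
  (t1 : is_weak_module (tensor_module M1 W1))
  (t2 : is_weak_module (tensor_module M2 W2)) (wX : is_weak_module X).
Hypotheses (d1 : decomposes (Lmode (W := W1) 0))
  (d2 : decomposes (Lmode (W := W2) 0))
  (dX : decomposes (Lmode (W := restrict_right X) 0)).
Variable Y : iop (tensor_module M1 W1) (tensor_module M2 W2) X.
Hypothesis iY : is_intertwining Y.

Let LV := Lmode (W := restrict_right X) 0.
Let lV : linear LV.
Proof. exact: Lmode_lin (restrict_right_weak U_voa V_voa wX). Qed.
Let l1 : linear (Lmode (W := W1) 0). Proof. exact: Lmode_lin. Qed.
Let l2 : linear (Lmode (W := W2) 0). Proof. exact: Lmode_lin. Qed.
Let bY h := iop_bilinear iY h 0.
Let prl a : linear (wproj dX a). Proof. exact: wproj_lin. Qed.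
Let bt1 := tpure_bilinear M1 W1.
Let bt2 := tpure_bilinear M2 W2.

(* For w1 and w2 of L_V(0)-weights a and b, the component of Y(m1 (x) w1, x)  *)
(* (m2 (x) w2) of L_V(0)-weight a + b - h' - 1 is regarded as the coefficient *)
(* of x_U^(-h-1) x_V^(-h'-1) in a two-variable intertwining operator, from    *)
(* which Y is recovered at x_U = x_V = x.                                     *)
Definition split_homog (h h' : K) (p1 : M1) (p2 : M2) (a : K) (q1 : W1) (b : K)
    (q2 : W2) : X :=
  wproj dX (a + b - h' - 1) (Y (tpure p1 q1) (h + h' + 1) 0 (tpure p2 q2)).

Definition split_iop (h h' : K) (p1 : M1) (q1 : W1) (p2 : M2) (q2 : W2) : X :=
  wext d1 (fun a q1 => wext d2 (fun b q2 => split_homog h h' p1 p2 a q1 b q2) q2) q1.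

Let split_homog_lin2 h h' p1 p2 a q1 b : linear (split_homog h h' p1 p2 a q1 b).
Proof.
apply: (linear_compf (prl _)); apply: (linear_compf ((bY _).2 _)); exact: bt2.2.
Qed.

Let split_inner_lin h h' p1 p2 a q2 :
  linear (fun q1 => wext d2 (fun b q2 => split_homog h h' p1 p2 a q1 b q2) q2).
Proof.
apply: (linear_fsum (F := fun b q1 => split_homog h h' p1 p2 a q1 b (wproj d2 b q2))).
  move=> b; apply: (linear_compf (prl _)); apply: (linear_compf ((bY _).1 _)).
  exact: bt1.2.
by move=> q1; exact: wext_fsupp (split_homog_lin2 h h' p1 p2 a q1) q2.
Qed.

Lemma split_iop_homog h h' p1 p2 a q1 b q2 :
  gen_eigenspace (Lmode (W := W1) 0) a q1 ->
  gen_eigenspace (Lmode (W := W2) 0) b q2 ->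
  split_iop h h' p1 q1 p2 q2 = split_homog h h' p1 p2 a q1 b q2.
Proof.
move=> aq1 bq2; rewrite /split_iop (wextE _ _ aq1) //.
by rewrite (wextE _ _ bq2).
Qed.

Lemma split_iop_bilinear h h' p1 p2 :
  is_bilinear (fun q1 q2 => split_iop h h' p1 q1 p2 q2).
Proof.
split=> [q2|q1].
  by apply: wext_lin => // a; exact: split_inner_lin.
apply: (linear_fsum (F := fun a q2 => wext d2
  (fun b q2 => split_homog h h' p1 p2 a (wproj d1 a q1) b q2) q2)).
  by move=> a; exact: wext_lin.
move=> q2; exact: (wext_fsupp d1 (fun a => split_inner_lin h h' p1 p2 a q2) q1).
Qed.

Lemma split_ind (S : W1 -> W2 -> Prop) :
  (forall q1 q1' q2, S q1 q2 -> S q1' q2 -> S (q1 + q1') q2) ->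
  (forall q1 q2 q2', S q1 q2 -> S q1 q2' -> S q1 (q2 + q2')) ->
  (forall a b q1 q2, gen_eigenspace (Lmode (W := W1) 0) a q1 ->
    gen_eigenspace (Lmode (W := W2) 0) b q2 -> S q1 q2) ->
  forall q1 q2, S q1 q2.
Proof.
move=> S1 S2 S0 q1 q2; elim/(decomp_ind d1): q1 => [x y Sx Sy|a q1 aq1].
  exact: S1.
by elim/(decomp_ind d2): q2 => [x y Sx Sy|b q2 bq2]; [exact: S2 | exact: S0 aq1 bq2].
Qed.

(** Modes of U commute with L_V(0), hence preserve its generalized eigenspaces. *)
Let pr_left a u n x :
  wproj dX a (act (m := restrict_left X) u n x)
  = act (m := restrict_left X) u n (wproj dX a x).
Proof.
have lX := (act_bilinear (restrict_left_weak U_voa V_voa wX) n).2 u.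
rewrite -{1}[a]addr0; apply: (wproj_comm dX dX lV lV lX) => b y yb.
rewrite addr0; apply: (gen_eigen_transport lX) yb => z.
by rewrite (linB lX) (linZ lX) /LV /Lmode (left_right_comm U_voa V_voa wX).
Qed.

Let pr_right a v n k x : weight_space n v ->
  wproj dX (a + (n - k - 1)%:~R) (act (m := restrict_right X) v k x)
  = act (m := restrict_right X) v k (wproj dX a x).
Proof.
move=> vn; have wR := restrict_right_weak U_voa V_voa wX.
apply: (wproj_comm dX dX lV lV ((act_bilinear wR k).2 v)) => b y.
exact: act_weight.
Qed.

Let total_weight (M : module_data U) (W : module_data V) a b p q :
  is_weak_module M -> is_weak_module W -> is_weak_module (tensor_module M W) ->
  gen_eigenspace (Lmode (W := M) 0) a p -> gen_eigenspace (Lmode (W := W) 0) b q ->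
  gen_eigenspace (Lmode (W := tensor_module M W) 0) (a + b) (tpure p q).
Proof.
move=> wM wW wT ap bq; have bt := tpure_bilinear M W.
have -> : Lmode (W := tensor_module M W) 0
    = fun x => Lmode (W := restrict_left (tensor_module M W)) 0 x
             + Lmode (W := restrict_right (tensor_module M W)) 0 x.
  by apply/funext => x; rewrite (Lmode_tensor wT).
apply: gen_eigen_add.
- exact: Lmode_lin (restrict_left_weak U_voa V_voa wT).
- exact: Lmode_lin (restrict_right_weak U_voa V_voa wT).
- by move=> y; exact: (Lmode_comm U_voa V_voa wT).
- apply: (gen_eigen_transport (bt.1 q)) ap => z.
  by rewrite [Lmode _ _](tensor_act_left wM wW) (bilBl bt) (bilZl bt).
apply: (gen_eigen_transport (bt.2 p)) bq => z.
by rewrite [Lmode _ _](tensor_act_right wM wW) (bilBr bt) (bilZr bt).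
Qed.

(** The projection commutes with U, so the Jacobi identity of [Y] for u (x) 1 survives it with h
    shifted by h' + 1. The arguments from V may be taken homogeneous, as log-free families are
    closed under sums. *)
Lemma split_iop_left q1 q2 h' :
  is_logfree (W1 := M1) (W2 := M2) (W3 := restrict_left X)
    (fun p1 h p2 => split_iop h h' p1 q1 p2 q2).
Proof.
have wL := restrict_left_weak U_voa V_voa wX.
pattern q1, q2; apply: split_ind => {q1 q2} [q1 q1' q2 f f'|q1 q2 q2' f f'|].
- have -> : (fun p1 h p2 => split_iop h h' p1 (q1 + q1') p2 q2)
      = (fun p1 h p2 => split_iop h h' p1 q1 p2 q2 + split_iop h h' p1 q1' p2 q2).
    by do 3!apply/funext => ?; rewrite (bilDl (split_iop_bilinear _ _ _ _)).
  exact: (logfree_add m1 m2 wL).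
- have -> : (fun p1 h p2 => split_iop h h' p1 q1 p2 (q2 + q2'))
      = (fun p1 h p2 => split_iop h h' p1 q1 p2 q2 + split_iop h h' p1 q1 p2 q2').
    by do 3!apply/funext => ?; rewrite (bilDr (split_iop_bilinear _ _ _ _)).
  exact: (logfree_add m1 m2 wL).
move=> a b q1 q2 aq1 bq2.
have -> : (fun p1 h p2 => split_iop h h' p1 q1 p2 q2)
    = (fun p1 h p2 => split_homog h h' p1 p2 a q1 b q2).
  by do 3!apply/funext => ?; exact: split_iop_homog.
have tY := iop_truncated_coefs iY 0.
rewrite /split_homog; split.
- move=> h; split=> [p2|p1]; apply: (linear_compf (prl _)).
    by apply: (linear_compf ((bY _).1 _)); exact: bt1.1.
  by apply: (linear_compf ((bY _).2 _)); exact: bt2.1.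
- move=> p1 p2 h; have [N YN] := tY (tpure p1 q1) (tpure p2 q2) (h + h' + 1).
  exists N => n /YN Yn; rewrite -(lin0 (prl (a + b - h' - 1))) -Yn.
  by congr (wproj _ _ (Y _ _ _ _)); ring.
- move=> u p1 p2 l m h.
  have bX := act_bilinear wX; have bYk := bY.
  have pl c n x : wproj dX c (act (m := X) (tpure u (vacuum V)) n x)
      = act (m := X) (tpure u (vacuum V)) n (wproj dX c x) by exact: pr_left.
  have al1 n : act (m := tensor_module M1 W1) (tpure u (vacuum V)) n (tpure p1 q1)
      = tpure (act u n p1) q1 by exact: (tensor_act_left m1 w1).
  have al2 n : act (m := tensor_module M2 W2) (tpure u (vacuum V)) n (tpure p2 q2)
      = tpure (act u n p2) q2 by exact: (tensor_act_left m2 w2).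
  have := congr1 (wproj dX (a + b - h' - 1)) (iop_jacobi iY 0 (tpure u (vacuum V))
    (tpure p1 q1) (tpure p2 q2) l m (h + h' + 1)).
  rewrite (linB (prl _)) !(fsum_lin (prl _)).
  + under eq_fsum => i.
      rewrite (linZ (prl _)) pl.
      have -> : h + h' + 1 + i%:R = h + i%:R + h' + 1 by ring.
      over.
    under [X in _ - X]eq_fsum => i.
      rewrite (linZ (prl _)) al2.
      have -> : h + h' + 1 + l%:~R - i%:R = h + l%:~R - i%:R + h' + 1 by ring.
      over.
    under [X in _ = X -> _]eq_fsum => i.
      rewrite (linZ (prl _)) al1.
      have -> : h + h' + 1 + m%:~R - i%:R = h + m%:~R - i%:R + h' + 1 by ring.
      over.
    exact.
  + exact: (fsupp_jacobi3 bYk (act_truncated t1)).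
  + exact: (fsupp_jacobi2 bYk (act_truncated t2)).
  exact: (fsupp_jacobi1 bX tY).
move=> c d h p1 p2 cp1 dp2.
have tw := iop_weight t1 t2 wX iY (h + h' + 1) 0
  (total_weight m1 w1 t1 cp1 aq1) (total_weight m2 w2 t2 dp2 bq2).
set y := Y _ _ _ _ in tw *; set e := (_ + _ - _ - _) in tw.
have lL := Lmode_lin 0 wL; have lX := Lmode_lin 0 wX.
have prX z : Lmode (W := X) 0 (wproj dX (a + b - h' - 1) z)
    = wproj dX (a + b - h' - 1) (Lmode (W := X) 0 z).
  rewrite !(Lmode_tensor wX) (linD (prl _)); congr (_ + _).
    exact: (esym (pr_left _ _ _ _)).
  rewrite -[X in wproj _ X (LV _)]addr0; symmetry.
  apply: (wproj_comm dX dX lV lV lV) => b' x' [n xn]; rewrite addr0; exists n.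
  have sV := shift_lin b' lV.
  rewrite -[RHS](lin0 lV) -xn; apply: iter_comm => z'.
  by rewrite (linB lV) (linZ lV).
have ey : gen_eigenspace (Lmode (W := X) 0) e (wproj dX (a + b - h' - 1) y).
  apply: (gen_eigen_transport (prl _)) tw => z.
  by rewrite (linB (prl _)) (linZ (prl _)) prX.
have vy := wproj_eigen dX (a + b - h' - 1) y.
have LE : Lmode (W := restrict_left X) 0 = fun x => Lmode (W := X) 0 x + - LV x.
  by apply/funext => x; rewrite (Lmode_tensor wX) addrK.
(* L_U(0) is L(0) - L_V(0), so its weight is the total weight [e] minus the L_V(0)-weight projected
   to. *)
have -> : c + d - h - 1 = e - (a + b - h' - 1) by rewrite /e; ring.
rewrite LE; apply: gen_eigen_add => //.
- by move=> s x x'; rewrite lV opprD scalerN.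
- by move=> x; rewrite (linN lX) !(Lmode_tensor wX) (linD lV) /LV (Lmode_comm U_voa V_voa wX).
exact: (gen_eigenN lV).
Qed.

(** For homogeneous v, q1 and q2, every term of the Jacobi identity of [Y] for 1 (x) v is projected
    to the same L_V(0)-weight, and the projected identity is the one required. *)
Lemma split_iop_right p1 p2 h :
  is_logfree (W1 := W1) (W2 := W2) (W3 := restrict_right X)
    (fun q1 h' q2 => split_iop h h' p1 q1 p2 q2).
Proof.
have wR := restrict_right_weak U_voa V_voa wX.
have bS h' := split_iop_bilinear h h' p1 p2.
have tY := iop_truncated_coefs iY 0.
have tS : truncated_coefs (fun q1 h' q2 => split_iop h h' p1 q1 p2 q2).
  move=> q1 q2; pattern q1, q2.
  apply: split_ind => {q1 q2} [q1 q1' q2 f f' h'|q1 q2 q2' f f' h'|].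
  - have [N1 P1] := f h'; have [N2 P2] := f' h'; exists (maxn N1 N2) => n.
    by rewrite geq_max (bilDl (bS _)) => /andP[/P1 -> /P2 ->]; rewrite addr0.
  - have [N1 P1] := f h'; have [N2 P2] := f' h'; exists (maxn N1 N2) => n.
    by rewrite geq_max (bilDr (bS _)) => /andP[/P1 -> /P2 ->]; rewrite addr0.
  move=> a b q1 q2 aq1 bq2 h'.
  have [N YN] := tY (tpure p1 q1) (tpure p2 q2) (h + h' + 1).
  exists N => n /YN Yn; rewrite (split_iop_homog _ _ _ _ aq1 bq2) /split_homog.
  rewrite [Y _ _ _ _](_ : _ = 0) ?(lin0 (prl _)) // -Yn.
  by congr (Y _ _ _ _); ring.
have wS a b h' q1 q2 : gen_eigenspace (Lmode (W := W1) 0) a q1 ->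
    gen_eigenspace (Lmode (W := W2) 0) b q2 ->
    gen_eigenspace LV (a + b - h' - 1) (split_iop h h' p1 q1 p2 q2).
  move=> aq1 bq2; rewrite (split_iop_homog _ _ _ _ aq1 bq2).
  exact: wproj_eigen.
split=> //.
pose hom (W : module_data V) : set W :=
  [set w | exists a, gen_eigenspace (Lmode (W := W) 0) a w].
apply: (jacobi_additive (Gv := [set v | exists n, weight_space n v])
    (G1 := hom W1) (G2 := hom W2) w1 w2 wR bS tS).
- move=> S SD SG v; have [g [[fg gw vE] _]] := voa_graded V_voa v.
  rewrite vE; apply: (big_ind S) => // [|n _]; last by apply: SG; exists n.
  apply: SG; exists 0.
  exact: etrans (lin0 (Lmode_lin 0 (voa_adjoint V_voa))) (esym (scaler0 _ _)).
- move=> S SD SG q; elim/(decomp_ind d1): q => // a q aq; apply: SG; by exists a.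
- move=> S SD SG q; elim/(decomp_ind d2): q => // a q aq; apply: SG; by exists a.
move=> v q1 q2 [n vn] [a aq1] [b bq2] l m h'.
(* The weight a + b - h' - 1 shifted by the degrees n - m - 1 and -l; the summation index i cancels
   in each of the three sums. *)
pose L : K := a + b - h' - 1 + (n - m - l - 1)%:~R.
have := congr1 (wproj dX L) (iop_jacobi iY 0 (tpure (vacuum U) v)
  (tpure p1 q1) (tpure p2 q2) l m (h + h' + 1)).
rewrite (linB (prl _)) !(fsum_lin (prl _)).
+ have E1 (i : nat) : act (m := restrict_right X) v (m + l - i%:Z)
        (split_iop h (h' + i%:R) p1 q1 p2 q2)
      = wproj dX L (act (m := restrict_right X) v (m + l - i%:Z)
          (Y (tpure p1 q1) (h + h' + 1 + i%:R) 0 (tpure p2 q2))).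
    rewrite (split_iop_homog _ _ _ _ aq1 bq2) /split_homog -(pr_right _ _ _ vn).
    have -> : h + (h' + i%:R) + 1 = h + h' + 1 + i%:R by ring.
    by congr (wproj _ _ _); rewrite /L !intrD !mulrNz; ring.
  have E2 (i : nat) : split_iop h (h' + l%:~R - i%:R) p1 q1 p2 (act v (m + i%:Z) q2)
      = wproj dX L (Y (tpure p1 q1) (h + h' + 1 + l%:~R - i%:R) 0
          (tpure p2 (act v (m + i%:Z) q2))).
    rewrite (split_iop_homog _ _ _ _ aq1 (act_weight V_voa _ w2 vn bq2)) /split_homog.
    have -> : h + (h' + l%:~R - i%:R) + 1 = h + h' + 1 + l%:~R - i%:R by ring.
    by congr (wproj _ _ _); rewrite /L !intrD !mulrNz ?intrD; ring.
  have E3 (i : nat) : split_iop h (h' + m%:~R - i%:R) p1 (act v (l + i%:Z) q1) p2 q2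
      = wproj dX L (Y (tpure p1 (act v (l + i%:Z) q1)) (h + h' + 1 + m%:~R - i%:R) 0
          (tpure p2 q2)).
    rewrite (split_iop_homog _ _ _ _ (act_weight V_voa _ w1 vn aq1) bq2) /split_homog.
    have -> : h + (h' + m%:~R - i%:R) + 1 = h + h' + 1 + m%:~R - i%:R by ring.
    by congr (wproj _ _ _); rewrite /L !intrD !mulrNz ?intrD; ring.
  have ar1 j : act (m := tensor_module M1 W1) (tpure (vacuum U) v) j (tpure p1 q1)
      = tpure p1 (act v j q1) by exact: (tensor_act_right m1 w1).
  have ar2 j : act (m := tensor_module M2 W2) (tpure (vacuum U) v) j (tpure p2 q2)
      = tpure p2 (act v j q2) by exact: (tensor_act_right m2 w2).
  under eq_fsum => i do rewrite (linZ (prl _)) -[wproj _ _ _]E1.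
  under [X in _ - X]eq_fsum => i do rewrite (linZ (prl _)) ar2 -E2.
  under [X in _ = X -> _]eq_fsum => i do rewrite (linZ (prl _)) ar1 -E3.
  exact.
+ exact: (fsupp_jacobi3 bY (act_truncated t1)).
+ exact: (fsupp_jacobi2 bY (act_truncated t2)).
exact: (fsupp_jacobi1 (act_bilinear wX) tY).
Qed.

(** On the diagonal, g runs through all L_V(0)-weights g + (a + b - h), so the sum collects all
    components of one coefficient of [Y]. *)
Lemma split_iop_sum h p1 q1 p2 q2 :
  fsupp (fun g => split_iop g (h - 1 - g) p1 q1 p2 q2) /\
  \sum_(g \in [set: K]) split_iop g (h - 1 - g) p1 q1 p2 q2
  = Y (tpure p1 q1) h 0 (tpure p2 q2).
Proof.
pattern q1, q2; apply: split_ind => {q1 q2} [q1 q1' q2 [f E] [f' E']|q1 q2 q2' [f E] [f' E']|].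
- have D g : split_iop g (h - 1 - g) p1 (q1 + q1') p2 q2
      = split_iop g (h - 1 - g) p1 q1 p2 q2 + split_iop g (h - 1 - g) p1 q1' p2 q2.
    exact: (bilDl (split_iop_bilinear _ _ _ _)).
  rewrite (eq_fsum D) (funext D); split; first exact: fsuppD.
  by rewrite (fsumD f f') E E' (bilDr bt1) (bilDl (bY h)).
- have D g : split_iop g (h - 1 - g) p1 q1 p2 (q2 + q2')
      = split_iop g (h - 1 - g) p1 q1 p2 q2 + split_iop g (h - 1 - g) p1 q1 p2 q2'.
    exact: (bilDr (split_iop_bilinear _ _ _ _)).
  rewrite (eq_fsum D) (funext D); split; first exact: fsuppD.
  by rewrite (fsumD f f') E E' (bilDr bt2) (bilDr (bY h)).
move=> a b q1 q2 aq1 bq2.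
pose y := Y (tpure p1 q1) h 0 (tpure p2 q2).
have D g : split_iop g (h - 1 - g) p1 q1 p2 q2 = wproj dX (g + (a + b - h)) y.
  rewrite (split_iop_homog _ _ _ _ aq1 bq2) /split_homog.
  by congr (wproj _ _ (Y _ _ _ _)); ring.
have bj : bijective (fun g : K => g + (a + b - h)).
  by exists (fun g => g - (a + b - h)) => g; rewrite ?addrK ?subrK.
rewrite (eq_fsum D) (funext D); split; first exact: (fsupp_bij bj (wproj_fsupp dX y)).
by rewrite -/y [RHS](wproj_sum dX) [RHS](@reindex_fsbigT _ _ _ _ _ _ _ bj).
Qed.

End TwoVariables.

(** * The fusion product of tensor products *)

Section Retraction.
Variables (K : numFieldType) (U V : voa_data K).
Variables (M : module_data U) (W : module_data V).
Hypotheses (wM : is_weak_module M) (wW : is_weak_module W)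
  (wT : is_weak_module (tensor_module M W)).

Lemma tpure_left_hom (w : W) :
  is_hom (W' := restrict_left (tensor_module M W)) (fun m : M => tpure m w).
Proof.
split=> [|u n m]; first exact: (tpure_bilinear M W).1.
by rewrite [RHS](tensor_act_left wM wW).
Qed.

Lemma tpure_right_hom (m : M) :
  is_hom (W' := restrict_right (tensor_module M W)) (fun w : W => tpure m w).
Proof.
split=> [|v n w]; first exact: (tpure_bilinear M W).2.
by rewrite [RHS](tensor_act_right wM wW).
Qed.

(** Applying to the factor W a linear functional with value 1 at [w] commutes with U, which acts on
    M only. *)
Lemma tensor_retraction_left (w : W) : w != 0 ->
  exists2 g : tensor M W -> M,
    is_hom (W := restrict_left (tensor_module M W)) g
    & cancel (fun m : M => tpure m w) g.
Proof.
move=> /linear_functional_neq0[e el ew].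
have bg : is_bilinear (fun (m : M) (w : W) => e w *: m).
  split=> [z|m] a x y; first by rewrite scalerDr !scalerA mulrC.
  by rewrite el scalerDl scalerA.
exists (tlift (fun m w => e w *: m)); last by move=> m; rewrite tliftE // ew scale1r.
have gl := tlift_linear bg; split=> // u n t.
have bM := act_bilinear wM n; have lT := (act_bilinear wT n).2 (tpure u (vacuum V)).
elim/tensor_ind: t => [s t sE tE|m z].
  by rewrite [act _ _ _](linD lT) !(linD gl) sE tE (bilDr bM).
rewrite [act _ _ _](tensor_act_left wM wW) !tliftE //.
by rewrite (bilZr bM).
Qed.

Lemma tensor_retraction_right (m : M) : m != 0 ->
  exists2 g : tensor M W -> W,
    is_hom (W := restrict_right (tensor_module M W)) g
    & cancel (fun w : W => tpure m w) g.
Proof.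
move=> /linear_functional_neq0[e el em].
have bg : is_bilinear (fun (m : M) (w : W) => e m *: w).
  split=> [z|z] a x y; last by rewrite scalerDr !scalerA mulrC.
  by rewrite el scalerDl scalerA.
exists (tlift (fun m w => e m *: w)); last by move=> w; rewrite tliftE // em scale1r.
have gl := tlift_linear bg; split=> // v n t.
have bW := act_bilinear wW n; have lT := (act_bilinear wT n).2 (tpure (vacuum U) v).
elim/tensor_ind: t => [s t sE tE|z w].
  by rewrite [act _ _ _](linD lT) !(linD gl) sE tE (bilDr bW).
rewrite [act _ _ _](tensor_act_right wM wW) !tliftE //.
by rewrite (bilZr bW).
Qed.

End Retraction.

Section HomSpaces.
Variables (K : numFieldType) (V : voa_data K) (W X : module_data V).
Hypothesis wX : is_weak_module X.

Lemma hom_lin c (f g : W -> X) : is_hom f -> is_hom g ->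
  is_hom (fun w => c *: f w + g w).
Proof.
move=> [fl fh] [gl gh]; split=> [|v n w].
  by apply: linear_addf => //; exact: linear_scalef.
by have bX := act_bilinear wX n; rewrite fh gh (bilDr bX) (bilZr bX).
Qed.

End HomSpaces.

Section FusionOfTensorProducts.
Variables (K : numFieldType) (U V : voa_data K).
Variables (catU : module_data U -> Prop) (catV : module_data V -> Prop)
  (catD : module_data (tensor_voa U V) -> Prop).
Hypotheses (U_voa : is_VOA U) (V_voa : is_VOA V).
Hypotheses (catU_cat : is_category catU) (catV_cat : is_category catV)
  (catD_cat : is_category catD).
Hypothesis hi : forall X, catD X ->
  decomposes (Lmode (W := restrict_left X) 0) /\
  decomposes (Lmode (W := restrict_right X) 0).
Hypothesis hii : forall M W, catU M -> catV W -> catD (tensor_module M W).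
Hypotheses (hiiiU : forall M, catU M -> weights_in_finitely_many_cosets M)
  (hiiiV : forall W, catV W -> weights_in_finitely_many_cosets W).
Hypothesis hivU : forall (M1 M2 : module_data U) (X : module_data (tensor_voa U V))
  (Y : iop M1 M2 (restrict_left X)),
  catU M1 -> catU M2 -> catD X -> is_intertwining Y -> catU (image_module Y).
Hypothesis hivV : forall (W1 W2 : module_data V) (X : module_data (tensor_voa U V))
  (Y : iop W1 W2 (restrict_right X)),
  catV W1 -> catV W2 -> catD X -> is_intertwining Y -> catV (image_module Y).
Variables (M1 M2 M12 : module_data U) (W1 W2 W12 : module_data V).
Hypotheses (hM1 : catU M1) (hM2 : catU M2) (hW1 : catV W1) (hW2 : catV W2).
Variables (YM : iop M1 M2 M12) (YW : iop W1 W2 W12).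
Hypotheses (fusM : is_fusion_product catU YM) (fusW : is_fusion_product catV YW).

Let hM12 : catU M12 := fusion_object fusM.
Let hW12 : catV W12 := fusion_object fusW.
Let iM := fusion_intertwining fusM.
Let iW := fusion_intertwining fusW.
Let m1 := (catU_cat.1 _ hM1).1. Let dM1 := (catU_cat.1 _ hM1).2.
Let m2 := (catU_cat.1 _ hM2).1. Let dM2 := (catU_cat.1 _ hM2).2.
Let m12 := (catU_cat.1 _ hM12).1.
Let w1 := (catV_cat.1 _ hW1).1. Let dW1 := (catV_cat.1 _ hW1).2.
Let w2 := (catV_cat.1 _ hW2).1. Let dW2 := (catV_cat.1 _ hW2).2.
Let w12 := (catV_cat.1 _ hW12).1.
Let t1 := (catD_cat.1 _ (hii hM1 hW1)).1.
Let t2 := (catD_cat.1 _ (hii hM2 hW2)).1.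
Let t12 := (catD_cat.1 _ (hii hM12 hW12)).1.

Let lM := iop_lowfin m1 m2 m12 dM1 dM2 (hiiiU hM12) iM.
Let lW := iop_lowfin w1 w2 w12 dW1 dW2 (hiiiV hW12) iW.

Let iT : is_intertwining (tensor_iop YM YW).
Proof. exact: (tensor_iop_intertwining m1 m2 m12 w1 w2 w12 t1 t2 t12). Qed.

Let bt := tpure_bilinear M12 W12.

(** Condition (iv) speaks of operators into objects of D. The embedding of M12 as M12 (x) w into M12
    (x) W12 provides such a target, and [tensor_retraction_left] leads back to M12. *)
Let spanM (w : W12) : w != 0 -> forall S : M12 -> Prop,
  (forall c u v, S u -> S v -> S (c *: u + v)) ->
  (forall x h y, S (YM x h 0 y)) -> forall p, S p.
Proof.
move=> /(tensor_retraction_left m12 w12 t12)[g hg eg].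
apply: (fusion_span catU_cat hM1 hM2 fusM
  (restrict_left_weak U_voa V_voa t12) _ (tpure_left_hom m12 w12 w) hg eg).
by move=> J; apply: hivU => //; exact: hii.
Qed.

Let spanW (m : M12) : m != 0 -> forall S : W12 -> Prop,
  (forall c u v, S u -> S v -> S (c *: u + v)) ->
  (forall x h y, S (YW x h 0 y)) -> forall p, S p.
Proof.
move=> /(tensor_retraction_right m12 w12 t12)[g hg eg].
apply: (fusion_span catV_cat hW1 hW2 fusW
  (restrict_right_weak U_voa V_voa t12) _ (tpure_right_hom m12 w12 m) hg eg).
by move=> J; apply: hivV => //; exact: hii.
Qed.

Let tensor_iop0 x1 x2 h y1 y2 :
  tensor_iop YM YW (tpure x1 x2) h 0 (tpure y1 y2)
  = \sum_(g \in [set: K]) tpure (YM x1 g 0 y1) (YW x2 (h - 1 - g) 0 y2).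
Proof.
rewrite (tensor_iop_pure iM iW lM lW).
by apply: eq_fsum => g; rewrite big_ord1.
Qed.

Let tensor_iop0_fsupp x1 x2 h y1 y2 : fsupp (fun g : K =>
  tpure (YM x1 g 0 y1) (YW x2 (h - 1 - g) 0 y2)).
Proof.
apply: (tensor_family_fsupp (A := fun x h => YM x h 0) (B := fun x h => YW x h 0)).
  by move=> x y; apply: lowfin_sub (lM x y) _ => g nz; exists 0%N.
by move=> x y; apply: lowfin_sub (lW x y) _ => g nz; exists 0%N.
Qed.

Section Target.
Variables (X : module_data (tensor_voa U V))
  (Y : iop (tensor_module M1 W1) (tensor_module M2 W2) X).
Hypotheses (hX : catD X) (iY : is_intertwining Y).

Let wX := (catD_cat.1 _ hX).1.
Let dL := (hi hX).1.
Let dR := (hi hX).2.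
Let Z := split_iop dW1 dW2 dR Y.

Let extendM q1 q2 h' : exists2 F : M12 -> X, is_hom (W' := restrict_left X) F
  & forall p1 h p2, F (YM p1 h 0 p2) = Z h h' p1 q1 p2 q2.
Proof.
apply: (fusion_logfree U_voa catU_cat hM1 hM2 fusM (X := restrict_left X)).
- exact: restrict_left_weak.
- by move=> J; exact: hivU.
exact: split_iop_left.
Qed.

Let extendW p1 p2 h : exists2 H : W12 -> X, is_hom (W' := restrict_right X) H
  & forall q1 h' q2, H (YW q1 h' 0 q2) = Z h h' p1 q1 p2 q2.
Proof.
apply: (fusion_logfree V_voa catV_cat hW1 hW2 fusW (X := restrict_right X)).
- exact: restrict_right_weak.
- by move=> J; exact: hivV.
exact: split_iop_right.
Qed.

(* The maps extendM and extendW agree on the coefficients of YM and YW, which *)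
(* span M12 and W12 unless one of the two modules is 0; in that case the      *)
(* existence of extendM or extendW forces Z = 0.                              *)
Let extend : exists2 f : tensor_module M12 W12 -> X, is_hom f
  & forall p1 p2 q1 q2 h h',
    f (tpure (YM p1 h 0 p2) (YW q1 h' 0 q2)) = Z h h' p1 q1 p2 q2.
Proof.
have [[m m0]|noM] := pselect (exists m : M12, m != 0); last first.
  have M0 (m : M12) : m = 0.
    by apply/eqP/negPn/negP => mnz; apply: noM; exists m.
  exists (fun=> 0) => [|p1 p2 q1 q2 h h'].
    split=> [a x y|v n x]; first by rewrite scaler0 addr0.
    by rewrite (bil0r (act_bilinear wX n)).
  have [F hF <-] := extendM q1 q2 h'.
  by rewrite (M0 (YM _ _ _ _)) (lin0 hF.1).
have [[w w0]|noW] := pselect (exists w : W12, w != 0); last first.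
  have W0 (w : W12) : w = 0.
    by apply/eqP/negPn/negP => wnz; apply: noW; exists w.
  exists (fun=> 0) => [|p1 p2 q1 q2 h h'].
    split=> [a x y|v n x]; first by rewrite scaler0 addr0.
    by rewrite (bil0r (act_bilinear wX n)).
  have [H hH <-] := extendW p1 p2 h.
  by rewrite (W0 (YW _ _ _ _)) (lin0 hH.1).
have wL := restrict_left_weak U_voa V_voa wX.
have wR := restrict_right_weak U_voa V_voa wX.
have /choice[F FP] (z : W1 * W2 * K) : exists F : M12 -> X,
    is_hom (W' := restrict_left X) F /\
    forall p1 h p2, F (YM p1 h 0 p2) = Z h z.2 p1 z.1.1 p2 z.1.2.
  by case: z => [[q1 q2] h']; have [F hF FE] := extendM q1 q2 h'; exists F.
(* The p for which the values [F (q1, q2, h') p] come from a V-homomorphism on W12 form a subspace.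
   It contains the coefficients of [YM] by [extendW], hence everything by [spanM]. *)
have /choice[phi phiP] (p : M12) : exists psi : W12 -> X,
    is_hom (W' := restrict_right X) psi /\
    forall q1 h' q2, psi (YW q1 h' 0 q2) = F (q1, q2, h') p.
  apply: (spanM w0 (S := fun p => exists psi : W12 -> X,
    is_hom (W' := restrict_right X) psi /\
    forall q1 h' q2, psi (YW q1 h' 0 q2) = F (q1, q2, h') p)).
    move=> c u v [psi [hpsi psiE]] [psi' [hpsi' psiE']].
    exists (fun z => c *: psi z + psi' z); split; first exact: (hom_lin wR).
    by move=> q1 h' q2; rewrite psiE psiE' (FP (q1, q2, h')).1.1.
  move=> p1 h p2; have [H hH HE] := extendW p1 p2 h.
  by exists H; split=> // q1 h' q2; rewrite HE (FP (q1, q2, h')).2.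
(* Each [phi p] is merely chosen. Linearity in p holds on the coefficients of [YW], where [phi] is
   given by the linear maps [F], and these coefficients span W12. *)
have bphi : is_bilinear phi.
  split=> [z c u v|p]; last exact: (phiP p).1.1.
  apply: (spanW m0 (S := fun z => phi (c *: u + v) z = c *: phi u z + phi v z)).
    move=> d z1 z2 E1 E2; rewrite !(phiP _).1.1 E1 E2; lmod_conv K.
  by move=> q1 h' q2; rewrite !(phiP _).2 (FP (q1, q2, h')).1.1.
have fl := tlift_linear bphi.
exists (tlift phi); last first.
  by move=> p1 p2 q1 q2 h h'; rewrite tliftE // (phiP _).2 (FP (q1, q2, h')).2.
apply: (tensor_hom U_voa V_voa t12 wX); split=> // u n t.
  have lT := (act_bilinear t12 n).2 (tpure u (vacuum V)).
  have bL := act_bilinear wL n.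
  elim/tensor_ind: t => [s t sE tE|p q].
    by rewrite [act _ _ _](linD lT) !(linD fl) (bilDr bL) [X in X + _]sE [X in _ + X]tE.
  rewrite [act _ _ _](tensor_act_left m12 w12) !tliftE //.
  apply: (spanW m0 (S := fun q => phi (act u n p) q
    = act (m := restrict_left X) u n (phi p q))).
    by move=> c z1 z2 E1 E2; rewrite !(phiP _).1.1 E1 E2 (bilDr bL) (bilZr bL).
  by move=> q1 h' q2; rewrite !(phiP _).2 (FP (q1, q2, h')).1.2.
have lT := (act_bilinear t12 n).2 (tpure (vacuum U) u).
have bR := act_bilinear wR n.
elim/tensor_ind: t => [s t sE tE|p q].
  by rewrite [act _ _ _](linD lT) !(linD fl) (bilDr bR) [X in X + _]sE [X in _ + X]tE.
rewrite [act _ _ _](tensor_act_right m12 w12) !tliftE //.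
exact: (phiP p).1.2.
Qed.

(** By [iop_levels_eq] only log-free coefficients need comparison; on pure tensors both sides are
    the diagonal sum of [Z]. *)
Let existence : exists f : tensor_module M12 W12 -> X, is_hom f /\
  forall x h k y, f (tensor_iop YM YW x h k y) = Y x h k y.
Proof.
have [f hf fE] := extend; exists f; split=> //.
apply: (iop_levels_eq iT wX iY hf) => x h y.
have bT := iop_bilinear iT h 0; have bY := iop_bilinear iY h 0.
elim/tensor_ind: x => [s t sE tE|p1 q1].
  by rewrite (bilDl bT) (bilDl bY) (linD hf.1) sE tE.
elim/tensor_ind: y => [s t sE tE|p2 q2].
  by rewrite (bilDr bT) (bilDr bY) (linD hf.1) sE tE.
rewrite tensor_iop0 (fsum_lin hf.1); last exact: tensor_iop0_fsupp.
have [_ <-] := split_iop_sum U_voa V_voa w1 w2 wX dW1 dW2 dR iY h p1 q1 p2 q2.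
by apply: eq_fsum => g; rewrite fE.
Qed.

(* The L_U(0)-weights separate the terms of the coefficients of YM (x) YW.    *)
Let uniqueness (f f' : tensor_module M12 W12 -> X) : is_hom f -> is_hom f' ->
  (forall x h k y, f (tensor_iop YM YW x h k y) = Y x h k y) ->
  (forall x h k y, f' (tensor_iop YM YW x h k y) = Y x h k y) -> f = f'.
Proof.
move=> hf hf' fE fE'.
have wtL (f0 : tensor_module M12 W12 -> X) a t : is_hom f0 ->
    gen_eigenspace (Lmode (W := restrict_left (tensor_module M12 W12)) 0) a t ->
    gen_eigenspace (Lmode (W := restrict_left X) 0) a (f0 t).
  move=> [f0l f0h]; apply: (gen_eigen_transport f0l) => z.
  rewrite (linB f0l) (linZ f0l); congr (_ - _).
  exact: (esym (f0h (tpure (conformal U) (vacuum V)) _ _)).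
have coefE p1 p2 q1 q2 g g' : f (tpure (YM p1 g 0 p2) (YW q1 g' 0 q2))
    = f' (tpure (YM p1 g 0 p2) (YW q1 g' 0 q2)).
  have bM := iop_bilinear iM g 0.
  elim/(decomp_ind dM1): p1 => [x y xE yE|a p1 ap1].
    by rewrite (bilDl bM) (bilDl bt) (linD hf.1) (linD hf'.1) xE yE.
  elim/(decomp_ind dM2): p2 => [x y xE yE|b p2 bp2].
    by rewrite (bilDr bM) (bilDl bt) (linD hf.1) (linD hf'.1) xE yE.
  (* [h] indexes the coefficient of YM (x) YW in which the given term occurs, and [T (c - k)] is the
     component of L_U(0)-weight k of that coefficient, since a + b - (c - k) - 1 = k. *)
  pose h := g + g' + 1; pose c := a + b - 1.
  pose T (k : K) := tpure (YM p1 k 0 p2) (YW q1 (h - 1 - k) 0 q2).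
  have fT : fsupp T by exact: tensor_iop0_fsupp.
  have bj : bijective (fun k : K => c - k) by exists (fun k => c - k) => k; ring.
  have wT k : gen_eigenspace (Lmode (W := restrict_left (tensor_module M12 W12)) 0)
      k (T (c - k)).
    have [Tl Th] := tpure_left_hom m12 w12 (YW q1 (h - 1 - (c - k)) 0 q2).
    apply: (gen_eigen_transport (L := Lmode (W := M12) 0) (a := k) Tl) => [z|].
      rewrite (linB Tl) (linZ Tl); congr (_ - _).
      exact: (esym (Th (conformal U) _ _)).
    have := iop_weight m1 m2 m12 iM (c - k) 0 ap1 bp2.
    by have -> : a + b - (c - k) - 1 = k by rewrite /c; ring.
  have sumE (f0 : tensor_module M12 W12 -> X) : is_hom f0 ->
      (forall x h k y, f0 (tensor_iop YM YW x h k y) = Y x h k y) ->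
      fsupp (fun k => f0 (T (c - k))) /\
      \sum_(k \in [set: K]) f0 (T (c - k)) = Y (tpure p1 q1) h 0 (tpure p2 q2).
    move=> [f0l _] f0E; have fc := fsupp_bij bj fT.
    split; first exact: fsupp_lin f0l fc.
    rewrite -(fsum_lin f0l fc) -f0E tensor_iop0; congr f0.
    by rewrite [RHS](@reindex_fsbigT _ _ _ _ _ _ _ bj).
  have [s1 E1] := sumE f hf fE; have [s2 E2] := sumE f' hf' fE'.
  have : (fun k => f (T (c - k))) = (fun k => f' (T (c - k))).
    apply: (decomp_uniq dL s1 s2) => [k|k|]; try exact: wtL.
    by rewrite E1 E2.
  move=> /(congr1 (fun F => F (c - g))) /=; rewrite /T.
  have -> : c - (c - g) = g by ring.
  by have -> : h - 1 - g = g' by rewrite /h; ring.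
apply/funext => t; elim/tensor_ind: t => [s t sE tE|m w].
  by rewrite (linD hf.1) (linD hf'.1) sE tE.
have [->|m0] := eqVneq m 0; first by rewrite (bil0l bt) (lin0 hf.1) (lin0 hf'.1).
have [->|w0] := eqVneq w 0; first by rewrite (bil0r bt) (lin0 hf.1) (lin0 hf'.1).
have ff' c (t u : tensor M12 W12) : f t = f' t -> f u = f' u ->
    f (c *: t + u) = f' (c *: t + u).
  by move=> tE uE; rewrite hf.1 hf'.1 tE uE.
apply: (spanM w0 (S := fun m => f (tpure m w) = f' (tpure m w))) => {m m0}.
  by move=> c u v uE vE; rewrite bt.1; exact: ff'.
(* The coefficient itself serves as the nonzero vector of M12 that [spanW] requires. *)
move=> p1 g p2; set m := YM _ _ _ _.
have [->|m0] := eqVneq m 0; first by rewrite (bil0l bt) (lin0 hf.1) (lin0 hf'.1).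
apply: (spanW m0 (S := fun w => f (tpure m w) = f' (tpure m w))).
  by move=> c u v uE vE; rewrite bt.2; exact: ff'.
by move=> q1 g' q2; exact: coefE.
Qed.

Lemma tensor_fusion_universal : exists! f : tensor_module M12 W12 -> X,
  is_hom f /\ forall x h k y, f (tensor_iop YM YW x h k y) = Y x h k y.
Proof.
have [f fP] := existence; exists f; split=> // f' [hf' fE'].
by case: fP => hf fE; exact: uniqueness.
Qed.

End Target.

Lemma tensor_fusion_product : is_fusion_product catD (tensor_iop YM YW).
Proof.
split; [exact: hii | exact: iT | move=> X Y].
exact: tensor_fusion_universal.
Qed.

End FusionOfTensorProducts.

Unset Implicit Arguments.

Theorem theorem4p3 (R : realType) (U V : voa_data R[i])
  (catU : module_data U -> Prop) (catV : module_data V -> Prop)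
  (catD : module_data (tensor_voa U V) -> Prop)
  (U_voa : is_VOA U) (V_voa : is_VOA V)
  (catU_cat : is_category catU) (catV_cat : is_category catV)
  (catD_cat : is_category catD)
  (hi : forall X, catD X ->
     decomposes (Lmode (W := restrict_left X) 0) /\
     decomposes (Lmode (W := restrict_right X) 0))
  (hii : forall M W, catU M -> catV W -> catD (tensor_module M W))
  (hiiiU : forall M, catU M -> weights_in_finitely_many_cosets M)
  (hiiiV : forall W, catV W -> weights_in_finitely_many_cosets W)
  (hivU : forall (M1 M2 : module_data U) (X : module_data (tensor_voa U V))
     (Y : iop M1 M2 (restrict_left X)),
     catU M1 -> catU M2 -> catD X -> is_intertwining Y ->
     catU (image_module Y))
  (hivV : forall (W1 W2 : module_data V) (X : module_data (tensor_voa U V))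
     (Y : iop W1 W2 (restrict_right X)),
     catV W1 -> catV W2 -> catD X -> is_intertwining Y ->
     catV (image_module Y))
  (M1 M2 M12 : module_data U) (W1 W2 W12 : module_data V)
  (hM1 : catU M1) (hM2 : catU M2) (hW1 : catV W1) (hW2 : catV W2)
  (YM : iop M1 M2 M12) (YW : iop W1 W2 W12)
  (fusM : is_fusion_product catU YM) (fusW : is_fusion_product catV YW) :
  is_fusion_product catD (tensor_iop YM YW).
Proof.
exact: (@tensor_fusion_product _ U V catU catV catD U_voa V_voa catU_cat
  catV_cat catD_cat hi hii hiiiU hiiiV hivU hivV M1 M2 M12 W1 W2 W12
  hM1 hM2 hW1 hW2 YM YW fusM fusW).
Qed.
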